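(* Let $d>1$ and $n$ be positive integers with $d\mid n$. The collection $\{\Sigma_\alpha:\alpha\in A_n^d\}$, ordered by $rr$-lex, is a dual $EL$-ced of $\Pi_n^d$ with respect to the labeling $\lambda$.
   Context: $\Pi_n^d$ is the set of partitions of $[n]$ (other than the one-block partition) whose blocks all have size divisible by $d$, ordered by refinement, with top $\hat1=\{[n]\}$ and bottom $\hat0$ adjoined; it has rank $k=n/d$. Labeling $\lambda$ of cover relations: if $y\gtrdot z$, $z\ne\hat0$, $y$ is obtained by merging blocks $B_1,B_2$ of $z$ with $\max B_1<\max B_2$; $\lambda(y\gtrdot z)=-\max B_1$ if $\max B_1<\min B_2$, else $\max B_1$; and $\lambda(y\gtrdot\hat0)=0$. Write $\alpha\in S_n$ as the word $\alpha(1)\cdots\alpha(n)$; $\operatorname{des}\alpha=\{i:\alpha(i)>\alpha(i+1)\}$. $A_n^d=\{\alpha\in S_n:\alpha(n)=n,\ \operatorname{des}\alpha=\{d,2d,\dots,n-d\}\}$. For $\alpha\in S_n$, choose a subset $I\subseteq\{1,\dots,n/d-1\}$ and for each $i\in I$ choose either to ''split'' or to ''switch-and-split'' at position $di$: first transpose the letters in positions $di,di+1$ for each switch-and-split position, then cut the resulting word at the positions $di$, $i\in I$; the sets of letters of the resulting segments form a $d$-divisible partition. $\Sigma_\alpha$ is the subposet of $\Pi_n^d$ consisting of $\hat0$ and all partitions so obtained. $rr$-lex order on $A_n^d$: compare the reversed words $\alpha(n)\alpha(n-1)\cdots\alpha(1)$ lexicographically, where letters are ordered $n\lhd n-1\lhd\dots\lhd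 1$. A dual $EL$-ced is an $EL$-ced of the dual poset $Q$ (the order reversed, so chains are read from $\hat1=[n]$ downwards), with $\lambda$ viewed as an edge labeling of $Q$; here, for a bounded poset $Q$ of rank $k$ with edge labeling $\mu$ that is an $EL$-labeling (every interval has a unique maximal chain with weakly increasing labels read from its bottom, which is lexicographically first), and an ordered collection $\Sigma_1,\dots,\Sigma_m$ of rank-$k$ subposets, let $\Delta_s$ be the simplicial complex generated by maximal chains lying in $\Sigma_s$ but in no $\Sigma_t$ with $t<s$; a chain is descending if each label is strictly greater than (i.e. not $\le$) the next. The collection is an $EL$-ced if: (polytope) each $\Sigma_s$ is isomorphic to the face lattice of a convex polytope; (desc) for every $s$ and interval $[x,y]$ of $Q$ at most one descending maximal chain of $[x,y]$ is a face of $\Delta_s$; (bdry) any chain of length $<k$ extendable to maximal chains in both $\Delta_s$ and $\Delta_t$ ($t<s$) extends to a maximal chain of $\Sigma_s$ that is not a maximal chain of $\Delta_s$; (union) every chain of $Q$ lies in some $\Sigma_s$. *)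

(* Defs.v *)
From HB Require Import structures.
From mathcomp Require Import all_boot all_order all_algebra all_fingroup.

Set Implicit Arguments.
Unset Strict Implicit.
Unset Printing Implicit Defensive.

Import Order.TTheory.

(* Chains are sets of elements; the labels of a chain are read along its
   increasing enumeration. *)

Section Chains.
Local Open Scope order_scope.
Context {disp : Order.disp_t} {Q : finPOrderType disp}.
Context {ldisp : Order.disp_t} {L : orderType ldisp}.

Definition chain (C : {set Q}) : bool :=
  [forall x in C, forall y in C, x >=< y].

Definition max_chain (S C : {set Q}) : bool :=
  maxset (fun D => chain D && (D \subset S)) C.

Definition interval (x y : Q) : {set Q} := [set z | x <= z <= y].

(* Length of a chain: one less than its cardinality. *)
Definition graded_rank (k : nat) (S : {set Q}) : Prop :=
  forall C, max_chain S C -> #|C| = k.+1.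

Definition bounded_poset : Prop :=
  (exists b : Q, forall x, b <= x) /\ (exists t : Q, forall x, x <= t).

(* An edge labeling is a function of two arguments x, y of which only the values
   with y covering x matter: consecutive elements of a maximal chain of an
   interval form a covering pair. *)
Definition labels (mu : Q -> Q -> L) (C : {set Q}) : seq L :=
  let s := sort <=%O (enum C) in [seq mu e.1 e.2 | e <- zip s (behead s)].

Definition ascending (mu : Q -> Q -> L) (C : {set Q}) : bool :=
  sorted <=%O (labels mu C).

Definition descending (mu : Q -> Q -> L) (C : {set Q}) : bool :=
  sorted >%O (labels mu C).

Definition EL_labeling (mu : Q -> Q -> L) : Prop :=
  forall x y : Q, x <= y ->
  exists C, [/\ max_chain (interval x y) C, ascending mu C
    & forall D, max_chain (interval x y) D -> D != C ->
        ~~ ascending mu D /\ (labels mu C : seqlexi L) < labels mu D].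

(* Facets and faces of the complex generated by the maximal chains that lie in
   the s-th member of Sigmas and in no earlier one. *)
Definition Delta_facet (Sigmas : seq {set Q}) (s : nat) (C : {set Q}) : bool :=
  [&& max_chain [set: Q] C, C \subset nth set0 Sigmas s
    & all (fun S : {set Q} => ~~ (C \subset S)) (take s Sigmas)].

Definition Delta_face (Sigmas : seq {set Q}) (s : nat) (C : {set Q}) : Prop :=
  exists2 F, Delta_facet Sigmas s F & C \subset F.

End Chains.

Arguments bounded_poset {disp} Q.

(* The poset of d-divisible partitions of [n], with a bottom adjoined. The
   element i of [n] = {1, ..., n} is represented by the ordinal i - 1. *)

Definition d_divisible (n d : nat) (p : {set {set 'I_n}}) : bool :=
  partition p [set: 'I_n] && [forall B in p, d %| #|B|].

(* None is the adjoined bottom; for n > 0 and d %| n the one-block partition is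
   d-divisible, and it is the top. *)
Definition dpart (n d : nat) : Type := option {p : {set {set 'I_n}} | d_divisible d p}.

HB.instance Definition _ (n d : nat) := Finite.on (dpart n d).

Definition refines (n : nat) (p q : {set {set 'I_n}}) : bool :=
  [forall B in p, exists C in q, B \subset C].

Definition dpart_le (n d : nat) : rel (dpart n d) := fun x y =>
  match x, y with
  | None, _ => true
  | Some _, None => false
  | Some p, Some q => refines (val p) (val q)
  end.

Lemma refines_refl (n : nat) : reflexive (@refines n).
Proof. by move=> p; apply/forall_inP=> B Bp; apply/exists_inP; exists B. Qed.

Lemma refines_trans (n : nat) : transitive (@refines n).
Proof.
move=> q p r /forall_inP pq /forall_inP qr; apply/forall_inP=> B /pq.
case/exists_inP=> C /qr /exists_inP [D Dr CD] BC.
by apply/exists_inP; exists D => //; apply: subset_trans CD.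
Qed.

Lemma refines_sub (n : nat) (p q : {set {set 'I_n}}) :
  partition p [set: 'I_n] -> refines p q -> refines q p -> p \subset q.
Proof.
case/and3P=> _ tp p0 /forall_inP pq /forall_inP qp; apply/subsetP=> B Bp.
have /exists_inP [C Cq BC] := pq _ Bp.
have /exists_inP [B' B'p CB'] := qp _ Cq.
have BB' : B = B'.
  apply/eqP/negPn/negP=> /(trivIsetP tp _ _ Bp B'p) dBB'.
  have BB : B \subset B' by apply: subset_trans CB'.
  by move: dBB' p0; rewrite -setI_eq0 (setIidPl BB) => /eqP <-; rewrite Bp.
have -> // : B = C.
by apply/eqP; rewrite eqEsubset BC BB' CB'.
Qed.

Lemma dpart_le_refl (n d : nat) : reflexive (@dpart_le n d).
Proof. by case=> [p|] //=; apply: refines_refl. Qed.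

Lemma dpart_le_anti (n d : nat) : antisymmetric (@dpart_le n d).
Proof.
case=> [p|] [q|] //= /andP [pq qp]; congr Some; apply: val_inj; apply/eqP.
have /andP [pp _] := valP p; have /andP [qq _] := valP q.
by rewrite eqEsubset !refines_sub.
Qed.

Lemma dpart_le_trans (n d : nat) : transitive (@dpart_le n d).
Proof. by case=> [p|] [q|] [r|] //=; apply: refines_trans. Qed.

Fact dpart_display : Order.disp_t. Proof. exact: Order.Disp tt tt. Qed.

HB.instance Definition _ (n d : nat) :=
  Order.Le_isPOrder.Build dpart_display (dpart n d)
    (@dpart_le_refl n d) (@dpart_le_anti n d) (@dpart_le_trans n d).

Definition bmax (n : nat) (B : {set 'I_n}) : nat := \max_(i in B) i.+1.
Definition bmin (n : nat) (B : {set 'I_n}) : nat := \big[minn/n]_(i in B) i.+1.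

(* lam y z is the label of the covering relation in which y covers z. *)
Definition lam (n d : nat) (y z : dpart n d) : int :=
  match y, z with
  | Some p, Some q =>
      if [pick BB : {set 'I_n} * {set 'I_n} |
           [&& BB.1 \in val q, BB.2 \in val q, bmax BB.1 < bmax BB.2
             & val p == (BB.1 :|: BB.2) |: (val q :\ BB.1 :\ BB.2)]]
        is Some (B1, B2)
      then if bmax B1 < bmin B2 then (- (bmax B1)%:Z)%R else ((bmax B1)%:Z)%R
      else 0%R
  | _, _ => 0%R
  end.

(* The ordinal i with 0 < i stands for the position i of [n - 1]; the letters in
   the (1-based) positions i and i + 1 are then alpha j with j + 1 = i, and
   alpha i. *)
Definition des (n : nat) (alpha : 'S_n) : {set 'I_n} :=
  [set i : 'I_n | [exists j : 'I_n, (j.+1 == i) && (alpha i < alpha j)]].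

Definition A_set (n d : nat) : {set 'S_n} :=
  [set alpha : 'S_n |
    [forall i : 'I_n, (i.+1 == n) ==> (alpha i == i)]
    && (des alpha == [set i : 'I_n | (0 < i) && (d %| i)])].

Definition word (n : nat) (alpha : 'S_n) : seq 'I_n :=
  [seq alpha i | i <- enum 'I_n].

(* Lexicographic order on reversed words, for the reversed (dual) order on letters. *)
Definition rr_lex (n : nat) : rel 'S_n := fun alpha beta =>
  ((rev (word alpha) : seqlexi ('I_n)^d) <= rev (word beta))%O.

(* Effect on 0-based positions of transposing the 1-based positions di and
   di + 1 for every i in W. *)
Definition switch (n d k : nat) (W : {set 'I_k}) (p : 'I_n) : 'I_n :=
  if [exists i in W, p.+1 == d * i] then insubd p p.+1
  else if [exists i in W, p == d * i :> nat] then insubd p p.-1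
  else p.

(* Two positions lie in the same segment of the word cut after the di-th letter,
   i in I, exactly when they have the same number of cuts on their left. *)
Definition segments (n d k : nat) (I : {set 'I_k}) : {set {set 'I_n}} :=
  preim_partition (fun p : 'I_n => #|[set i in I | d * i <= p]|) [set: 'I_n].

(* I is the set of all the chosen i, and W is the subset of those at which one
   switches and splits. *)
Definition split_partition (n d : nat) (alpha : 'S_n)
    (I W : {set 'I_(n %/ d)}) : {set {set 'I_n}} :=
  [set [set alpha (switch d W p) | p in S] | S : {set 'I_n} in segments n d I].

Definition Sigma (n d : nat) (alpha : 'S_n) : {set dpart n d} :=
  [set x : dpart n d |
    if x is Some p then
      [exists I : {set 'I_(n %/ d)}, exists W : {set 'I_(n %/ d)},
        [&& I \subset [set i : 'I_(n %/ d) | 0 < i], W \subset I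
          & val p == split_partition alpha I W]]
    else true].

Definition Sigmas (n d : nat) : seq {set dpart n d} :=
  [seq Sigma d alpha | alpha <- sort (@rr_lex n) (enum (A_set n d))].

From mathcomp Require Import classical_sets reals.

Section Polytopes.
Local Open Scope ring_scope.
Local Open Scope classical_set_scope.
Context {R : realType}.

(* The points are the rows of V. *)
Definition convex_hull (p m : nat) (V : 'M[R]_(p, m)) : set 'rV[R]_m :=
  [set x | exists w : 'rV[R]_p,
     [/\ forall i, 0 <= w 0 i, \sum_i w 0 i = 1 & x = w *m V]].

Definition polytope (m : nat) (P : set 'rV[R]_m) : Prop :=
  exists (p : nat) (V : 'M[R]_(p, m)), P = convex_hull V.

(* Taking a = 0 makes P itself and the empty set faces of P. *)
Definition face (m : nat) (P F : set 'rV[R]_m) : Prop :=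
  exists (a : 'cV[R]_m) (b : R),
    (forall x, P x -> (x *m a) 0 0 <= b) /\
    F = P `&` [set x | (x *m a) 0 0 = b].

Definition is_face_lattice (disp : Order.disp_t) (Q : finPOrderType disp)
    (S : {set Q}) : Prop :=
  exists (m : nat) (P : set 'rV[R]_m) (f : Q -> set 'rV[R]_m),
  [/\ polytope P,
      forall x, x \in S -> face P (f x),
      forall F, face P F -> exists2 x, x \in S & f x = F
    & {in S &, forall x y, (x <= y)%O <-> f x `<=` f y}].

End Polytopes.

Arguments is_face_lattice R {disp Q} S.

(* (Q, mu) is required to be a bounded poset of rank k with an EL-labeling, and
   the members of Sg to be subposets of rank k, as part of the definition.
   A chain has length < k exactly when it has fewer than k + 1 elements. *)
Record EL_ced (R : realType) (disp : Order.disp_t) (Q : finPOrderType disp)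
    (ldisp : Order.disp_t) (L : orderType ldisp)
    (k : nat) (mu : Q -> Q -> L) (Sg : seq {set Q}) : Prop := {
  ced_bounded : bounded_poset Q;
  ced_rank : graded_rank k [set: Q]%SET;
  ced_EL : EL_labeling mu;
  ced_subrank : forall S, S \in Sg -> graded_rank k S;
  ced_polytope : forall S, S \in Sg -> is_face_lattice R S;
  ced_desc : forall (s : nat) (x y : Q) (C D : {set Q}),
    s < size Sg -> (x <= y)%O ->
    max_chain (interval x y) C -> max_chain (interval x y) D ->
    descending mu C -> descending mu D ->
    Delta_face Sg s C -> Delta_face Sg s D -> C = D;
  ced_bdry : forall (s t : nat) (C : {set Q}),
    s < size Sg -> t < s -> chain C -> #|C| < k.+1 ->
    Delta_face Sg s C -> Delta_face Sg t C ->
    exists F : {set Q}, [/\ max_chain (nth finset.set0 Sg s) F, C \subset F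
                          & ~~ Delta_facet Sg s F];
  ced_union : forall C : {set Q}, chain C ->
    exists2 S, S \in Sg & C \subset S
}.

(* An edge of the dual goes from x to y when x covers y in Q. *)
Definition dual_EL_ced (R : realType) (disp : Order.disp_t)
    (Q : finPOrderType disp) (ldisp : Order.disp_t) (L : orderType ldisp)
    (k : nat) (lambda : Q -> Q -> L) (Sg : seq {set Q}) : Prop :=
  @EL_ced R _ Q^d _ L k lambda Sg.

(* Main.v *)
(** Choosing a set [I] of cuts and a subset [W] of switches for [alpha] amounts to
    choosing a sign vector on the [n/d - 1] cuts, and refinement is inclusion of
    sign vectors; so, dually, [Sigma alpha] is the face lattice of a
    cross-polytope.

    In each interval of the dual order a unique atom carries the least label: if
    some block can be cut into two non-crossing parts, it is such a cut with the
    largest separating maximum; otherwise it splits off the block of the refined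
    end of the interval which has the smallest new maximum. Every other atom is
    necessarily followed by a descent, hence the labeling is an EL-labeling.

    A chain [C] is assigned the word [gamma C]: sort the letters lexicographically
    by the maxima of their blocks in the members of [C], from coarse to fine, and
    switch at the ascents between consecutive runs of length [d]. Among the words
    whose [Sigma] contains [C], [gamma C] is the rr-lex first. Therefore the
    facets of the [alpha]-th complex are the maximal chains [F] with
    [gamma F = alpha]. A descending chain between two of the elements of such a
    facet is determined by [alpha], and if [gamma C] differs from [alpha], some
    inversion of [alpha] with respect to the order attached to [C] persists in a
    maximal chain of [Sigma alpha] which extends [C]. *)

From mathcomp Require Import all_boot all_order all_algebra all_fingroup.
From mathcomp Require Import zify.
From mathcomp Require classical_sets.
From mathcomp Require Import reals.
Require Import Defs.

Set Implicit Arguments.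
Unset Strict Implicit.
Unset Printing Implicit Defensive.

Import Order.TTheory.

(** * Maximal chains and EL-labelings of ranked posets *)

Section Ranked.
Local Open Scope order_scope.
Context {disp : Order.disp_t} {P : finPOrderType disp}.
Context {ldisp : Order.disp_t} {L : orderType ldisp}.
Implicit Types (C D S : {set P}) (x y z : P) (mu : P -> P -> L).

(** The delicate point is that [gamma F = alpha] determines neither [F] nor its switches, so two
    facets of one complex carry two orders [prec F] and [prec F']. A common member [y] other than
    the bottom fixes the cuts and switches that produce it, so the two orders agree on letters that
    [y] separates, and this is enough above [y]: suppose two descending chains part with different
    new maxima, and let [m] be that of the step with the larger label. The other chain creates [m]
    later, with a smaller label; both labels being [m.+1] up to sign, the first is positive and the
    second negative. A letter witnessing the positive sign then forces, in the other chain, a step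
    with new maximum at least [m] and label strictly between these two, which is absurd. If the
    interval ends at the bottom, no such [y] is given. But then the last label is 0 and the others
    are positive; with the descent this forces every ascent of the sorted word to be a cut of the
    upper end [x]. So [x] and [alpha] determine all switches, hence the last partition before the
    bottom, which serves as [y]. *)

Lemma chainP C : reflect {in C &, forall x y, x >=< y} (chain C).
Proof.
apply: (iffP forall_inP) => [h x y xC yC|h x xC].
  by have /forall_inP := h x xC; apply.
by apply/forall_inP => y yC; apply: h.
Qed.

Lemma sub_chain C D : D \subset C -> chain C -> chain D.
Proof.
move=> /subsetP DC /chainP cC; apply/chainP => x y /DC xC /DC yC; exact: cC.
Qed.

Lemma chainU1 x C : chain C -> {in C, forall y, x >=< y} -> chain (x |: C).
Proof.
move=> /chainP cC xC; apply/chainP => a b /setU1P [->|aC] /setU1P [->|bC].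
- exact: comparablexx.
- exact: xC.
- by rewrite comparable_sym; apply: xC.
- exact: cC.
Qed.

Lemma max_chainP S C : reflect [/\ chain C, C \subset S &
    forall z, z \in S -> {in C, forall y, z >=< y} -> z \in C] (max_chain S C).
Proof.
apply: (iffP maxsetP) => [[/andP [cC CS] mC]|[cC CS mC]].
  split=> // z zS zC; rewrite -(mC (z |: C)) ?setU11 ?subsetUr //.
  by rewrite chainU1 // subUset sub1set zS.
split=> [|D /andP [/chainP cD /subsetP DS] CD]; first by rewrite cC.
apply/eqP; rewrite eqEsubset CD andbT; apply/subsetP => z zD.
by apply: mC => [|y yC]; [exact: DS | apply: cD => //; apply: (subsetP CD)].
Qed.

Lemma chain_extend S C : chain C -> C \subset S ->
  exists2 D, max_chain S D & C \subset D.
Proof.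
move=> cC CS.
set p := fun D : {set P} => chain D && (D \subset S).
have SC : p C by rewrite /p cC.
by have [D mD CD] := @maxset_exists _ p C SC; exists D.
Qed.

Variables (rk : P -> nat).
Hypothesis rk_lt : forall x y, x < y -> (rk x < rk y)%N.

(** Given the strict monotonicity of [rk], this makes [S] graded by [rk]. It is stated for a subset
    since it serves for the whole poset, for its intervals and for each [Sigma]. *)
Definition gapless S := forall x y, x \in S -> y \in S -> x < y ->
  ((rk x).+1 < rk y)%N -> exists2 z, z \in S & x < z < y.

Lemma rk_le x y : x <= y -> (rk x <= rk y)%N.
Proof. by rewrite le_eqVlt => /predU1P [->//|/rk_lt/ltnW]. Qed.

Lemma rk_chain_lt C x y : chain C -> x \in C -> y \in C ->
  (rk x < rk y)%N -> x < y.
Proof.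
move=> /chainP cC xC yC xy; have /orP [] := cC _ _ xC yC.
  by rewrite le_eqVlt => /predU1P [E|//]; rewrite E ltnn in xy.
by move=> /rk_le; rewrite leqNgt xy.
Qed.

Lemma rk_chain_inj C : chain C -> {in C &, injective rk}.
Proof.
move=> cC x y xC yC E; have /orP [] := chainP _ cC _ _ xC yC.
  by rewrite le_eqVlt => /predU1P [//|/rk_lt]; rewrite E ltnn.
by rewrite le_eqVlt => /predU1P [//|/rk_lt]; rewrite E ltnn.
Qed.

Lemma rk_chain_le C x y : chain C -> x \in C -> y \in C ->
  (rk x <= rk y)%N -> x <= y.
Proof.
move=> cC xC yC; rewrite leq_eqVlt => /predU1P [/(rk_chain_inj cC xC yC) ->//|].
by move=> /(rk_chain_lt cC xC yC)/ltW.
Qed.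

Section Full.
Variables (S : {set P}) (b t : P).
Hypotheses (bS : b \in S) (tS : t \in S).
Hypotheses (b_le : {in S, forall x, b <= x}) (le_t : {in S, forall x, x <= t}).
Hypothesis gapS : gapless S.

Lemma max_chain_bot C : max_chain S C -> b \in C.
Proof.
case/max_chainP => cC CS; apply=> // y yC.
by rewrite /Order.comparable b_le // (subsetP CS).
Qed.

Lemma max_chain_top C : max_chain S C -> t \in C.
Proof.
case/max_chainP => cC CS; apply=> // y yC.
by rewrite /Order.comparable orbC le_t // (subsetP CS).
Qed.

(** If rank [r] were missing, an element [z] between the last member below rank [r] and the first
    one above it would be comparable to all of [C], hence in [C] by maximality, and its rank would
    contradict one of the two choices. *)
Lemma max_chain_rank C r : max_chain S C -> (rk b <= r <= rk t)%N ->
  exists2 x, x \in C & rk x = r.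
Proof.
move=> mC /andP [br rt]; have [cC CS maxC] := max_chainP _ _ mC.
case: (boolP [exists x in C, rk x == r]) => [/exists_inP [x xC /eqP]|].
  by exists x.
rewrite negb_exists_in => /forall_inP noC.
have bC := max_chain_bot mC; have tC := max_chain_top mC.
have lb : (b \in C) && (rk b < r)%N by rewrite bC ltn_neqAle br noC.
have lt : (t \in C) && (r < rk t)%N by rewrite tC ltn_neqAle rt eq_sym noC.
case: (@arg_maxnP _ b (fun x => (x \in C) && (rk x < r)%N) rk lb).
move=> x /andP [xC xr] xmax.
case: (@arg_minnP _ t (fun x => (x \in C) && (r < rk x)%N) rk lt).
move=> y /andP [yC yr] ymin.
have xy : x < y by apply: rk_chain_lt cC _ _ _ => //; apply: ltn_trans yr.
have [|z zS /andP [xz zy]] :=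
  gapS (subsetP CS _ xC) (subsetP CS _ yC) xy; first by apply: leq_ltn_trans yr.
exfalso; have zC : z \in C.
  apply: maxC => // w wC; have := noC _ wC; rewrite neq_ltn => /orP [] wr.
    have wx : w <= x by apply: (rk_chain_le cC) => //; apply: xmax; rewrite wC.
    by rewrite /Order.comparable orbC (le_trans wx) // ltW.
  have yw : y <= w by apply: (rk_chain_le cC) => //; apply: ymin; rewrite wC.
  by rewrite /Order.comparable (ltW (lt_le_trans zy yw)).
have := noC _ zC; rewrite neq_ltn => /orP [] zr.
  have := xmax z; rewrite zC zr => /(_ isT) /=.
  by rewrite leqNgt (rk_lt xz).
have := ymin z; rewrite zC zr => /(_ isT) /=.
by rewrite leqNgt (rk_lt zy).
Qed.

Lemma max_chain_card C : rk b = 0%N -> max_chain S C -> #|C| = (rk t).+1.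
Proof.
move=> b0 mC; have [cC CS _] := max_chainP _ _ mC.
have rC x : x \in C -> (rk x < (rk t).+1)%N.
  by move=> xC; rewrite ltnS rk_le // le_t // (subsetP CS).
rewrite -[RHS]card_ord -cardsT.
have <- : (fun x => inord (rk x) : 'I_(rk t).+1) @: C = [set: 'I_(rk t).+1].
  apply/setP => r; rewrite inE; apply/imsetP.
  have [|x xC xr] := @max_chain_rank C r mC; first by rewrite b0 /= -ltnS ltn_ord.
  by exists x => //; rewrite xr inord_val.
rewrite card_in_imset // => x y xC yC /(congr1 val).
by rewrite /= (inordK (rC _ xC)) (inordK (rC _ yC)); apply: (rk_chain_inj cC).
Qed.

End Full.

Hypothesis gapT : gapless [set: P].

Lemma mem_interval x y z : (z \in interval x y) = (x <= z <= y).
Proof. by rewrite inE. Qed.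

Lemma gap_interval x y : gapless (interval x y).
Proof.
move=> u v; rewrite !mem_interval => /andP [xu _] /andP [_ vy] uv rkuv.
have [z _ /andP [uz zv]] := gapT (in_setT u) (in_setT v) uv rkuv.
exists z; rewrite ?uz // mem_interval.
by rewrite (le_trans xu (ltW uz)) (le_trans (ltW zv) vy).
Qed.

Section IntervalBounds.
Variables x y : P.
Hypothesis xy : x <= y.

Lemma interval_bot : x \in interval x y.
Proof. by rewrite mem_interval lexx. Qed.

Lemma interval_top : y \in interval x y.
Proof. by rewrite mem_interval lexx xy. Qed.

Lemma interval_ge : {in interval x y, forall z, x <= z}.
Proof. by move=> z; rewrite mem_interval => /andP []. Qed.

Lemma interval_le : {in interval x y, forall z, z <= y}.
Proof. by move=> z; rewrite mem_interval => /andP []. Qed.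

Lemma max_chain_int_rank C r : max_chain (interval x y) C ->
  (rk x <= r <= rk y)%N -> exists2 z, z \in C & rk z = r.
Proof.
exact: (max_chain_rank interval_bot interval_top interval_ge interval_le
  (@gap_interval x y)).
Qed.

Lemma max_chain_int_bot C : max_chain (interval x y) C -> x \in C.
Proof. exact: (max_chain_bot interval_bot interval_ge). Qed.

Lemma max_chain_int_top C : max_chain (interval x y) C -> y \in C.
Proof. exact: (max_chain_top interval_top interval_le). Qed.

End IntervalBounds.

Definition atom x y b := (x < b <= y) && (rk b == (rk x).+1).

Lemma atom_lt x y b : atom x y b -> x < b.
Proof. by case/andP => /andP []. Qed.

Lemma atom_le x y b : atom x y b -> b <= y.
Proof. by case/andP => /andP []. Qed.

Lemma atom_rk x y b : atom x y b -> rk b = (rk x).+1.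
Proof. by case/andP => _ /eqP. Qed.

Lemma max_chain_int1 x C : max_chain (interval x x) C <-> C = [set x].
Proof.
split=> [mC|->].
  have [_ /subsetP CS _] := max_chainP _ _ mC.
  apply/setP => z; rewrite inE; apply/idP/eqP => [/CS|->].
    by rewrite mem_interval => zx; apply/le_anti; rewrite andbC.
  exact: max_chain_int_bot mC.
apply/max_chainP; split=> [||z].
- by apply/chainP => a b /set1P -> /set1P ->; apply: comparablexx.
- by rewrite sub1set interval_bot.
- by rewrite mem_interval => zx _; rewrite inE; apply/eqP/le_anti; rewrite andbC.
Qed.

Lemma max_chain_intU x y b C : atom x y b ->
  max_chain (interval b y) C -> max_chain (interval x y) (x |: C).
Proof.
move=> bA mC; have [cC CS maxC] := max_chainP _ _ mC.
have xb := atom_lt bA; have by_ := atom_le bA.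
have xC z : z \in C -> x < z.
  by move/(subsetP CS); rewrite mem_interval => /andP [/(lt_le_trans xb)].
apply/max_chainP; split.
- by apply: chainU1 => // z /xC/ltW xz; rewrite /Order.comparable xz.
- apply/subsetP => z /setU1P [->|zC].
    by rewrite interval_bot // ltW // (lt_le_trans xb).
  by have := subsetP CS _ zC; rewrite !mem_interval (ltW (xC _ zC)) => /andP [].
move=> z; rewrite mem_interval => /andP [xz zy] cz; rewrite in_setU1.
case: eqVneq => //= zx; apply: maxC; last first.
  by move=> w wC; apply: cz; rewrite setU1r.
rewrite mem_interval zy andbT.
have xz' : x < z by rewrite lt_neqAle eq_sym zx.
have /orP [] // := cz b (setU1r _ (max_chain_int_bot by_ mC)).
rewrite le_eqVlt => /predU1P [->//|/rk_lt].
by rewrite (atom_rk bA) ltnS leqNgt rk_lt.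
Qed.

Lemma max_chain_intE x y C : x < y -> max_chain (interval x y) C ->
  exists b D, [/\ atom x y b, C = x |: D & max_chain (interval b y) D].
Proof.
move=> xy mC; have [cC CS maxC] := max_chainP _ _ mC.
have [|b bC rb] := max_chain_int_rank (ltW xy) mC (r := (rk x).+1).
  by rewrite leqnSn rk_lt.
have xC := max_chain_int_bot (ltW xy) mC.
have by_ : b <= y by have := subsetP CS _ bC; rewrite mem_interval => /andP [].
have bA : atom x y b.
  by rewrite /atom by_ rb eqxx !andbT; apply: (rk_chain_lt cC); rewrite ?rb.
exists b, (C :\ x); split=> //; first by rewrite setD1K.
apply/max_chainP; split=> [||z].
- by apply: sub_chain cC; apply: subD1set.
- apply/subsetP => z /setD1P [zx zC].
  have := subsetP CS _ zC; rewrite !mem_interval => /andP [xz ->].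
  rewrite andbT; apply: (rk_chain_le cC) => //.
  by rewrite rb; apply: rk_lt; rewrite lt_neqAle eq_sym zx.
rewrite mem_interval => /andP [bz zy] cz.
have xz := lt_le_trans (atom_lt bA) bz.
rewrite in_setD1 (gt_eqF xz) /=; apply: maxC.
  by rewrite mem_interval zy ltW.
move=> w wC; case: (eqVneq w x) => [->|wx].
  by rewrite /Order.comparable (ltW xz) orbT.
by apply: cz; rewrite in_setD1 wx.
Qed.

Lemma sort_chain C s : chain C -> sorted <%O s -> s =i C ->
  sort <=%O (enum C) = s.
Proof.
move=> /chainP cC ss sC; apply: (sorted_eq le_trans le_anti).
- apply: (@sort_sorted_in _ (mem C)) => [a b aC bC|]; first exact: cC.
  by apply/allP => a; rewrite mem_enum.
- by move: ss; rewrite lt_sorted_uniq_le => /andP [].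
rewrite perm_sort; apply: uniq_perm; first exact: enum_uniq.
  by move: ss; rewrite lt_sorted_uniq_le => /andP [].
by move=> a; rewrite mem_enum sC.
Qed.

Lemma lt_sorted_sort C : chain C -> sorted <%O (sort <=%O (enum C)).
Proof.
move=> /chainP cC; rewrite lt_sorted_uniq_le sort_uniq enum_uniq.
apply: (@sort_sorted_in _ (mem C)) => [a b aC bC|]; first exact: cC.
by apply/allP => a; rewrite mem_enum.
Qed.

Lemma sort_chainU1 x C : chain C -> {in C, forall z, x < z} ->
  sort <=%O (enum (x |: C)) = x :: sort <=%O (enum C).
Proof.
move=> cC xC; apply: sort_chain.
- by apply: chainU1 => // z /xC /ltW xz; rewrite /Order.comparable xz.
- rewrite /= path_sortedE; last exact: lt_trans.
  rewrite lt_sorted_sort // andbT; apply/allP => z.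
  by rewrite mem_sort mem_enum => /xC.
by move=> z; rewrite in_setU1 inE mem_sort mem_enum.
Qed.

Lemma max_chain_above x y b C : atom x y b -> max_chain (interval b y) C ->
  {in C, forall z, x < z}.
Proof.
move=> bA /max_chainP [_ CS _] z /(subsetP CS).
by rewrite mem_interval => /andP [/(lt_le_trans (atom_lt bA))].
Qed.

Lemma head_max_chain b y C : b <= y -> max_chain (interval b y) C ->
  exists s, sort <=%O (enum C) = b :: s.
Proof.
move=> by_ mC; have [cC CS _] := max_chainP _ _ mC.
exists (sort <=%O (enum (C :\ b))).
rewrite -{1}(setD1K (max_chain_int_bot by_ mC)); apply: sort_chainU1.
  by apply: sub_chain cC; apply: subD1set.
move=> z /setD1P [zb /(subsetP CS)]; rewrite mem_interval => /andP [bz _].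
by rewrite lt_neqAle eq_sym zb.
Qed.

Lemma labels_cons mu x y b C : atom x y b -> max_chain (interval b y) C ->
  labels mu (x |: C) = mu x b :: labels mu C.
Proof.
move=> bA mC; have [cC _ _] := max_chainP _ _ mC.
rewrite /labels (sort_chainU1 cC (max_chain_above bA mC)).
by have [s ->] := head_max_chain (atom_le bA) mC.
Qed.

Lemma labels_set1 mu x : labels mu [set x] = [::].
Proof.
rewrite /labels (@sort_chain _ [:: x]) //; last by move=> z; rewrite !inE.
by apply/chainP => a b /set1P -> /set1P ->; apply: comparablexx.
Qed.

Lemma interval_ind (T : P -> P -> {set P} -> Prop) :
  (forall x, T x x [set x]) ->
  (forall x y b C, atom x y b -> max_chain (interval b y) C -> T b y C ->
     T x y (x |: C)) ->
  forall x y C, x <= y -> max_chain (interval x y) C -> T x y C.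
Proof.
move=> T0 T1 x y C; move: {2}(rk y - rk x)%N (leqnn (rk y - rk x)%N) => m.
elim: m x C => [|m IHm] x C le_m xy mC; case: (eqVneq x y) => [E|nxy].
- by move: mC; rewrite -E => /max_chain_int1 ->.
- have : x < y by rewrite lt_neqAle nxy.
  by move/rk_lt; rewrite -subn_gt0 ltnNge le_m.
- by move: mC; rewrite -E => /max_chain_int1 ->.
have ltxy : x < y by rewrite lt_neqAle nxy.
have [b [D [bA -> mD]]] := max_chain_intE ltxy mC.
apply: (T1 _ _ b) => //; apply: IHm (atom_le bA) mD.
have := rk_le (atom_le bA); have := atom_rk bA; have := rk_lt ltxy; lia.
Qed.

Definition step C g h := [&& g \in C, h \in C, g < h & rk h == (rk g).+1].

Lemma step_cases x y b C g h : atom x y b -> max_chain (interval b y) C ->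
  step (x |: C) g h -> (g = x /\ h = b) \/ step C g h.
Proof.
move=> bA mC /and4P [/setU1P gC /setU1P hC gh rh].
have xC := max_chain_above bA mC.
have [cC _ _] := max_chainP _ _ mC.
case: hC => [E|hC].
  case: gC => [E'|/xC]; first by rewrite E E' ltxx in gh.
  by rewrite -E => /(lt_trans gh); rewrite ltxx.
case: gC => [E|gC]; last by right; apply/and4P.
left; split=> //; apply: (rk_chain_inj cC) => //.
  exact: (max_chain_int_bot (atom_le bA) mC).
by rewrite (eqP rh) E (atom_rk bA).
Qed.

Lemma step_labels mu x y C g h : x <= y -> max_chain (interval x y) C ->
  step C g h -> mu g h \in labels mu C.
Proof.
move=> xy mC; move: x y C xy mC g h.
apply: interval_ind => [x|x y b C bA mC IH] g h.
  by case/and4P => /set1P -> /set1P ->; rewrite ltxx.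
rewrite (labels_cons _ bA mC) inE.
by case/(step_cases bA mC) => [[-> ->]|/IH ->]; rewrite ?eqxx ?orbT.
Qed.

Lemma descending_steps mu x y C g h g' h' : x <= y ->
  max_chain (interval x y) C -> descending mu C ->
  step C g h -> step C g' h' -> h <= g' -> mu g' h' < mu g h.
Proof.
move=> xy mC; move: x y C xy mC g h g' h'; rewrite /descending.
apply: interval_ind => [x|x y b C bA mC IH] g h g' h'.
  by move=> _ /and4P [/set1P -> /set1P ->]; rewrite ltxx.
rewrite (labels_cons _ bA mC) /= path_sortedE; last first.
  by move=> ? ? ? ab bc; apply: lt_trans ab.
move=> /andP [/allP lt_b sC] /(step_cases bA mC) [[-> ->]|st].
  case/(step_cases bA mC) => [[-> _]|st' _]; first by rewrite (lt_geF (atom_lt bA)).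
  exact/lt_b/(step_labels _ (atom_le bA) mC).
case/(step_cases bA mC) => [[-> _]|]; last exact: IH.
have /and4P [_ /(max_chain_above bA mC) xh _ _] := st.
by rewrite (lt_geF xh).
Qed.

(** The chain through [a] ascends by the third clause and induction. A chain through another atom
    [b] does not: an ascending tail would be the lexicographically first chain above [b], whose
    first label is at most [mu b c], hence below [mu x b]. *)
Lemma EL_criterion mu :
  (forall x y, x < y -> exists a, [/\ atom x y a,
     forall b, atom x y b -> b != a -> mu x a < mu x b,
     forall c, atom a y c -> mu x a <= mu a c
   & forall b, atom x y b -> b != a -> exists2 c, atom b y c & mu b c < mu x b]) ->
  EL_labeling mu.
Proof.
move=> H x y; move: {2}(rk y - rk x)%N (leqnn (rk y - rk x)%N) => m.
elim: m x => [|m IHm] x le_m xy; case: (eqVneq x y) => [E|nxy].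
- exists [set x]; rewrite -E; split; first exact/max_chain_int1.
    by rewrite /ascending labels_set1.
  by move=> D /max_chain_int1 ->; rewrite eqxx.
- have : x < y by rewrite lt_neqAle nxy.
  by move/rk_lt; rewrite -subn_gt0 ltnNge le_m.
- exists [set x]; rewrite -E; split; first exact/max_chain_int1.
    by rewrite /ascending labels_set1.
  by move=> D /max_chain_int1 ->; rewrite eqxx.
have ltxy : x < y by rewrite lt_neqAle nxy.
have [a [aA a_min a_asc a_desc]] := H _ _ ltxy.
have IH b : atom x y b -> exists C, [/\ max_chain (interval b y) C,
    ascending mu C & forall D, max_chain (interval b y) D -> D != C ->
    ~~ ascending mu D /\ (labels mu C : seqlexi L) < labels mu D].
  move=> bA; apply: IHm (atom_le bA).
  have := rk_le (atom_le bA); have := atom_rk bA; have := rk_lt ltxy; lia.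
have [C [mC aC uC]] := IH a aA.
exists (x |: C); split; first exact: max_chain_intU mC.
  rewrite /ascending (labels_cons _ aA mC) /= path_sortedE; last exact: le_trans.
  have := aC; rewrite /ascending => sC; rewrite sC andbT.
  move: (atom_le aA); rewrite le_eqVlt => /predU1P [E|ay].
    by move: mC; rewrite -E => /max_chain_int1 ->; rewrite labels_set1.
  have [c [C' [cA EC mC']]] := max_chain_intE ay mC.
  move: sC; rewrite EC (labels_cons _ cA mC') /= path_sortedE; last exact: le_trans.
  move=> /andP [/allP le_c _]; rewrite a_asc //=.
  by apply/allP => l /le_c; apply: le_trans; apply: a_asc.
move=> D mD nDC; have [b [D' [bA ED mD']]] := max_chain_intE ltxy mD.
rewrite {}ED in nDC *; rewrite /ascending (labels_cons _ aA mC) (labels_cons _ bA mD').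
rewrite ltxi_cons /=.
case: (eqVneq b a) => [E|nba].
  have nD : D' != C by apply: contraNneq nDC => ->.
  rewrite E in mD' *; have [nasc lt_l] := uC _ mD' nD.
  rewrite lexx lt_l; split=> //; apply: contra nasc.
  exact: path_sorted.
rewrite (ltW (a_min _ bA nba)) /= leNgt (a_min _ bA nba) /=; split=> //.
have [c cA ltc] := a_desc _ bA nba.
have lt_by : b < y by apply: lt_le_trans (atom_lt cA) (atom_le cA).
have [c' [D'' [cA' ED mD'']]] := max_chain_intE lt_by mD'.
have [C' [mC' aC' uC']] := IH b bA.
apply/negP => asc.
have ED' : D' = C'.
  apply/eqP/negPn/negP => /(uC' _ mD') [/negP nasc _].
  exact/nasc/(path_sorted asc).
have [E mE _] : exists2 E, max_chain (interval c y) E & set0 \subset E.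
  by apply: chain_extend; rewrite ?sub0set //; apply/chainP => z; rewrite inE.
have le_c : mu b c' <= mu b c.
  have := labels_cons mu cA' mD''; rewrite -ED ED' => lC'.
  have := uC' _ (max_chain_intU cA mE).
  case: eqVneq => [E0 _|_ /(_ isT) [_]].
    by move: lC'; rewrite -E0 (labels_cons mu cA mE) => -[->].
  by rewrite lC' (labels_cons mu cA mE) ltxi_cons => /andP [].
move: asc; rewrite ED (labels_cons _ cA' mD'') /= => /andP [].
by move=> /le_trans/(_ le_c); rewrite leNgt ltc.
Qed.

End Ranked.

(** * Integer labels up to sign *)

Section SignedLabels.
Local Open Scope ring_scope.
Implicit Types (i j : nat) (l : int).

(** Letters are 0-based ordinals, so a step with new maximum [i] has the label [i.+1] up to sign. *)
Definition signed i l := l = - (i.+1)%:Z \/ l = (i.+1)%:Z.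

Lemma signed_neq0 i l : signed i l -> l != 0.
Proof. by case=> ->; lia. Qed.

Lemma signed_inj i j l : signed i l -> signed j l -> i = j.
Proof. by case=> -> []; lia. Qed.

Lemma signed_pos i l : signed i l -> 0 <= l -> l = (i.+1)%:Z.
Proof. by case=> ->; lia. Qed.

Lemma signed_gt0 i l : signed i l -> 0 <= l -> 0 < l.
Proof. by case=> ->; lia. Qed.

Lemma lab_neg i : - (i.+1)%:Z < 0 :> int.
Proof. lia. Qed.

Lemma lab_pos i : 0 < (i.+1)%:Z :> int.
Proof. lia. Qed.

Lemma lab_le i j : ((i.+1)%:Z <= (j.+1)%:Z :> int) = (i <= j)%N.
Proof. lia. Qed.

Lemma lab_lt i j : ((i.+1)%:Z < (j.+1)%:Z :> int) = (i < j)%N.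
Proof. lia. Qed.

Lemma lab_ltN i j : (- (i.+1)%:Z < - (j.+1)%:Z :> int) = (j < i)%N.
Proof. lia. Qed.

Lemma signed_ltN i j l : signed j l -> l < - (i.+1)%:Z -> (i < j)%N.
Proof. by case=> ->; lia. Qed.

Lemma signed_lt_neg i j l l' : signed i l -> signed j l' -> (i < j)%N ->
  l' < l -> l' < 0.
Proof. by case=> -> [] ->; lia. Qed.

Lemma signed_pair i l l' : signed i l -> signed i l' -> l < l' ->
  l = - (i.+1)%:Z /\ l' = (i.+1)%:Z.
Proof. by case=> -> [] ->; split=> //; lia. Qed.

Lemma signed_between i j l : signed j l -> - (i.+1)%:Z < l -> l < (i.+1)%:Z ->
  (j < i)%N.
Proof. by case=> ->; lia. Qed.

End SignedLabels.

(** * The rr-lex order *)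

Section RRLex.
Variable n : nat.
Implicit Types (alpha beta : 'S_n) (p q : 'I_n).

Lemma lexi_cat_lt {disp : Order.disp_t} (T : orderType disp) (u s t : seq T) (x y : T) :
  (x < y)%O -> ((u ++ x :: s : seqlexi T) <= u ++ y :: t)%O.
Proof.
move=> xy; elim: u => [|z u IHu] /=; last by rewrite lexi_cons lexx IHu.
by rewrite lexi_cons (ltW xy) leNgt xy.
Qed.

Lemma rev_word alpha p : rev (word alpha) =
  rev (drop p.+1 (word alpha)) ++ alpha p :: rev (take p (word alpha)).
Proof.
have szE : size (enum 'I_n) = n by rewrite size_enum_ord.
have E : nth (alpha p) (word alpha) p = alpha p.
  by rewrite (nth_map p) ?szE // nth_ord_enum.
have sz : p < size (word alpha) by rewrite size_map szE.
rewrite -{1}(cat_take_drop p (word alpha)) (drop_nth (alpha p) sz).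
by rewrite E rev_cat rev_cons cat_rcons.
Qed.

(** Reversal of the words makes the last difference decisive, and the reversed order on letters lets
    the larger letter come first. *)
Lemma rr_lexP alpha beta p : (forall q : 'I_n, p < q -> alpha q = beta q) ->
  beta p < alpha p -> rr_lex alpha beta.
Proof.
move=> agree lt; rewrite /rr_lex (rev_word alpha p) (rev_word beta p).
have -> : drop p.+1 (word alpha) = drop p.+1 (word beta).
  rewrite -map_drop -[RHS]map_drop; apply/eq_in_map => q qd; apply: agree.
  have : val q \in drop p.+1 (iota 0 n).
    by rewrite -val_enum_ord -map_drop; apply: map_f.
  by rewrite drop_iota mem_iota add0n => /andP [].
apply: lexi_cat_lt; exact: lt.
Qed.

Lemma word_inj : injective (@word n).
Proof.
move=> alpha beta /eq_in_map E; apply/permP => p; apply: E.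
by rewrite mem_enum.
Qed.

Lemma rr_lex_anti : antisymmetric (@rr_lex n).
Proof. by move=> alpha beta /le_anti /(can_inj revK)/word_inj. Qed.

Lemma rr_lex_trans : transitive (@rr_lex n).
Proof. by move=> beta alpha delta; apply: le_trans. Qed.

Lemma rr_lex_total : total (@rr_lex n).
Proof. by move=> alpha beta; apply: le_total. Qed.

Lemma rr_lex_refl : reflexive (@rr_lex n).
Proof. by move=> alpha; apply: lexx. Qed.
End RRLex.

(** * Cross-polytopes *)

Section CrossPolytope.
Import GRing.Theory Num.Theory classical_sets.
Local Open Scope ring_scope.
Local Open Scope classical_set_scope.
Context {R : realType} (m : nat) (C : {set 'I_m}).
Implicit Types (v : 'rV[R]_m) (i : 'I_m) (I J W V : {set 'I_m}).

Definition dot (s : 'I_m -> R) (v : 'rV[R]_m) : R := \sum_i s i * v 0 i.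

(** Rows outside [C] are zero, so all coordinates are kept without reindexing. In the application
    [m] is [n %/ d] and [C] consists of the nonzero indices, 0 not being a cut. *)
Definition axes : 'M[R]_m := \matrix_(i, j) ((i == j) && (i \in C))%:R.

(* The origin is there only to make this a point, not empty, when [C] is empty. *)
Definition cross : set 'rV[R]_m :=
  convex_hull (col_mx (0 : 'rV[R]_m) (col_mx axes (- axes))).

Lemma polytope_cross : polytope cross.
Proof. by exists (1 + (m + m))%N, (col_mx (0 : 'rV[R]_m) (col_mx axes (- axes))). Qed.

Lemma crossP v : cross v -> exists wp wm : 'I_m -> R,
  [/\ forall i, 0 <= wp i /\ 0 <= wm i, \sum_i (wp i + wm i) <= 1 &
      forall i, v 0 i = (wp i - wm i) *+ (i \in C)].
Proof.
case=> w [w0 w1 ->]; set wl := lsubmx w; set wr := rsubmx w.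
exists (fun i => lsubmx wr 0 i), (fun i => rsubmx wr 0 i); split=> [i||i].
- by rewrite !mxE.
- rewrite -w1 big_split_ord /= big_ord1 [X in _ <= _ + X]big_split_ord /=.
  rewrite big_split /= -[X in X <= _]add0r lerD //.
  rewrite le_eqVlt; apply/orP; left; apply/eqP.
  by congr (_ + _); apply: eq_bigr => i _; rewrite !mxE.
rewrite -[w]hsubmxK -/wl -/wr mul_row_col mulmx0 add0r.
rewrite -[wr]hsubmxK mul_row_col mulmxN -mulmxBl row_mxKl row_mxKr.
rewrite mxE (bigD1 i) //= big1 ?addr0 => [|j ji]; last first.
  by rewrite [axes _ _]mxE (negbTE ji) mulr0.
by rewrite [axes _ _]mxE eqxx /= mulr_natr !mxE.
Qed.

Lemma cross_off v i : cross v -> i \notin C -> v 0 i = 0.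
Proof. by case/crossP => wp [wm [_ _ ->]] /negbTE ->. Qed.

Lemma cross_norm v : cross v -> \sum_i `|v 0 i| <= 1.
Proof.
case/crossP => wp [wm [w0 w1 vE]]; apply: le_trans w1; apply: ler_sum => i _.
have [p0 m0] := w0 i; rewrite vE; case: (i \in C); rewrite ?mulr1n ?mulr0n.
  by apply: le_trans (ler_normB _ _) _; rewrite !ger0_norm.
by rewrite normr0 addr_ge0.
Qed.

Lemma cross_row r : cross (row r (col_mx (0 : 'rV[R]_m) (col_mx axes (- axes)))).
Proof.
exists (delta_mx 0 r); split=> [i||]; last by rewrite rowE.
  by rewrite mxE ler0n.
rewrite (bigD1 r) //= mxE !eqxx big1 ?addr0 // => i ir.
by rewrite mxE (negbTE ir) andbF.
Qed.

Lemma cross0 : cross 0.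
Proof.
have -> : 0 = row (lshift (m + m) 0) (col_mx (0 : 'rV[R]_m) (col_mx axes (- axes))).
  by apply/rowP => j; rewrite !mxE (unsplitK (inl _)) !mxE.
exact: cross_row.
Qed.

Lemma cross_axis (b : bool) i : i \in C -> cross ((-1) ^+ b *: delta_mx 0 i).
Proof.
move=> iC; pose r := rshift 1 (if b then rshift m i else lshift m i).
have -> : (-1) ^+ b *: delta_mx 0 i =
    row r (col_mx (0 : 'rV[R]_m) (col_mx axes (- axes))) :> 'rV[R]_m.
  apply/rowP => j; rewrite !mxE eqxx /= (unsplitK (inr _)) /r; case: (b).
    by rewrite !mxE (unsplitK (inr _)) !mxE iC andbT mulN1r eq_sym.
  by rewrite !mxE (unsplitK (inl _)) !mxE iC andbT mul1r eq_sym.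
exact: cross_row.
Qed.

Lemma dot_axis s (b : bool) i : dot s ((-1) ^+ b *: delta_mx 0 i) = (-1) ^+ b * s i.
Proof.
rewrite /dot (bigD1 i) //= big1 ?addr0 => [|j ji].
  by rewrite !mxE !eqxx mulr1 mulrC.
by rewrite !mxE (negbTE ji) andbF !mulr0.
Qed.

Lemma dot0 s : dot s 0 = 0.
Proof. by rewrite /dot big1 // => i _; rewrite mxE mulr0. Qed.

Definition sgn (I W : {set 'I_m}) i : R := if i \in I then (-1) ^+ (i \in W) else 0.

(** For [I] empty the functional vanishes and this is the empty face, the counterpart of the
    one-block partition. The whole polytope, the counterpart of the adjoined bottom, is not of this
    form. *)
Definition face_of I W : set 'rV[R]_m := cross `&` [set v | dot (sgn I W) v = 1].

Lemma sgn_norm I W i : `|sgn I W i| = (i \in I)%:R.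
Proof. by rewrite /sgn; case: ifP => _; rewrite ?normr0 ?normr_sign. Qed.

Lemma sgn_le I W v i : sgn I W i * v 0 i <= `|v 0 i|.
Proof.
apply: le_trans (ler_norm _) _; rewrite normrM sgn_norm.
by case: (i \in I); rewrite ?mul1r // mul0r.
Qed.

(* Equality holds throughout [1 = dot s v <= sum |v i| <= 1]. *)
Lemma face_ofP I W v : face_of I W v ->
  \sum_i `|v 0 i| = 1 /\ forall i, sgn I W i * v 0 i = `|v 0 i|.
Proof.
case=> cv /= dv; have le1 := cross_norm cv.
have ge1 : 1 <= \sum_i `|v 0 i| by rewrite -dv; apply: ler_sum => i _; apply: sgn_le.
have E : \sum_i `|v 0 i| = 1 by apply/eqP; rewrite eq_le le1.
split=> // i; apply/eqP; rewrite eq_sym -subr_eq0.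
have /eqP : \sum_i (`|v 0 i| - sgn I W i * v 0 i) = 0.
  by rewrite sumrB E -[X in _ - X]/(dot _ _) dv subrr.
rewrite psumr_eq0 => [/allP H|j _]; last by rewrite subr_ge0 sgn_le.
by apply: H; rewrite mem_index_enum.
Qed.

Lemma face_face_of I W : face cross (face_of I W).
Proof.
have dE v : (v *m \col_i sgn I W i) 0 0 = dot (sgn I W) v.
  by rewrite mxE /dot; apply: eq_bigr => i _; rewrite !mxE mulrC.
exists (\col_i sgn I W i), 1; split=> [v cv|].
  rewrite dE; apply: le_trans (cross_norm cv); apply: ler_sum => i _; exact: sgn_le.
by rewrite /face_of; congr (_ `&` _); apply/seteqP; split=> v /=; rewrite dE.
Qed.

Lemma face_cross : face cross cross.
Proof.
exists 0, 0; split=> [v _|]; first by rewrite mulmx0 mxE.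
by apply/seteqP; split=> v /=; [move=> cv; split=> //; rewrite mulmx0 mxE|case].
Qed.

Lemma cross_not_sub I W : ~ (cross `<=` face_of I W).
Proof.
by move=> /(_ _ cross0) [_] /=; rewrite dot0 => /eqP; rewrite eq_sym oner_eq0.
Qed.

(** In one direction, evaluate on the vertices of the smaller face: each forces the sign of its
    coordinate. In the other, the points of [face_of I W] have no coordinate outside [I], so the
    additional entries of the sign vector do not matter. *)
Lemma face_of_sub I W J V : I \subset C -> W \subset I -> V \subset J ->
  (face_of I W `<=` face_of J V) <-> I \subset J /\ W = V :&: I.
Proof.
move=> IC WI VJ; split=> [H|[IJ WE] v fv].
  have sE i : i \in I -> sgn J V i = sgn I W i.
    move=> iI; have ax := cross_axis (i \in W) (fintype.subsetP IC _ iI).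
    have : face_of I W ((-1) ^+ (i \in W) *: delta_mx 0 i).
      by split=> //=; rewrite dot_axis /sgn iI -expr2 sqrr_sign.
    case/H => _ /=; rewrite dot_axis /sgn iI => E.
    have := congr1 ( *%R ((-1) ^+ (i \in W))) E.
    by rewrite mulrA -expr2 sqrr_sign mul1r mulr1.
  have IJ : I \subset J.
    apply/fintype.subsetP => i iI; have := sE i iI; rewrite /sgn iI; case: ifP => // _ /eqP.
    by rewrite eq_sym signr_eq0.
  split=> //; apply/finset.setP => i; rewrite inE; case: (boolP (i \in I)) => iI; last first.
    by rewrite andbF; apply: contraNF iI; apply: (fintype.subsetP WI).
  have := sE i iI; rewrite /sgn iI (fintype.subsetP IJ _ iI) andbT.
  by move/signr_inj ->.
have [_ vE] := face_ofP fv; case: fv => cv /= dv; split=> //=.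
rewrite -dv; apply: eq_bigr => i _; case: (boolP (i \in I)) => iI.
  by rewrite /sgn iI (fintype.subsetP IJ _ iI) WE inE iI andbT.
by have := vE i; rewrite /sgn (negbTE iI) mul0r => /esym/eqP; rewrite normr_eq0 => /eqP ->; rewrite !mulr0.
Qed.

(** The origin gives [0 <= b], and the vertices bound every coefficient on [C] by [b] in absolute
    value. If [b = 0] the functional vanishes on the polytope. Otherwise only coordinates whose
    coefficient attains the bound can be nonzero on the face, and there the functional is [b] times
    a sign vector. *)
Lemma face_cases F : face cross F -> F = cross \/
  exists I W : {set 'I_m}, [/\ I \subset C, W \subset I & F = face_of I W].
Proof.
case=> a [b [le_b ->]]; pose s i := a i 0.
have dE v : (v *m a) 0 0 = dot s v.
  by rewrite mxE /dot; apply: eq_bigr => i _; rewrite mulrC.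
have {}le_b v : cross v -> dot s v <= b by rewrite -dE; apply: le_b.
have -> : cross `&` [set v | (v *m a) 0 0 = b] = cross `&` [set v | dot s v = b].
  by congr (_ `&` _); apply/seteqP; split=> v /=; rewrite dE.
have b0 : 0 <= b by have := le_b _ cross0; rewrite dot0.
have s_le i : i \in C -> `|s i| <= b.
  move=> iC; have h0 := le_b _ (cross_axis false iC); have h1 := le_b _ (cross_axis true iC).
  rewrite !dot_axis expr0 expr1 mul1r mulN1r in h0 h1.
  by rewrite ler_norml h0 lerNl h1.
move: b0; rewrite le_eqVlt => /predU1P [b0|b_gt0].
  left; apply/seteqP; split=> [v []//|v cv]; split=> //=.
  rewrite /dot big1 // => i _; case: (boolP (i \in C)) => iC.
    by have := s_le i iC; rewrite -b0 normr_le0 => /eqP ->; rewrite mul0r.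
  by rewrite (cross_off cv iC) mulr0.
right; pose I := [set i in C | `|s i| == b]; pose W := [set i in I | s i < 0].
have IC : I \subset C by apply/fintype.subsetP => i; rewrite inE => /andP [].
have WI : W \subset I by apply/fintype.subsetP => i; rewrite inE => /andP [].
exists I, W; split=> //.
have sI i : i \in I -> s i = b * sgn I W i.
  move=> iI; rewrite /sgn iI; move: (iI); rewrite inE => /andP [_ /eqP <-].
  rewrite [i \in W]inE iI /= mulrC; exact: realEsign (num_real _).
have leb v i : cross v -> s i * v 0 i <= b * `|v 0 i|.
  move=> cv; case: (boolP (i \in C)) => iC; last by rewrite (cross_off cv iC) normr0 !mulr0.
  by apply: le_trans (ler_norm _) _; rewrite normrM ler_wpM2r // s_le.
apply/seteqP; split=> v; last first.
  move=> fv; have [v1 vE] := face_ofP fv; case: fv => cv _; split=> //=.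
  rewrite -[RHS]mulr1 -v1 mulr_sumr; apply: eq_bigr => i _.
  case: (boolP (i \in I)) => iI; first by rewrite sI // -mulrA vE.
  have := vE i; rewrite /sgn (negbTE iI) mul0r => /esym/eqP; rewrite normr_eq0 => /eqP ->.
  by rewrite normr0 !mulr0.
case=> cv /= dv; split=> //=.
have le1 := cross_norm cv.
have ge1 : b <= b * \sum_i `|v 0 i|.
  by rewrite -{1}dv mulr_sumr; apply: ler_sum => i _; apply: leb.
have E : \sum_i `|v 0 i| = 1.
  by apply/eqP; rewrite eq_le le1 -(ler_pM2l b_gt0) mulr1.
have eqb i : s i * v 0 i = b * `|v 0 i|.
  apply/eqP; rewrite eq_sym -subr_eq0.
  have /eqP : \sum_i (b * `|v 0 i| - s i * v 0 i) = 0.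
    by rewrite sumrB -mulr_sumr E mulr1 -[X in _ - X]/(dot _ _) dv subrr.
  rewrite psumr_eq0 => [/allP H|j _]; last by rewrite subr_ge0 leb.
  by apply: H; rewrite mem_index_enum.
rewrite -E; apply: eq_bigr => i _.
have [v0|v0] := eqVneq (v 0 i) 0; first by rewrite v0 normr0 mulr0.
have iI : i \in I.
  rewrite inE; have iC : i \in C by apply: contraNT v0 => /(cross_off cv) ->.
  rewrite iC; apply/eqP/(mulIf (_ : `|v 0 i| != 0)); first by rewrite normr_eq0.
  by rewrite -normrM eqb normrM normr_id ger0_norm // ltW.
have bN : b != 0 by rewrite gt_eqF.
by apply: (mulfI bN); rewrite mulrA -sI // eqb.
Qed.

End CrossPolytope.

Section Divisible.
Variables (n d : nat).
Hypotheses (d_gt1 : 1 < d) (n_gt0 : 0 < n) (d_dvd : d %| n).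
Notation Q := (dpart n d).
Notation k := (n %/ d).

(** * Divisible partitions as equivalence relations *)

Section Blocks.
Lemma d_gt0 : 0 < d.
Proof. exact: ltn_trans d_gt1. Qed.

Implicit Types (x y z t : Q) (a b e m : 'I_n) (S : {set 'I_n}).

(* The adjoined bottom is treated as the discrete partition. *)
Definition same x : rel 'I_n := fun a b =>
  if x is Some p then b \in pblock (val p) a else a == b.

Definition blk x a := [set b | same x a b].

Lemma dpart_partition (p : {p : {set {set 'I_n}} | d_divisible d p}) :
  partition (val p) [set: 'I_n].
Proof. by case/andP: (valP p). Qed.

Lemma dpart_cover (p : {p : {set {set 'I_n}} | d_divisible d p}) a :
  a \in cover (val p).
Proof. by rewrite (cover_partition (dpart_partition p)) in_setT. Qed.

Lemma same_refl x a : same x a a.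
Proof. by case: x => [p|] /=; rewrite ?eqxx // mem_pblock dpart_cover. Qed.

Lemma same_pblockE (p : {p : {set {set 'I_n}} | d_divisible d p}) a b :
  same (Some p) a b = (pblock (val p) a == pblock (val p) b).
Proof.
have tp := partition_trivIset (dpart_partition p).
by rewrite (eq_pblock b tp (dpart_cover p a)).
Qed.

Lemma same_sym x a b : same x a b = same x b a.
Proof. by case: x => [p|]; [rewrite !same_pblockE eq_sym|rewrite /= eq_sym]. Qed.

Lemma same_trans x a b e : same x a b -> same x b e -> same x a e.
Proof.
by case: x => [p|]; [rewrite !same_pblockE|]; move=> /eqP -> /eqP ->; rewrite /= ?eqxx.
Qed.

Lemma same_eql x a b e : same x a b -> same x a e = same x b e.
Proof.
move=> ab; apply/idP/idP; first by apply: same_trans; rewrite same_sym.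
exact: same_trans.
Qed.

Lemma same_eqr x a b e : same x a b -> same x e a = same x e b.
Proof. by move=> ab; rewrite !(same_sym x e); apply: same_eql. Qed.

Lemma blkE (p : {p : {set {set 'I_n}} | d_divisible d p}) a :
  blk (Some p) a = pblock (val p) a.
Proof. by apply/setP => b; rewrite inE. Qed.

Arguments same : simpl never.

(** Such an [S] is a union of blocks. This yields the divisibility of prefixes of words and of cuts
    compatible with a finer partition. *)
Lemma dvd_closed x S : x != None ->
  (forall a b, a \in S -> same x a b -> b \in S) -> d %| #|S|.
Proof.
case: x => [p|] // _ SC; have pP := dpart_partition p.
have tp := partition_trivIset pP.
have PS : partition (val p ::&: S) S.
  apply/and3P; split.
  - rewrite eqEsubset; apply/andP; split.
      by apply/bigcupsP => B; rewrite inE => /andP [].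
    apply/subsetP => a aS; apply/bigcupP; exists (pblock (val p) a).
      rewrite inE pblock_mem ?dpart_cover //=.
      by apply/subsetP => b; apply: SC.
    by rewrite mem_pblock dpart_cover.
  - exact: trivIsetI.
  - by rewrite inE (partition0 pP).
rewrite (card_partition PS); apply: dvdn_sum => B; rewrite inE => /andP [Bp _].
by have /andP [_ /forall_inP] := valP p; apply.
Qed.

Lemma dvd_blk x a : x != None -> d %| #|blk x a|.
Proof.
by move=> xN; apply: (dvd_closed xN) => b e; rewrite !inE => /same_trans; apply.
Qed.

Lemma blk_gt0 x a : 0 < #|blk x a|.
Proof. by rewrite card_gt0; apply/set0Pn; exists a; rewrite inE same_refl. Qed.

Lemma same_two x a : x != None -> exists2 b, b != a & same x a b.
Proof.
move=> xN; have dB := dvd_blk a xN.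
have B1 : 1 < #|blk x a| by rewrite (leq_trans d_gt1) // dvdn_leq // blk_gt0.
have [b] : exists b, b \in blk x a :\ a.
  apply/set0Pn; rewrite -card_gt0.
  by move: B1; rewrite (cardsD1 a) inE same_refl.
by rewrite !inE => /andP [ba ab]; exists b.
Qed.

(** With the bottom read as the discrete partition, the order is inclusion of equivalence relations
    throughout. That no genuine partition lies below the bottom is where [d > 1] enters, through
    [same_two]. *)
Lemma dpart_leP x y :
  reflect (forall a b, same x a b -> same y a b) (x <= y)%O.
Proof.
case: x => [p|]; last by apply: (iffP idP) => // _ a b /eqP ->; apply: same_refl.
case: y => [q|]; last first.
  apply: (iffP idP) => // H; have [b] := @same_two (Some p) (Ordinal n_gt0) isT.
  by move=> /eqP nb /H /eqP E; case: nb; rewrite E.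
have pP := dpart_partition p; have qP := dpart_partition q.
have tp := partition_trivIset pP; have tq := partition_trivIset qP.
apply: (iffP forall_inP) => [H a b ab|H B Bp].
  have /exists_inP [C Cq /subsetP BC] := H _ (pblock_mem (dpart_cover p a)).
  have aC : a \in C by apply: BC; rewrite mem_pblock dpart_cover.
  by rewrite /same (def_pblock tq Cq aC); apply: BC.
have [a aB] := set0Pn _ (partition_neq0 pP Bp).
apply/exists_inP; exists (pblock (val q) a); first by rewrite pblock_mem ?dpart_cover.
by apply/subsetP => b bB; apply: H; rewrite /same (def_pblock tp Bp aB).
Qed.

Lemma same_inj x y : same x =2 same y -> x = y.
Proof.
by move=> E; apply/eqP; rewrite eq_le; apply/andP; split; apply/dpart_leP => a b;
  rewrite E.
Qed.

Lemma of_rel (r : rel 'I_n) : equivalence_rel r ->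
  (forall a, d %| #|[set b | r a b]|) -> exists2 x : Q, x != None & same x =2 r.
Proof.
move=> eqr dr; pose p := equivalence_partition r [set: 'I_n].
have er : {in [set: 'I_n] & &, equivalence_rel r}.
  by move=> a b e _ _ _; apply: eqr.
have pP : partition p [set: 'I_n] := equivalence_partitionP er.
have pd : d_divisible d p.
  rewrite /d_divisible pP; apply/forall_inP => B /imsetP [a _ ->].
  by rewrite (_ : [set _ in _ | _] = [set b | r a b]) //; apply/setP => b; rewrite !inE.
exists (Some (exist _ p pd)) => // a b; rewrite /same /=.
by rewrite pblock_equivalence_partition ?inE.
Qed.

Definition bm x a := [arg max_(b > a | same x a b) (b : nat)].

Lemma bm_same x a : same x a (bm x a).
Proof. by rewrite /bm; case: arg_maxnP => //; apply: same_refl. Qed.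

Lemma bm_max x a b : same x a b -> b <= bm x a.
Proof.
rewrite /bm; case: arg_maxnP => [|e _ emax]; [exact: same_refl|exact: emax].
Qed.

Lemma le_bm x a : a <= bm x a.
Proof. exact/bm_max/same_refl. Qed.

Lemma bm_eq x a b : (bm x a == bm x b) = same x a b.
Proof.
apply/eqP/idP => [E|ab].
  by apply: (same_trans (bm_same x a)); rewrite E same_sym bm_same.
apply/val_inj/anti_leq/andP; split; apply: bm_max.
  by rewrite -(same_eql _ ab) bm_same.
by rewrite (same_eql _ ab) bm_same.
Qed.

Lemma bm_unique x a m : same x a m -> (forall b, same x a b -> b <= m) ->
  bm x a = m.
Proof.
move=> am mmax; apply/val_inj/anti_leq.
by rewrite bm_max // mmax // bm_same.
Qed.

(** One representative per block, so the cardinality counts the blocks. Refinement only enlarges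
    this set, and a cover adds exactly one letter, which is the absolute value of the label up to
    the shift by one. *)
Definition maxima x := [set a | bm x a == a].

Lemma bm_maxima x a : bm x a \in maxima x.
Proof. by rewrite inE bm_eq same_sym bm_same. Qed.

Lemma bm_le x y a : (x <= y)%O -> bm x a <= bm y a.
Proof. by move=> /dpart_leP xy; apply/bm_max/xy/bm_same. Qed.

Lemma maxima_le x y : (x <= y)%O -> maxima y \subset maxima x.
Proof.
move=> xy; apply/subsetP => a; rewrite !inE => /eqP ya.
apply/eqP/val_inj/anti_leq; rewrite le_bm andbT -{2}ya; exact: bm_le.
Qed.

Lemma maxima_lt x y : (x < y)%O -> #|maxima y| < #|maxima x|.
Proof.
move=> xy; have le_xy := ltW xy; have /dpart_leP H := le_xy.
apply/proper_card; rewrite properEneq (maxima_le le_xy) andbT.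
apply/eqP => E; suff xyE : x = y by rewrite xyE ltxx in xy.
apply/same_inj => a b; apply/idP/idP; first exact: H.
suff K e : bm x e = bm y e by rewrite -!bm_eq !K.
have := bm_maxima x e; rewrite -E inE => /eqP <-; apply/eqP.
by rewrite bm_eq same_sym; apply/H/bm_same.
Qed.

Lemma maxima_blk_sum x : x != None -> \sum_(a in maxima x) #|blk x a| = n.
Proof.
case: x => [p|] // _; have pP := dpart_partition p.
rewrite -[RHS]card_ord -cardsT (card_partition pP).
have tp := partition_trivIset pP.
have {1}-> : val p = [set pblock (val p) a | a in maxima (Some p)].
  apply/setP => B; apply/idP/imsetP => [Bp|[a _ ->]]; last first.
    by rewrite pblock_mem ?dpart_cover.
  have [a aB] := set0Pn _ (partition_neq0 pP Bp).
  exists (bm (Some p) a); rewrite ?bm_maxima // -(def_pblock tp Bp aB).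
  by apply/eqP; rewrite -same_pblockE bm_same.
rewrite big_imset /=; first by apply: eq_bigr => a _; rewrite blkE.
move=> a b; rewrite !inE => /eqP aM /eqP bM E.
by rewrite -aM -bM; apply/eqP; rewrite bm_eq same_pblockE E.
Qed.

Lemma blk_size_ge x a : x != None -> d <= #|blk x a|.
Proof. by move=> xN; rewrite dvdn_leq ?blk_gt0 ?dvd_blk. Qed.

Lemma maxima_le_k x : x != None -> #|maxima x| <= k.
Proof.
move=> xN; rewrite (leq_divRL _ _ d_gt0).
rewrite (leq_trans _ (eq_leq (maxima_blk_sum xN))) //.
by rewrite -sum_nat_const; apply: leq_sum => a _; apply: blk_size_ge.
Qed.

Lemma maxima_gt0 x : 0 < #|maxima x|.
Proof.
by rewrite card_gt0; apply/set0Pn; exists (bm x (Ordinal n_gt0)); apply: bm_maxima.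
Qed.

Lemma big_block x : x != None -> #|maxima x| < k ->
  exists a, d < #|blk x a|.
Proof.
move=> xN; case: (boolP [exists a, d < #|blk x a|]) => [/existsP //|].
rewrite negb_exists => /forallP small.
rewrite ltnNge (leq_divLR _ d_dvd) (leq_trans (eq_leq (esym (maxima_blk_sum xN)))) //.
rewrite -sum_nat_const leq_sum // => a _.
by rewrite leqNgt small.
Qed.

Lemma k_gt0 : 0 < k.
Proof. by rewrite (divn_gt0 _ d_gt0) (dvdn_leq n_gt0 d_dvd). Qed.

(** The rank in the dual order: the number of blocks less one. A finest partition has [k] blocks,
    hence rank [k.-1], and the bottom comes next. *)
Definition rk x := if x is Some _ then #|maxima x|.-1 else k.

Lemma rkS x : x != None -> (rk x).+1 = #|maxima x|.
Proof. by case: x => [p|] // _; rewrite /rk prednK // maxima_gt0. Qed.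

Lemma rk_lt_k x : x != None -> rk x < k.
Proof. by move=> xN; rewrite rkS // maxima_le_k. Qed.

Lemma rk_ltQ x y : (x < y)%O -> rk y < rk x.
Proof.
move=> xy; have yN : y != None.
  by apply: contraTneq xy => ->; case: (x).
case: (eqVneq x None) => [->|xN]; first exact: rk_lt_k.
by rewrite -ltnS !rkS // maxima_lt.
Qed.

Lemma rk_leQ x y : (x <= y)%O -> rk y <= rk x.
Proof. by rewrite le_eqVlt => /predU1P [->//|/rk_ltQ/ltnW]. Qed.

Definition split_rel y S : rel 'I_n := fun a b =>
  same y a b && ((a \in S) == (b \in S)).

Lemma split_rel_equiv y S : equivalence_rel (split_rel y S).
Proof.
move=> a b e; split; first by rewrite /split_rel same_refl eqxx.
by case/andP => ab /eqP E; rewrite /split_rel (same_eql _ ab) E.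
Qed.

Lemma split_ex y a S : y != None -> S \subset blk y a -> d %| #|S| ->
  exists2 z : Q, z != None & same z =2 split_rel y S.
Proof.
move=> yN /subsetP Sa dS; apply: of_rel (split_rel_equiv y S) _ => b.
case: (boolP (b \in S)) => bS.
  rewrite (_ : [set _ | _] = S) //; apply/setP => e; rewrite inE /split_rel bS.
  case: (boolP (e \in S)) => eS; rewrite ?andbF // andbT.
  by have := Sa _ bS; have := Sa _ eS; rewrite !inE => ae /same_eql <-.
rewrite (_ : [set _ | _] = blk y b :\: S); last first.
  by apply/setP => e; rewrite !inE /split_rel (negbTE bS) andbC eq_sym eqbF_neg.
rewrite cardsD dvdn_sub ?dvd_blk //.
case: (boolP (same y a b)) => ab.
  rewrite (setIidPr _) //; apply/subsetP => e /Sa; rewrite !inE.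
  by rewrite (same_eql _ ab).
rewrite (_ : _ :&: _ = set0) ?cards0 //; apply/setP => e; rewrite !inE.
apply/negbTE; rewrite negb_and; case: (boolP (e \in S)) => [/Sa|]; rewrite ?orbT //.
by rewrite inE orbF => ae; rewrite same_sym -(same_eql _ ae).
Qed.

Lemma split_le y S z : same z =2 split_rel y S -> (z <= y)%O.
Proof. by move=> zE; apply/dpart_leP => a b; rewrite zE => /andP []. Qed.

(** The old maximum [bm y a] lies outside [S], so the rest of the block keeps it, and [a] is the
    only maximum gained. *)
Lemma split_maxima y a S z : S \subset blk y a -> a \in S ->
  {in S, forall b, b <= a} -> bm y a != a -> same z =2 split_rel y S ->
  maxima z = a |: maxima y.
Proof.
move=> /subsetP Sa aS amax ya zE; have zy := split_le zE.
have za : bm z a = a.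
  apply: bm_unique => [|b]; first exact: same_refl.
  by rewrite zE /split_rel aS => /andP [_ /eqP/esym/amax].
apply/eqP; rewrite eqEsubset subUset sub1set maxima_le // andbT inE za eqxx andbT.
apply/subsetP => e; rewrite !inE => /eqP ze; case: eqVneq => //= nea.
apply/eqP; apply: bm_unique => [|b eb]; first exact: same_refl.
have eS : e \notin S.
  apply: contra nea => eS; rewrite -ze -[X in _ == X]za bm_eq zE /split_rel.
  by rewrite aS eS same_sym; have := Sa _ eS; rewrite inE => ->.
rewrite -ze; case: (boolP (b \in S)) => bS; last first.
  by apply: bm_max; rewrite zE /split_rel eb (negbTE bS) (negbTE eS).
have ab : same y a b by have := Sa _ bS; rewrite inE.
apply: leq_trans (amax _ bS) _; apply: leq_trans (le_bm y a) _.
have nS : bm y a \notin S.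
  apply: contra ya => /amax yaa; apply/eqP/val_inj/anti_leq.
  by rewrite yaa le_bm.
apply: bm_max; rewrite zE /split_rel (negbTE nS) (negbTE eS) andbT.
by rewrite (same_eql _ eb) -(same_eql _ ab) bm_same.
Qed.

Lemma split_rk y z a : y != None -> z != None -> bm y a != a ->
  maxima z = a |: maxima y -> rk z = (rk y).+1.
Proof.
move=> yN zN ya E; apply/eqP; rewrite -eqSS !rkS // E cardsU1 inE ya.
by rewrite -rkS.
Qed.

Lemma rk_lt_split y z a : (z <= y)%O -> bm y a != a ->
  maxima z = a |: maxima y -> (z < y)%O.
Proof.
move=> zy ya E; rewrite lt_neqAle zy andbT; apply: contra ya => /eqP zE.
by have := setU11 a (maxima y); rewrite -E zE inE.
Qed.

Lemma bmin_le S e : e \in S -> bmin S <= e.+1.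
Proof.
move=> eS; rewrite /bmin; have := mem_index_enum e.
elim: (index_enum _) => //= a s IH; rewrite inE big_cons => /predU1P [<-|/IH le].
  by rewrite eS geq_minl.
by case: ifP => // _; apply: leq_trans (geq_minr _ _) le.
Qed.

Section Cover.
Variables y z : Q.
Hypotheses (yN : y != None) (zN : z != None) (zy : (z < y)%O).
Hypothesis rkzy : rk z = (rk y).+1.

Lemma cover_new : exists2 m, bm y m != m & maxima z = m |: maxima y.
Proof.
have E : #|maxima z :\: maxima y| = 1.
  rewrite cardsD (setIidPr _) ?maxima_le ?ltW // -!rkS // rkzy; lia.
have /cards1P [m mE] : #|maxima z :\: maxima y| == 1 by rewrite E.
exists m; first by have := set11 m; rewrite -mE !inE => /andP [].
rewrite -[LHS](setID _ (maxima y)) mE setUC; congr (_ :|: _).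
by apply/setIidPr; rewrite maxima_le ?ltW.
Qed.

Variable m : 'I_n.
Hypotheses (ym : bm y m != m) (zE : maxima z = m |: maxima y).

Lemma cover_bm : bm z m = m.
Proof. by have := setU11 m (maxima y); rewrite -zE inE => /eqP. Qed.

(** Only [m] is a new maximum, so letters outside its block keep the maximum of their old block; two
    of these from one block of [y] stay together. *)
Lemma cover_two a b : same y a b -> ~~ same z a b -> same z m a || same z m b.
Proof.
move=> ab; apply: contraNT; rewrite negb_or => /andP [ma mb].
have H e : ~~ same z m e -> bm z e = bm y e.
  move=> me; have := bm_maxima z e; rewrite zE !inE -[X in _ == X]cover_bm.
  rewrite bm_eq same_sym (negbTE me) /= => /eqP <-.
  apply/eqP; rewrite bm_eq same_sym.
  by move/ltW/dpart_leP: zy; apply; apply: bm_same.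
by rewrite -bm_eq (H _ ma) (H _ mb) bm_eq.
Qed.

Lemma cover_split : same z =2 split_rel y (blk z m).
Proof.
move=> a b; rewrite /split_rel !inE; have /dpart_leP H := ltW zy.
apply/idP/andP => [ab|[ab E]]; first by rewrite H // (same_eqr m ab).
apply: contraT => nab; case/negP: (nab); case/orP: (cover_two ab nab) => mE.
  by rewrite -(same_eql _ mE) -(eqP E).
by rewrite same_sym -(same_eql _ mE) (eqP E).
Qed.

(** Of the two merged blocks, that of [m] has the smaller maximum, since the other one contains the
    maximum of their union. *)
Lemma lam_cover : lam y z =
  if [forall e, (same y m e && ~~ same z m e) ==> (m < e)]
  then (- (m.+1)%:Z)%R else (m.+1)%:Z%R.
Proof.
have zm := cover_bm; have two := cover_two; have spl := cover_split.
have H := dpart_leP _ _ (ltW zy); have zz := bm_max (x := z); have yy := bm_max (x := y).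
move: ym zE zm two spl H zz yy.
case: (y) yN => [p|] // _; case: (z) zN => [q|] // _.
move=> ymp zEp zm two spl H zz yy.
have pP := dpart_partition p; have tp := partition_trivIset pP.
have qP := dpart_partition q; have tq := partition_trivIset qP.
have bmaxE a : bmax (pblock (val q) a) = (bm (Some q) a).+1.
  apply/eqP; rewrite eqn_leq; apply/andP; split.
    by apply/bigmax_leqP => e ae; rewrite ltnS; apply: zz.
  rewrite /bmax (bigD1 (bm (Some q) a)) ?leq_maxl //.
  exact: (bm_same (Some q) a).
set M := bm (Some p) m.
have mM : same (Some p) m M by apply: bm_same.
have nmM : ~~ same (Some q) m M.
  rewrite -bm_eq zm; have : bm (Some q) M = M.
    by apply/val_inj/anti_leq; rewrite le_bm andbT; apply: yy; apply: same_trans mM _; apply/H/bm_same.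
  by move=> ->; rewrite eq_sym.
have bmM : bm (Some q) M = M.
  by apply/val_inj/anti_leq; rewrite le_bm andbT; apply: yy; apply: same_trans mM _; apply/H/bm_same.
pose B1 := pblock (val q) m; pose B2 := pblock (val q) M.
have Bm : pblock (val p) m = B1 :|: B2.
  apply/setP => e; rewrite inE; apply/idP/orP => [me|].
    have me' : same (Some p) m e by [].
    case: (boolP (same (Some q) m e)) => [|nme]; first by left.
    right; have Me : same (Some p) M e by rewrite -(same_eql _ mM).
    case: (boolP (same (Some q) M e)) => // /(two _ _ Me).
    by rewrite (negbTE nmM) (negbTE nme).
  by case=> [/H //|Me]; apply: (same_trans mM); apply: H.
have q_in a : pblock (val q) a \in val q by rewrite pblock_mem ?dpart_cover.
have p_in a : pblock (val p) a \in val p by rewrite pblock_mem ?dpart_cover.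
have defq B : B \in val q -> exists a, B = pblock (val q) a.
  move=> Bq; have [a aB] := set0Pn _ (partition_neq0 qP Bq).
  by exists a; rewrite (def_pblock tq Bq aB).
have defp B : B \in val p -> exists a, B = pblock (val p) a.
  move=> Bp; have [a aB] := set0Pn _ (partition_neq0 pP Bp).
  by exists a; rewrite (def_pblock tp Bp aB).
have qeq a b : (pblock (val q) a == pblock (val q) b) = same (Some q) a b.
  by rewrite same_pblockE.
have peq a b : (pblock (val p) a == pblock (val p) b) = same (Some p) a b.
  by rewrite same_pblockE.
rewrite /lam; case: pickP => [[C1 C2] /= /and4P [C1q C2q ltC /eqP pE]|]; last first.
  move=> /(_ (B1, B2)) /= /negP []; rewrite !q_in !bmaxE zm bmM ltnS /=.
  apply/andP; split.
    by rewrite ltn_neqAle le_bm andbT; apply: contra ymp => /eqP/val_inj E; rewrite -/M -E.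
  rewrite -Bm; apply/eqP/setP => B; rewrite !inE.
  apply/idP/orP => [/defp [a ->]|[/eqP -> //|/and3P [nB2 nB1 /defq [a EB]]]].
    rewrite peq; case: (boolP (same (Some p) a m)) => [|nam]; [by left|right].
    have E : pblock (val p) a = pblock (val q) a.
      apply/setP => e; apply/idP/idP => [ae|/H //].
      have ae' : same (Some p) a e by [].
      case: (boolP (same (Some q) a e)) => // /(two _ _ ae') /orP [] /H me.
        by rewrite same_sym me in nam.
      by rewrite same_sym (same_eqr _ ae') me in nam.
    rewrite E q_in !qeq andbT; apply/andP; split; apply: contra nam => /H //.
    by rewrite -(same_eqr _ mM).
  rewrite EB !qeq in nB1 nB2; rewrite EB.
  have -> : pblock (val q) a = pblock (val p) a; last exact: p_in.
  apply/setP => e; apply/idP/idP => [/H //|ae].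
  have ae' : same (Some p) a e by [].
  case: (boolP (same (Some q) a e)) => // nae; have := two _ _ ae' nae.
  rewrite same_sym (negbTE nB1) /= => me.
  have aM : same (Some p) a M.
    by apply: (same_trans ae'); apply: same_trans mM; rewrite same_sym; apply: H.
  have := two _ _ aM nB2; rewrite same_sym (negbTE nB1) /=.
  by rewrite (negbTE nmM).
have [a EC1] := defq _ C1q; have [b EC2] := defq _ C2q.
have nab : ~~ same (Some q) a b.
  by rewrite -qeq -EC1 -EC2; apply: contraTneq ltC => ->; rewrite ltnn.
have CC : C1 :|: C2 \in val p by rewrite (pE : val p = _) setU11.
have aC : a \in C1 :|: C2 by rewrite EC1 inE mem_pblock dpart_cover.
have bC : b \in C1 :|: C2 by rewrite EC2 inE orbC mem_pblock dpart_cover.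
have pa : pblock (val p) a = C1 :|: C2 := def_pblock tp CC aC.
have ab : same (Some p) a b by rewrite /same pa.
move: ltC; rewrite EC1 EC2 !bmaxE ltnS => ltC.
(* The block of [m] must be the first of the pair: as the maximum of the second, [m] would already
   be a maximum of [y]. *)
have {two} := two _ _ ab nab => /orP [] ma; last first.
  case/negP: ymp; apply/eqP; apply: bm_unique => [|e me]; first exact: same_refl.
  have {me}: e \in pblock (val p) a.
    by apply: (same_trans ab); apply: same_trans me; rewrite same_sym; apply: H.
  have E : bm (Some q) m = bm (Some q) b by apply/eqP; rewrite bm_eq.
  rewrite pa EC1 EC2 inE -zm E.
  by case/orP => /zz //; move=> /leq_trans; apply; apply: ltnW.
have -> : bm (Some q) a = m by rewrite -[RHS]zm; apply/eqP; rewrite bm_eq same_sym.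
congr (if _ then _ else _).
have C2E e : (e \in C2) = same (Some p) m e && ~~ same (Some q) m e.
  rewrite (same_eql _ (H _ _ ma)) (same_eql _ ma) /same pa EC1 EC2 inE.
  case: (boolP (e \in pblock (val q) a)) => ae; rewrite ?orbF ?andbT ?andbF //=.
  apply: contraNF nab => be; have be' : same (Some q) b e by [].
  by rewrite (same_eql _ (ae : same (Some q) a e)) same_sym.
rewrite -EC2; apply/idP/forallP => [lt e|lt].
  apply/implyP; rewrite -C2E => eC; rewrite -ltnS; apply: leq_trans lt _.
  exact: bmin_le.
have E : bm (Some q) m = bm (Some q) a by apply/eqP; rewrite bm_eq.
(* The iterated minimum in [bmin] starts from [n], so the bound is needed for [n] as well. *)
have mn : m.+1 < n by rewrite -zm E; apply: leq_ltn_trans (ltn_ord (bm (Some q) b)).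
rewrite /bmin;  apply: (big_ind (fun u => m.+1 < u)) => //; first by move=> u v; rewrite leq_min => -> ->.
by move=> e; rewrite C2E ltnS => me; have := lt e; rewrite me.
Qed.
End Cover.

Lemma lam_None y : lam y None = 0%R.
Proof. by case: y. Qed.
End Blocks.

(** * The EL-labeling *)

Section Splits.
Implicit Types (b c x y z t : Q) (e f m : 'I_n) (S : {set 'I_n}).

Lemma lt_NoneF x : (x < None)%O = false.
Proof. by case: x => [p|]; [case: (boolP (_ < _)%O) => // /ltW | rewrite ltxx]. Qed.

Lemma lt_neq_None x y : (x < y)%O -> y != None.
Proof. by apply: contraTneq => ->; rewrite lt_NoneF. Qed.

Lemma le_neq_None x y : x != None -> (x <= y)%O -> y != None.
Proof. by case: x y => [p|] [q|]. Qed.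

(** The lower part of a non-crossing cut. Splitting off such an initial segment is the same as a
    step with a negative label ([cut_atom], [cover_neg]). *)
Definition cutS t m := [set e in blk t m | e <= m].

Lemma mem_cutS t m e : (e \in cutS t m) = same t m e && (e <= m).
Proof. by rewrite !inE. Qed.

Lemma split_atom y (a : 'I_n) S : y != None -> S \subset blk y a -> a \in S ->
  {in S, forall e, e <= a} -> bm y a != a -> d %| #|S| ->
  exists z : Q, [/\ z != None, same z =2 split_rel y S, (z < y)%O,
    rk z = (rk y).+1 & lam y z =
      if [forall e, (same y a e && (e \notin S)) ==> (a < e)]
      then (- (a.+1)%:Z)%R else (a.+1)%:Z%R].
Proof.
move=> yN Sa aS amax ya dS; have [z zN zE] := split_ex yN Sa dS.
have Ez := split_maxima Sa aS amax ya zE.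
have zy : (z < y)%O := rk_lt_split (split_le zE) ya Ez.
exists z; split=> //; first exact: split_rk zN ya Ez.
rewrite (lam_cover yN zN zy ya Ez); congr (if _ then _ else _).
apply: eq_forallb => e; rewrite zE /split_rel aS.
by case: (same y a e); rewrite //= eq_sym eqb_id.
Qed.

Lemma cut_atom y m : y != None -> bm y m != m -> d %| #|cutS y m| ->
  exists z : Q, [/\ z != None, same z =2 split_rel y (cutS y m), (z < y)%O,
    rk z = (rk y).+1 & lam y z = (- (m.+1)%:Z)%R].
Proof.
move=> yN ym dm; have [|||z [zN zE zy rkz lE]] := split_atom yN _ _ _ ym dm.
- by apply/subsetP => e; rewrite mem_cutS inE => /andP [].
- by rewrite mem_cutS same_refl leqnn.
- by move=> e; rewrite mem_cutS => /andP [].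
exists z; split=> //; rewrite lE; case: ifP => // /negP []; apply/forallP => e.
by apply/implyP; rewrite mem_cutS => /andP [-> /=]; rewrite ltnNge.
Qed.

Definition atomQ t x (b : Q) := [&& (b < t)%O, (x <= b)%O & rk b == (rk t).+1].

(** If all blocks have size [d], the bottom is itself an atom, with label 0. Otherwise the [d] least
    letters can be cut off a larger block, and this cut is non-crossing. *)
Lemma atom_le0 t : t != None -> exists2 b : Q, atomQ t None b & (lam t b <= 0)%R.
Proof.
move=> tN; case: (eqVneq #|maxima t| k) => [E|nE].
  exists None; last by rewrite lam_None.
  rewrite /atomQ lexx /= -(rkS tN) in E *; rewrite -E eqxx !andbT.
  by case: (t) tN.
have [|a ta] := big_block tN; first by rewrite ltn_neqAle nE maxima_le_k.
pose f (i : nat) := #|[set e in blk t a | e < i]|.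
have fE : exists i, d <= f i.
  exists n; rewrite /f (_ : [set _ in _ | _] = blk t a) ?(ltnW ta) //.
  by apply/setP => e; rewrite !inE ltn_ord andbT.
case: (ex_minnP fE) => [[|m]] dm min_m.
  have f0 : f 0 = 0.
    by apply/eqP; rewrite cards_eq0; apply/eqP/setP => e; rewrite !inE andbF.
  by move: dm; rewrite f0 leqNgt d_gt0.
have fm : f m < d by rewrite ltnNge; apply/negP => /min_m; rewrite ltnn.
have [mn|nm] := ltnP m n; last first.
  move: (leq_trans fm dm); rewrite /f.
  rewrite (_ : [set _ in _ | _] = [set e in blk t a | e < m.+1]) ?ltnn //.
  apply/setP => e; rewrite !inE; case: same => //=.
  by rewrite (leq_trans (ltn_ord e) nm) ltnS (ltnW (leq_trans (ltn_ord e) nm)).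
pose o := Ordinal mn.
have SE : [set e in blk t a | e < m.+1] =
    (if same t a o then [set o] else set0) :|: [set e in blk t a | e < m].
  apply/setP => e; rewrite !inE ltnS leq_eqVlt.
  rewrite (_ : (e == m :> nat) = (e == o)) //.
  case: (eqVneq e o) => [->|] /=; last by case: ifP; rewrite inE => // _ /negbTE ->.
  by case: ifP => E; rewrite ?inE ?eqxx ?E.
have ao : same t a o.
  move: dm; rewrite leqNgt /f SE; case: ifP => // _; rewrite set0U => /negP [].
  exact: fm.
have cE : cutS t o = [set e in blk t a | e < m.+1].
  by apply/setP => e; rewrite mem_cutS !inE (same_eql _ ao) ltnS.
have cd : #|cutS t o| = d.
  apply/eqP; rewrite eqn_leq cE -/(f _) dm andbT /f SE ao cardsU1 !inE /= ltnn andbF.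
  exact: fm.
have to : bm t o != o.
  apply: contraTneq ta => E; rewrite -leqNgt.
  rewrite (leq_trans _ (eq_leq cd)) //; apply: subset_leq_card; apply/subsetP => e; rewrite mem_cutS inE.
  rewrite (same_eql _ ao) => oe; rewrite oe /=.
  by have := bm_max oe; rewrite E.
have [|z [zN _ zt rkz lz]] := cut_atom tN to; first by rewrite cd.
exists z; last by rewrite lz.
by rewrite /atomQ zt rkz eqxx.
Qed.

Lemma peel_atom t x m : x != None -> (x < t)%O -> bm x m = m -> bm t m != m ->
  exists b : Q, [/\ atomQ t x b, same b =2 split_rel t (blk x m)
    & (lam t b <= (m.+1)%:Z)%R].
Proof.
move=> xN xt xm tm; have /dpart_leP H := ltW xt.
have tN := lt_neq_None xt.
have [|||z [zN zE zt rkz lz]] := @split_atom t m (blk x m) tN _ _ _ tm (dvd_blk m xN).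
- by apply/subsetP => e; rewrite !inE => /H.
- by rewrite inE same_refl.
- by move=> e; rewrite inE => /bm_max; rewrite xm.
exists z; split=> //; last by rewrite lz; case: ifP => _ //; apply/ltW/(lt_trans (lab_neg m))/lab_pos.
rewrite /atomQ zt rkz eqxx andbT; apply/dpart_leP => a b ab.
by rewrite zE /split_rel H // !inE (same_eqr _ ab) eqxx.
Qed.

Lemma cover_neg y z m : y != None -> z != None -> (z < y)%O -> bm y m != m ->
  maxima z = m |: maxima y -> (lam y z < 0)%R ->
  lam y z = (- (m.+1)%:Z)%R /\ same z =2 split_rel y (cutS y m).
Proof.
move=> yN zN zy ym zE; rewrite (lam_cover yN zN zy ym zE).
case: ifP => // /forallP lt _; split=> // a b.
rewrite (cover_split zy zE) /split_rel; suff -> : blk z m = cutS y m by [].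
apply/setP => e; rewrite mem_cutS inE; apply/idP/andP => [me|[me le]].
  have /dpart_leP H := ltW zy; rewrite H //; split=> //.
  by have := bm_max me; rewrite (cover_bm zE).
have := lt e; rewrite me /=; apply: contraLR => nme.
by rewrite nme /= -leqNgt.
Qed.

Lemma cover_lam y z m : y != None -> z != None -> (z < y)%O -> bm y m != m ->
  maxima z = m |: maxima y ->
  signed m (lam y z).
Proof.
move=> yN zN zy ym zE; rewrite (lam_cover yN zN zy ym zE).
by case: ifP => _; [left|right].
Qed.


Lemma atom_new t x b : atomQ t x b -> b != None ->
  exists m, [/\ bm t m != m, maxima b = m |: maxima t & t != None].
Proof.
case/and3P => bt xb /eqP rkb bN; have tN := lt_neq_None bt.
by have [m tm mE] := cover_new tN bN bt rkb; exists m.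
Qed.

Lemma atom_None t x b : atomQ t x b -> b = None -> x = None.
Proof. by case/and3P => _ xb _ E; move: xb; rewrite E; case: (x). Qed.

(** The block of [m] in [b] is a union of blocks of [x]. The maximum of each of these is new with
    respect to [t], hence at least [m], and it is at most [m]; so there is only one of them. *)
Lemma peel_unique t x b m : atomQ t x b -> x != None ->
  maxima b = m |: maxima t -> bm t m != m ->
  (forall e, bm x e = e -> bm t e != e -> m <= e) ->
  same b =2 split_rel t (blk x m).
Proof.
case/and3P => bt xb _ xN bE tm min_m a e.
rewrite (cover_split bt bE); suff -> : blk b m = blk x m by [].
have bm_m := cover_bm bE; have /dpart_leP H := xb; have /dpart_leP H' := ltW bt.
have xm : bm x m = m.
  have : m \in maxima b by rewrite bE setU11.
  by move/(subsetP (maxima_le xb)); rewrite inE => /eqP.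
apply/setP => f; rewrite !inE; apply/idP/idP; last exact: H.
move=> mf; have bxf : same b m (bm x f) by apply: same_trans mf (H _ _ (bm_same x f)).
have le : bm x f <= m by have := bm_max bxf; rewrite bm_m.
suff : m <= bm x f.
  move=> ge; have /val_inj E : bm x f = m :> nat by apply/anti_leq; rewrite le.
  by rewrite -bm_eq E xm.
apply: min_m; first by apply/eqP; rewrite bm_eq same_sym bm_same.
apply: contra tm => /eqP E; apply/eqP/val_inj/anti_leq.
rewrite le_bm andbT; apply: leq_trans le; rewrite -E.
have /eqP -> : bm t m == bm t (bm x f) by rewrite bm_eq H'.
by [].
Qed.

Section MinAtom.
Variables (t x a : Q).
Hypotheses (xt : (x < t)%O) (aA : atomQ t x a).
Hypothesis a_min : forall b, atomQ t x b -> (lam t a <= lam t b)%R.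

Let tN : t != None. Proof. exact: lt_neq_None xt. Qed.

Lemma min_le0 : x = None -> (lam t a <= 0)%R.
Proof.
move=> xE; have [b bA lb] := atom_le0 tN.
by apply: le_trans lb; apply: a_min; rewrite xE.
Qed.

(** Over the bottom there is an atom with label at most 0; and peeling off the block of any new
    maximum [e] gives an atom with label at most [e.+1]. *)
Lemma min_pos m : (0 < lam t a)%R -> bm t m != m -> a != None ->
  maxima a = m |: maxima t -> 
  x != None /\ forall e, bm x e = e -> bm t e != e -> m <= e.
Proof.
move=> la tm aN aE; have xN : x != None.
  by apply: contraTneq la => /min_le0; rewrite -leNgt.
split=> // e xe te; have [b [bA _ lb]] := peel_atom xN xt xe te.
have := le_trans (a_min bA) lb; have /and3P [at_ _ _] := aA.
by rewrite (signed_pos (cover_lam tN aN at_ tm aE) (ltW la)) lab_le.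
Qed.

(** Equal labels mean equal new maxima and equal signs. A negative sign determines the atom as the
    cut at [m], a positive one as the peeling of the block of [m]. *)
Lemma min_atom_strict b : atomQ t x b -> b != a -> (lam t a < lam t b)%R.
Proof.
move=> bA nba; rewrite lt_neqAle a_min // andbT; apply: contra nba => /eqP lE.
have /and3P [bt xb _] := bA; have /and3P [at_ xa _] := aA.
case: (eqVneq b None) => [bE|bN]; case: (eqVneq a None) => [aE|aN].
- by rewrite bE aE.
- have [m [tm aE _]] := atom_new aA aN; move: lE; rewrite bE lam_None.
  by move/eqP; rewrite (negbTE (signed_neq0 (cover_lam tN aN at_ tm aE))).
- have [m [tm bE _]] := atom_new bA bN; move: lE; rewrite aE lam_None.
  by move/esym/eqP; rewrite (negbTE (signed_neq0 (cover_lam tN bN bt tm bE))).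
have [m [tm bE _]] := atom_new bA bN; have [m' [tm' aE _]] := atom_new aA aN.
have Em : m = m'.
  apply/val_inj; apply: signed_inj (cover_lam tN bN bt tm bE) _.
  by rewrite -lE; apply: cover_lam tN aN at_ tm' aE.
subst m'; apply/eqP/same_inj => e f.
case: (ltP (lam t a) 0%R) => la.
  have lb : (lam t b < 0)%R by rewrite -lE.
  have [_ ->] := cover_neg tN bN bt tm bE lb.
  by have [_ ->] := cover_neg tN aN at_ tm aE la.
have la' := signed_gt0 (cover_lam tN aN at_ tm aE) la.
have [xN min_m] := min_pos la' tm aN aE.
by rewrite (peel_unique bA xN bE tm min_m) (peel_unique aA xN aE tm min_m).
Qed.

(** A smaller second label would be negative, with new maximum [m'] above [m]. The block split off
    first lies below [m'] entirely, so the same cut could be made in [t] at once, against the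
    minimality of [a]. *)
Lemma min_atom_ascends c : atomQ a x c -> (lam t a <= lam a c)%R.
Proof.
move=> cA; have /and3P [ca xc _] := cA; have /and3P [at_ xa _] := aA.
have aN := lt_neq_None ca; have [m [tm aE _]] := atom_new aA aN.
rewrite leNgt; apply/negP => lt.
case: (eqVneq c None) => [cE|cN].
  move: lt; rewrite cE lam_None ltNge min_le0 //.
  by apply: atom_None cA cE.
have [m' [am' cE _]] := atom_new cA cN.
have tm' : bm t m' != m'.
  apply: contra am' => /eqP E; have : m' \in maxima t by rewrite inE E.
  by move/(subsetP (maxima_le (ltW at_))); rewrite inE.
have am : bm a m = m := cover_bm aE.
have cm : bm c m' = m' := cover_bm cE.
have mm' : m < m' /\ (lam a c < 0)%R.
  case: (ltP (lam t a) 0%R) => la.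
    split; last exact: lt_trans lt la.
    move: lt; have [-> _] := cover_neg tN aN at_ tm aE la.
    exact: signed_ltN (cover_lam aN cN ca am' cE).
  have la' := signed_gt0 (cover_lam tN aN at_ tm aE) la.
  have [xN min_m] := min_pos la' tm aN aE.
  have xm' : bm x m' = m'.
    have : m' \in maxima c by rewrite cE setU11.
    by move/(subsetP (maxima_le xc)); rewrite inE => /eqP.
  have le := min_m _ xm' tm'.
  have nmm : m != m' by apply: contraNneq am' => <-; rewrite am.
  have {le} le : m < m' by rewrite ltn_neqAle nmm.
  split=> //; apply: signed_lt_neg le lt; first exact: cover_lam tN aN at_ tm aE.
  exact: cover_lam aN cN ca am' cE.
case: mm' => mm' lc; have [lcE cS] := cover_neg aN cN ca am' cE lc.
have /dpart_leP Ha := ltW at_; have /dpart_leP Hc := ltW ca.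
have closed e f : e \in cutS t m' -> same c e f -> f \in cutS t m'.
  rewrite !mem_cutS => /andP [te le] ef; have aef := Hc _ _ ef.
  rewrite (same_trans te (Ha _ _ aef)) /=.
  case: (boolP (same a m' e)) => ae.
    move: ef; rewrite cS /split_rel !mem_cutS ae le (same_trans ae aef) /=.
    by case/andP => _ /eqP <-.
  case/orP: (cover_two at_ aE te ae) => me.
    by have := bm_max me; rewrite am leqNgt mm'.
  have := bm_max (same_trans me aef).
  by rewrite am => /leq_trans; apply; apply: ltnW.
have [z [zN zE zt rkz lz]] := cut_atom tN tm' (dvd_closed cN closed).
have := a_min (b := z); rewrite lz -lcE leNgt lt => /(_ _)/negP; apply=> //.
rewrite /atomQ zt rkz eqxx andbT /=; apply: le_trans xc _.
apply/dpart_leP => e f ef; rewrite zE /split_rel Ha ?Hc //=.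
apply/eqP; apply/idP/idP => H; first exact: closed ef.
by apply: closed H _; rewrite same_sym.
Qed.

(** If both labels are negative, the cut of [a], at a larger maximum, can still be made in [b]. If
    both are positive, the smaller new maximum of [a] can be peeled from [b]. If only that of [a] is
    negative, some block of [b] crosses the cut of [a] and can be cut along it. When [x] is the
    bottom and the label of [b] is positive, [atom_le0] suffices. *)
Lemma min_atom_descends b : atomQ t x b -> b != a ->
  exists2 c : Q, atomQ b x c & (lam b c < lam t b)%R.
Proof.
move=> bA nba; have lab := min_atom_strict bA nba.
have /and3P [bt xb /eqP rkb] := bA; have /and3P [at_ xa /eqP rka] := aA.
case: (eqVneq b None) => [bE|bN].
  case: (eqVneq a None) => [aE|aN]; first by rewrite aE bE eqxx in nba.
  by have := rk_lt_k aN; rewrite rka -rkb bE ltnn.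
have [m' [tm' bE _]] := atom_new bA bN.
have /dpart_leP Hb := ltW bt; have /dpart_leP Ha := ltW at_.
have /dpart_leP Hxb := xb.
have xltb : (x < b)%O.
  rewrite lt_neqAle xb andbT; apply: contra nba => /eqP E.
  have ba : (b <= a)%O by rewrite -E.
  move: ba; rewrite le_eqVlt => /orP [//|/rk_ltQ].
  by rewrite rka rkb ltnn.
have atm m : bm t m != m -> m != m' -> bm b m != m.
  move=> tm nmm; have : m \notin maxima b by rewrite bE !inE negb_or nmm.
  by rewrite inE.
case: (ltP (lam t b) 0%R) => lb.
  have la : (lam t a < 0)%R by apply: lt_trans lb.
  have aN : a != None by apply: contraTneq la => ->; rewrite lam_None.
  have [m [tm aE _]] := atom_new aA aN.
  have [laE aS] := cover_neg tN aN at_ tm aE la.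
  have [lbE bS] := cover_neg tN bN bt tm' bE lb.
  have mm' : m' < m by rewrite laE lbE lab_ltN in lab.
  have bm_m : bm b m != m by apply: atm => //; rewrite eq_sym -val_eqE /= (ltn_eqF mm').
  have blkaE e : same a m e = same t m e && (e <= m).
    by rewrite aS /split_rel !mem_cutS same_refl leqnn /=; case: same; rewrite //= eq_sym eqb_id.
  have SE : cutS b m = blk a m :\: blk b m'.
    apply/setP => e; rewrite mem_cutS !inE blkaE.
    case: (boolP (same b m' e)) => m'e /=.
      apply/negbTE; rewrite negb_and; apply/orP; left; apply/negP => me.
      have := bm_max (same_trans m'e (etrans (same_sym b e m) me)).
      by rewrite (cover_bm bE) leqNgt mm'.
    case: (boolP (same t m e)) => tme /=; last first.
      by apply: contraNF tme => /andP [/Hb].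
    case: (boolP (e <= m)) => le; rewrite ?andbF // andbT.
    apply: contraT => nme; case/orP: (cover_two bt bE tme nme) => // me.
      have := bm_max me; rewrite (cover_bm bE) leqNgt mm' //.
    by rewrite me in m'e.
  have dS : d %| #|cutS b m|.
    rewrite SE cardsD dvdn_sub ?dvd_blk //.
    case: (boolP (same t m m')) => tmm.
      rewrite (setIidPr _) ?dvd_blk //; apply/subsetP => e.
      rewrite !inE blkaE => m'e; rewrite (same_trans tmm (Hb _ _ m'e)) /=.
      by have := bm_max m'e; rewrite (cover_bm bE) => /leq_trans; apply; apply: ltnW.
    rewrite (_ : _ :&: _ = set0) ?cards0 //; apply/setP => e; rewrite !inE.
    apply: contraNF tmm => /andP [/Ha me /Hb m'e]; apply: same_trans me _.
    by rewrite same_sym.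
  have [c [cN cS cb rkc lc]] := cut_atom bN bm_m dS.
  exists c; last by rewrite lc lbE lab_ltN.
  rewrite /atomQ cb rkc eqxx andbT /=; apply/dpart_leP => e f ef.
  rewrite cS SE /split_rel !inE (Hxb _ _ ef) /= !(same_eqr _ (Hxb _ _ ef)).
  by have /dpart_leP H := xa; rewrite !(same_eqr _ (H _ _ ef)).
have lb' := signed_pos (cover_lam tN bN bt tm' bE) lb.
case: (eqVneq x None) => [xE|xN].
  have [c cA lc] := atom_le0 bN; exists c; first by rewrite xE.
  by apply: le_lt_trans lc _; rewrite lb' lab_pos.
have aN : a != None by apply: contraNneq xN => aE; apply/eqP; apply: atom_None aA aE.
have [m [tm aE _]] := atom_new aA aN.
case: (ltP (lam t a) 0%R) => la; last first.
  have la' := signed_gt0 (cover_lam tN aN at_ tm aE) la.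
  have laE := signed_pos (cover_lam tN aN at_ tm aE) la.
  have mm' : m < m' by rewrite laE lb' lab_lt in lab.
  have xm : bm x m = m.
    have : m \in maxima a by rewrite aE setU11.
    by move/(subsetP (maxima_le xa)); rewrite inE => /eqP.
  have bm_m : bm b m != m by apply: atm => //; rewrite -val_eqE /= (ltn_eqF mm').
  have [c [cA _ lc]] := peel_atom xN xltb xm bm_m.
  by exists c => //; apply: le_lt_trans lc _; rewrite lb' lab_lt.
have [laE aS] := cover_neg tN aN at_ tm aE la.
have blkaE e : same a m e = same t m e && (e <= m).
  by rewrite aS /split_rel !mem_cutS same_refl leqnn /=; case: same; rewrite //= eq_sym eqb_id.
(* Some block of [b] meets both sides of the cut made by [a]: otherwise [b] would split the block of
   [t] at [m] as [a] does, and its label would be negative. *)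
have [e1 [e2 [te1 le1 e12 le2]]] : exists e1 e2,
    [/\ same t m e1, e1 <= m, same b e1 e2 & m < e2].
  set M := bm t m; have tmM : same t m M := bm_same t m.
  have mM : m < M by rewrite ltn_neqAle le_bm andbT eq_sym.
  case: (boolP [exists e in cutS t m, same b e M]) => [/exists_inP [e]|].
    by rewrite mem_cutS => /andP [te le] eM; exists e, M.
  rewrite negb_exists_in => /forall_inP noM.
  have Mt : bm t M = M by have := bm_maxima t m; rewrite inE => /eqP.
  have m'M : ~~ same b m' M.
    apply/negP => m'M; have := bm_max m'M; rewrite (cover_bm bE).
    have /eqP E : bm t m' == bm t M by rewrite bm_eq Hb.
    have := le_bm t m'; rewrite E Mt => le ge.
    by case/eqP: tm'; rewrite E Mt; apply/val_inj/anti_leq; rewrite le ge.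
  have m'L e : e \in cutS t m -> same b m' e.
    move=> eL; have neM := noM _ eL; move: (eL); rewrite mem_cutS => /andP [te _].
    have teM : same t e M by apply: same_trans tmM; rewrite same_sym.
    by case/orP: (cover_two bt bE teM neM) => //; rewrite (negbTE m'M).
  have mL : m \in cutS t m by rewrite mem_cutS same_refl leqnn.
  case: (boolP [exists e, same b m' e && (m < e)]) => [/existsP [e /andP [m'e le]]|].
    exists m, e; split=> //; first exact: same_refl.
    by rewrite -(same_eql _ (m'L _ mL)).
  rewrite negb_exists => /forallP small.
  have m'_m : m' = m.
    apply/val_inj/anti_leq; have := small m'; rewrite same_refl /= -leqNgt => -> /=.
    by rewrite -(cover_bm bE); apply/bm_max/m'L.
  have : (0 < lam t b)%R by rewrite lb' lab_pos.
  rewrite (lam_cover tN bN bt tm' bE); case: ifP => //; case/negP; apply/forallP => e.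
  apply/implyP => /andP [te]; rewrite ltnNge; apply: contra => le.
  by rewrite m'_m in te le *; rewrite -{1}m'_m m'L // mem_cutS te.
(* Cutting at the last letter of that block on the lower side amounts to intersecting the block with
   the lower part, so the result is still a union of blocks of [x]. *)
case: (@arg_maxnP _ e1 (fun e => same b e1 e && (e <= m)) (fun e => e : nat)).
  by rewrite same_refl.
move=> a2 /andP [e1a2 a2m] a2max.
have SE : cutS b a2 = blk b e1 :&: blk a m.
  apply/setP => e; rewrite mem_cutS !inE blkaE -(same_eql _ e1a2).
  case: (boolP (same b e1 e)) => //= be.
  rewrite (same_trans te1 (Hb _ _ be)) /=; apply/idP/idP => [le|le].
    exact: leq_trans le a2m.
  by apply: a2max; rewrite be.
have clS e f : same x e f -> (e \in cutS b a2) = (f \in cutS b a2).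
  move=> ef; rewrite SE !inE !(same_eqr _ (Hxb _ _ ef)).
  by have /dpart_leP H := xa; rewrite !(same_eqr _ (H _ _ ef)).
have ba2 : bm b a2 != a2.
  apply/eqP => E; have := bm_max (same_trans (etrans (same_sym b a2 e1) e1a2) e12).
  by rewrite E leqNgt (leq_ltn_trans a2m le2).
have dS : d %| #|cutS b a2|.
  by apply: (dvd_closed xN) => e f eS /clS <-.
have [c [cN cS cb rkc lc]] := cut_atom bN ba2 dS.
exists c; last by rewrite lc lb'; apply: lt_trans (lab_neg _) (lab_pos _).
rewrite /atomQ cb rkc eqxx andbT /=; apply/dpart_leP => e f ef.
by rewrite cS /split_rel (Hxb _ _ ef) (clS _ _ ef) eqxx.
Qed.

End MinAtom.

Lemma exists_atom t x : (x < t)%O -> exists b, atomQ t x b.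
Proof.
move=> xt; have tN := lt_neq_None xt; case: (eqVneq x None) => [->|xN].
  by have [b bA _] := atom_le0 tN; exists b.
have [m] : exists m, m \in maxima x :\: maxima t.
  apply/set0Pn; rewrite -card_gt0 cardsD (setIidPr _) ?maxima_le ?(ltW xt) //.
  by rewrite subn_gt0 maxima_lt.
rewrite !inE => /andP [tm /eqP xm].
by have [b [bA _ _]] := peel_atom xN xt xm tm; exists b.
Qed.

Lemma EL_atoms t x : (x < t)%O -> exists a, [/\ atomQ t x a,
  forall b, atomQ t x b -> b != a -> (lam t a < lam t b)%R,
  forall c, atomQ a x c -> (lam t a <= lam a c)%R
  & forall b, atomQ t x b -> b != a ->
      exists2 c : Q, atomQ b x c & (lam b c < lam t b)%R].
Proof.
move=> xt; have [a0 a0A] := exists_atom xt.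
case: (@Order.TotalTheory.arg_minP _ _ _ a0 (atomQ t x) (lam t) a0A) => a aA a_min.
exists a; split=> //.
- exact: min_atom_strict.
- exact: min_atom_ascends.
- exact: min_atom_descends.
Qed.

Definition rkd (x : Q^d) : nat := rk (x : Q).

Lemma rk_lt_dual (x y : Q^d) : (x < y)%O -> rkd x < rkd y.
Proof. exact: rk_ltQ. Qed.

Lemma gapless_dual : gapless rkd [set: Q^d].
Proof.
move=> t x _ _ xt rkx; have [b /and3P [bt xb /eqP rkb]] := exists_atom (xt : (x < t :> Q)%O).
exists b; rewrite ?inE //; apply/andP; split; first exact: bt.
have: (x <= b :> Q)%O := xb; rewrite le_eqVlt => /predU1P [E|//].
by move: rkx; rewrite /rkd E rkb ltnn.
Qed.

Lemma dual_EL : @EL_labeling _ Q^d _ int (@lam n d).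
Proof.
apply: (EL_criterion rk_lt_dual gapless_dual) => t x xt.
have [a [aA a1 a2 a3]] := EL_atoms (xt : (x < t :> Q)%O).
have atomE (u v w : Q^d) : atom rkd u v w = atomQ u v w.
  by rewrite /atom /atomQ andbA.
exists a; split=> [|b|c|b]; rewrite !atomE //.
- exact: a1.
- exact: a2.
by move=> bA /(a3 b bA) [c]; exists c; rewrite ?atomE.
Qed.
End Splits.

(** * Splits and switches as sign vectors *)

Section SplitAndSwitch.
Implicit Types (x y z : Q) (a b e p q : 'I_n) (I J V W : {set 'I_k}) (alpha : 'S_n).

(** This is how [d > 1] keeps the transpositions at different cuts disjoint: the one at cut [i]
    moves the 0-based positions [d * i - 1] and [d * i] only. *)
Lemma dvd_adj i : d %| i -> d %| i.+1 -> False.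
Proof.
by move=> di; rewrite -addn1 dvdn_addr // dvdn1 => /eqP E; move: d_gt1; rewrite E.
Qed.

Lemma cut_lt_n (i : 'I_k) : d * i < n.
Proof. by rewrite -[X in _ < X](divnK d_dvd) mulnC ltn_pmul2r ?d_gt0. Qed.

Lemma cut_inj (i j : 'I_k) : d * i = d * j -> i = j.
Proof.
by move=> /eqP; rewrite eqn_pmul2l ?d_gt0 // => /eqP; apply: val_inj.
Qed.

Lemma switch_cases W p :
  [\/ exists i, [/\ i \in W, p.+1 = d * i & switch d W p = d * i :> nat],
      exists i, [/\ i \in W, p = d * i :> nat & switch d W p = p.-1 :> nat] |
      switch d W p = p /\ forall i, i \in W -> (p.+1 != d * i) && (p != d * i :> nat)].
Proof.
rewrite /switch; case: ifP => [/exists_inP [i iW /eqP E]|/negbT].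
  by constructor 1; exists i; split=> //; rewrite val_insubd E cut_lt_n.
rewrite negb_exists_in => /forall_inP h1.
case: ifP => [/exists_inP [i iW /eqP E]|/negbT].
  constructor 2; exists i; split=> //; rewrite val_insubd.
  by rewrite (leq_ltn_trans (leq_pred _) (ltn_ord p)).
rewrite negb_exists_in => /forall_inP h2.
by constructor 3; split=> // i iW; rewrite h1 // h2.
Qed.

Lemma switch_at W (i : 'I_k) p q : p.+1 = d * i -> q = d * i :> nat ->
  (switch d W p = if i \in W then q else p) /\
  (switch d W q = if i \in W then p else q).
Proof.
move=> pE qE; have pq : p.+1 = q by rewrite pE.
split; apply: val_inj => /=.
  case: (switch_cases W p) => [[j [jW E ->]]|[j [jW E _]]|[-> H]].
  - by have -> : i = j; [apply: cut_inj; rewrite -pE|rewrite jW qE -pE E].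
  - by exfalso; apply: (@dvd_adj p); rewrite ?pE ?E dvdn_mulr.
  by case: ifP => // /H; rewrite pE eqxx.
case: (switch_cases W q) => [[j [jW E _]]|[j [jW E ->]]|[-> H]].
- by exfalso; apply: (@dvd_adj q); rewrite ?qE ?dvdn_mulr // -qE E dvdn_mulr.
- by have -> : i = j; [apply: cut_inj; rewrite -qE|rewrite jW -pq].
by case: ifP => // /H; rewrite qE eqxx andbF.
Qed.

Section NonZero.
Variable W : {set 'I_k}.
Hypothesis W0 : {in W, forall i : 'I_k, 0 < i}.

(** A switch exchanges two neighbours across a multiple of [d], so it crosses no other threshold. *)
Lemma switch_lt p r : ~~ (d %| r) -> (switch d W p < r) = (p < r).
Proof.
move=> dr; case: (switch_cases W p) => [[i [iW E ->]]|[i [iW E ->]]|[-> //]].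
  rewrite -E ltn_neqAle; case: eqVneq => //= Er.
  by rewrite -Er E dvdn_mulr in dr.
have p0 : 0 < p by rewrite E muln_gt0 d_gt0 W0.
rewrite [RHS]ltn_neqAle prednK // andbC; case: eqVneq => [Er|]; rewrite ?andbT //.
by rewrite -Er E dvdn_mulr in dr.
Qed.

(** The side of the cut [i] on which position [p] ends, with [s] telling whether [i] is switched.
    The switches at other cuts do not matter, which is why sign vectors can be restricted to fewer
    cuts. *)
Definition beyond (s : bool) (i p : nat) :=
  if s then (p.+1 == d * i) || (d * i < p) else d * i <= p.

Lemma cut_switch (i : 'I_k) p :
  (d * i <= switch d W p) = beyond (i \in W) i p.
Proof.
rewrite /beyond; case: (switch_cases W p) => [[j [jW E ->]]|[j [jW E ->]]|[-> H]].
- case: (eqVneq i j) => [->|nij]; first by rewrite jW leqnn -E eqxx.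
  have nE : (p.+1 == d * i) = false.
    by apply: contra_neqF nij => /eqP; rewrite E => /cut_inj.
  have nE' : (d * i == p) = false.
    by apply/negP => /eqP E'; apply: (@dvd_adj p); rewrite ?E -?E' dvdn_mulr.
  rewrite -E leq_eqVlt eq_sym nE /= ltnS leq_eqVlt nE' /=.
  by case: ifP.
- have p0 : 0 < p by rewrite E muln_gt0 d_gt0 W0.
  have nE : (p.+1 == d * i) = false.
    by apply/negP => /eqP E'; apply: (@dvd_adj p); rewrite ?E' ?E dvdn_mulr.
  rewrite nE /= -ltnS prednK //; case: (eqVneq i j) => [->|nij].
    by rewrite jW E ltnn.
  have nE' : (d * i == p) = false.
    by apply: contra_neqF nij => /eqP; rewrite E => /cut_inj.
  by rewrite [d * i <= p]leq_eqVlt nE'; case: ifP.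
case: ifP => // /H /andP [/negbTE -> /negbTE np] /=.
by rewrite leq_eqVlt eq_sym np.
Qed.

Lemma switchK : involutive (switch d W : 'I_n -> 'I_n).
Proof.
move=> p; apply: val_inj => /=.
case: (switch_cases W p) => [[j [jW E E']]|[j [jW E E']]|[E H]]; last by rewrite !E.
  case: (switch_cases W (switch d W p)) => [[i [iW F F']]|[i [iW F F']]|[F H]].
  - by exfalso; apply: (@dvd_adj (switch d W p)); rewrite ?F ?E' dvdn_mulr.
  - by rewrite F' E' -E.
  - by have /andP [_] := H _ jW; rewrite E' eqxx.
have p0 : 0 < p by rewrite E muln_gt0 d_gt0 W0.
case: (switch_cases W (switch d W p)) => [[i [iW F F']]|[i [iW F F']]|[F H]].
- by rewrite F' -F E' prednK.
- exfalso; apply: (@dvd_adj (switch d W p)); first by rewrite F dvdn_mulr.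
  by rewrite E' prednK // E dvdn_mulr.
- by have /andP [] := H _ jW; rewrite E' prednK // E eqxx.
Qed.

End NonZero.

Definition nonzero I := {in I, forall i : 'I_k, 0 < i}.

Lemma nonzeroS I J : I \subset J -> nonzero J -> nonzero I.
Proof. by move=> /subsetP IJ J0 i /IJ; apply: J0. Qed.

(* As [switch] is an involution, this is the position of [a] in the word [alpha]
   after the switches in [W]. *)
Definition po alpha W a := switch d W ((alpha^-1)%g a).

Definition letter alpha W p := alpha (switch d W p).

Lemma poK alpha W : nonzero W -> cancel (po alpha W) (letter alpha W).
Proof. by move=> W0 a; rewrite /po /letter switchK // permKV. Qed.

Lemma letterK alpha W : nonzero W -> cancel (letter alpha W) (po alpha W).
Proof. by move=> W0 p; rewrite /po /letter permK switchK. Qed.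

Definition seg I p q := [forall i in I, (d * i <= p) == (d * i <= q)].

Lemma seg_count I p q :
  (#|[set i in I | d * i <= p]| == #|[set i in I | d * i <= q]|) = seg I p q.
Proof.
apply/idP/forall_inP => [E i iI|H]; last first.
  apply/eqP; congr #|pred_of_set _|; apply/setP => i; rewrite !inE.
  by case: (boolP (i \in I)) => //= /H /eqP.
suff S : [set i in I | d * i <= p] = [set i in I | d * i <= q].
  by move/setP/(_ i): S; rewrite !inE iI /= => ->.
have [pq|qp] := leqP p q.
  apply/eqP; rewrite eqEcard (eqP E) leqnn andbT; apply/subsetP => j.
  by rewrite !inE => /andP [-> /leq_trans ->].
apply/esym/eqP; rewrite eqEcard (eqP E) leqnn andbT; apply/subsetP => j.
by rewrite !inE => /andP [-> /leq_trans ->] //; apply: ltnW.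
Qed.

Lemma seg_equiv I : equivalence_rel (seg I).
Proof. by move=> p q r; rewrite -!seg_count eqxx; split=> // /eqP ->. Qed.

(** The pair [I], [W] encodes the sign vector of [x]: [I] is its support and [W] the set of negative
    entries. *)
Definition SW alpha x I W := [/\ nonzero I, W \subset I, x != None
  & forall a b, same x a b = seg I (po alpha W a) (po alpha W b)].

Lemma split_partitionE alpha I W : nonzero W -> split_partition alpha I W =
  equivalence_partition (fun a b => seg I (po alpha W a) (po alpha W b)) [set: 'I_n].
Proof.
move=> W0; have set_eq p : [set alpha (switch d W q) | q in
    [set q in [set: 'I_n] | #|[set i in I | d * i <= p]| == #|[set i in I | d * i <= q]| ]]
  = [set b in [set: 'I_n] | seg I (po alpha W (letter alpha W p)) (po alpha W b)].
  apply/setP => b; rewrite !inE letterK //; apply/imsetP/idP => [[q]|pb].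
    by rewrite !inE seg_count => pq ->; rewrite -/(letter _ _ _) letterK.
  exists (po alpha W b); first by rewrite !inE seg_count.
  by rewrite -/(letter _ _ _) poK.
apply/setP => B; apply/imsetP/imsetP => [[S /imsetP [p _ ->] ->]|[a _ ->]].
  by exists (letter alpha W p); rewrite ?inE // set_eq.
exists [set q in [set: 'I_n] |
  #|[set i in I | d * i <= po alpha W a]| == #|[set i in I | d * i <= q]| ].
  by apply/imsetP; exists (po alpha W a); rewrite ?inE.
by rewrite set_eq poK.
Qed.

Lemma card_run (q : nat) : q < k -> #|[set p : 'I_n | p %/ d == q]| = d.
Proof.
move=> qk; have lt (j : 'I_d) : q * d + j < n.
  rewrite -(divnK d_dvd); apply: leq_trans (_ : q.+1 * d <= _).
    by rewrite mulSn addnC ltn_add2r.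
  by rewrite leq_mul2r qk orbT.
rewrite (_ : [set _ | _] = [set Ordinal (lt j) | j in [set: 'I_d]]).
  by rewrite card_imset ?cardsT ?card_ord // => i j [] /addnI /val_inj.
apply/setP => p; rewrite inE; apply/eqP/imsetP => [E|[j _ ->] /=]; last first.
  by rewrite divnMDl ?d_gt0 // divn_small ?addn0.
exists (Ordinal (ltn_pmod p (d_gt0 : 0 < d))) => //; apply: val_inj.
by rewrite /= -E -divn_eq.
Qed.

Lemma dvd_runs (f : 'I_n -> 'I_n) (S : {set 'I_n}) : injective f ->
  (forall a b, a \in S -> f a %/ d = f b %/ d -> b \in S) -> d %| #|S|.
Proof.
move=> f_inj SC; have [g fK gK] := injF_bij f_inj.
rewrite (@card_uniform_partition _ d (preim_partition (fun a => f a %/ d) S) S).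
- exact: dvdn_mull.
- move=> B /imsetP [a aS ->].
  rewrite -[RHS](@card_run (f a %/ d)) ?ltn_divLR ?d_gt0 ?divnK //.
  rewrite -(card_imset _ f_inj); congr #|pred_of_set _|; apply/setP => p.
  rewrite !inE; apply/imsetP/eqP => [[b]|E].
    by rewrite !inE => /andP [_ /eqP ->] ->.
  exists (g p); rewrite ?gK // !inE gK E eqxx andbT; apply: SC aS _.
  by rewrite gK E.
exact: preim_partitionP.
Qed.

Lemma seg_run I p q : p %/ d = q %/ d -> seg I p q.
Proof.
move=> E; apply/forall_inP => i _.
by rewrite ![d * i]mulnC -!leq_divRL ?d_gt0 // E.
Qed.

Lemma po_inj alpha W : nonzero W -> injective (po alpha W).
Proof. by move=> W0; apply: can_inj (poK _ W0). Qed.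

Lemma SW_ex alpha I W : nonzero I -> W \subset I ->
  exists2 x : Q, SW alpha x I W & x \in Sigma d alpha.
Proof.
move=> I0 WI; have W0 := nonzeroS WI I0.
pose r := fun a b => seg I (po alpha W a) (po alpha W b).
have er : {in [set: 'I_n] & &, equivalence_rel r}.
  by move=> a b e _ _ _; apply: seg_equiv.
have pP := equivalence_partitionP er.
have pd : d_divisible d (split_partition alpha I W).
  rewrite split_partitionE // /d_divisible pP; apply/forall_inP => B /imsetP [a _ ->].
  apply: (@dvd_runs (po alpha W)); first exact: po_inj.
  move=> b e; rewrite !inE => ab be; have [_ ->] := seg_equiv I
    (po alpha W a) (po alpha W b) (po alpha W e) => //.
  exact: seg_run.
exists (Some (exist _ (split_partition alpha I W) pd)).
  split=> // a b; rewrite /same /= split_partitionE //.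
  by rewrite pblock_equivalence_partition ?inE.
rewrite inE; apply/existsP; exists I; apply/existsP; exists W.
rewrite WI eqxx !andbT /=; apply/subsetP => i /I0.
by rewrite inE.
Qed.

Lemma SW_mem alpha x I W : SW alpha x I W -> x \in Sigma d alpha.
Proof.
case=> I0 WI xN xE; have [y [_ _ yN yE] yS] := SW_ex alpha I0 WI.
by rewrite (_ : x = y) //; apply: same_inj => a b; rewrite xE yE.
Qed.

Lemma Sigma_SW alpha x : x \in Sigma d alpha -> x != None ->
  exists I W, SW alpha x I W.
Proof.
case: x => [p|] //; rewrite inE => /existsP [I /existsP [W /and3P [I0 WI /eqP pE]]] _.
have nzI : nonzero I by move=> i /(subsetP I0); rewrite inE.
exists I, W; split=> // a b; rewrite /same pE split_partitionE; last exact: nonzeroS nzI.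
rewrite pblock_equivalence_partition ?inE // => e f g _ _ _.
exact: seg_equiv.
Qed.

Lemma seg_adj I p q : p.+1 = q :> nat -> ~~ (d %| q) -> seg I p q.
Proof.
move=> pq dq; apply/forall_inP => i _.
rewrite [X in _ == X]leq_eqVlt -{2}pq ltnS.
case: (eqVneq (d * i) (q : nat)) => [E|_ //].
by rewrite -E dvdn_mulr in dq.
Qed.

Section Refine.
Variables (alpha : 'S_n) (x y : Q) (I J W V : {set 'I_k}).
Hypotheses (xI : SW alpha x I W) (yJ : SW alpha y J V).

Let I0 : nonzero I. Proof. by case: xI. Qed.
Let J0 : nonzero J. Proof. by case: yJ. Qed.
Let WI : W \subset I. Proof. by case: xI. Qed.
Let VJ : V \subset J. Proof. by case: yJ. Qed.
Let W0 : nonzero W. Proof. exact: nonzeroS I0. Qed.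
Let V0 : nonzero V. Proof. exact: nonzeroS J0. Qed.

Lemma SW_same a b : same x a b = [forall i in I,
  (d * i <= po alpha W a) == (d * i <= po alpha W b)].
Proof. by case: xI => _ _ _ ->. Qed.

Lemma SW_le : J \subset I -> V = W :&: J -> (x <= y)%O.
Proof.
move=> JI VE; apply/dpart_leP => a b; rewrite SW_same.
case: yJ => _ _ _ -> /forall_inP H; apply/forall_inP => j jJ.
have := H j (subsetP JI _ jJ).
by rewrite /po !cut_switch // VE inE jJ andbT.
Qed.

Hypothesis xy : (x <= y)%O.

Let le_same a b : same x a b -> same y a b.
Proof. exact/dpart_leP. Qed.

Let y_cut a b j : j \in J -> same y a b ->
  (d * j <= po alpha V a) = (d * j <= po alpha V b).
Proof. by move=> jJ; case: yJ => _ _ _ -> /forall_inP /(_ j jJ) /eqP. Qed.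

Let cut_pos j : j \in J -> exists2 p : 'I_n, p.+1 = d * j & p.-1 < n.
Proof.
move=> jJ; have j0 : 0 < d * j by rewrite muln_gt0 d_gt0 J0.
have lt : (d * j).-1 < n by rewrite prednK // ltnW // cut_lt_n.
exists (Ordinal lt); first by rewrite /= prednK.
exact: leq_ltn_trans (leq_pred _) lt.
Qed.

Let ndvd_pred j p : p.+1 = d * j -> ~~ (d %| p).
Proof.
by move=> E; apply/negP => dp; apply: (dvd_adj dp); rewrite E dvdn_mulr.
Qed.

Let ndvd_succ j : ~~ (d %| (d * j).+1).
Proof. by apply/negP => /(dvd_adj (dvdn_mulr j (dvdnn d))). Qed.

(** If [j] is not in [I], the letters of [alpha] on the two sides of the cut [j] share a block of
    [x], since the switches at other cuts do not move them; but [y] separates them, switched or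
    not. *)
Lemma SW_sub : J \subset I.
Proof.
apply/subsetP => j jJ; apply: contraT => jI.
have [p pE _] := cut_pos jJ; pose q := Ordinal (cut_lt_n j).
have : same y (alpha p) (alpha q).
  apply: le_same; rewrite SW_same; apply/forall_inP => i iI.
  have nij : (d * j == d * i) = false.
    by apply: contraNF jI => /eqP/cut_inj ->.
  have nE : (d * i == p) = false.
    by apply: contraTF (ndvd_pred pE) => /eqP <-; rewrite negbK dvdn_mulr.
  have nE' : ((d * j).+1 == d * i) = false.
    by apply: contraTF (ndvd_succ j) => /eqP ->; rewrite negbK dvdn_mulr.
  rewrite /po !permK !cut_switch // /beyond /= -pE; rewrite -pE in nij nE'.
  have nij' : (d * i == p.+1) = false by rewrite eq_sym.
  rewrite nij nE' /= ltnS [d * i <= p]leq_eqVlt nE /=.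
  by rewrite [d * i <= p.+1]leq_eqVlt nij' ltnS [d * i <= p]leq_eqVlt nE.
move/(y_cut jJ); rewrite /po !permK !cut_switch // /beyond /= pE eqxx -pE ltnn.
by rewrite eqn_leq ltnn leqnn; case: ifP.
Qed.

(** Follow the letter [a] just before the cut [j] in [alpha]. In the word of [x] it shares its run
    with a neighbour [e] on the far side from the cut, which exists because [d > 1]. Passing from
    [W] to [V] never brings [e] across the cut, so in [y] as well [a] lies on the side of [e]. *)
Lemma SW_switch : V = W :&: J.
Proof.
suff H j : j \in J -> (j \in V) = (j \in W).
  apply/setP => j; rewrite inE; case: (boolP (j \in J)) => jJ.
    by rewrite H ?andbT.
  by rewrite andbF; apply: contraNF jJ; apply: (subsetP VJ).
move=> jJ; have [p pE p1n] := cut_pos jJ; set a := alpha p.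
have cW : (d * j <= po alpha W a) = (j \in W).
  by rewrite /po /a permK cut_switch // /beyond pE eqxx -pE ltnn; case: ifP.
have cV : (d * j <= po alpha V a) = (j \in V).
  by rewrite /po /a permK cut_switch // /beyond pE eqxx -pE ltnn; case: ifP.
case: (boolP (j \in W)) => jW; rewrite ?jW ?(negbTE jW) in cW *.
  have q1 : (d * j).+1 < n.
    apply: leq_trans (_ : d * j.+1 <= n); first by rewrite mulnS -addn2 addnC leq_add2r.
    apply: leq_trans (eq_leq (divnK d_dvd)).
    by rewrite mulnC leq_pmul2r ?d_gt0.
  pose e := letter alpha W (Ordinal q1).
  have We : po alpha W e = Ordinal q1 by rewrite /e letterK.
  have Wa : po alpha W a = d * j :> nat.
    apply/eqP; rewrite eqn_leq cW andbT -ltnS /po switch_lt // /a permK.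
    by rewrite -pE ltnW.
  have : same y a e.
    apply: le_same; case: xI => _ _ _ ->; rewrite We; apply: seg_adj.
      by rewrite Wa.
    exact: ndvd_succ.
  move/(y_cut jJ); rewrite cV => ->; apply/idP.
  have : ~~ (po alpha W e < (d * j).+1) by rewrite We /= ltnn.
  by rewrite /po !switch_lt // -(switch_lt V0) // -leqNgt => /ltnW.
have dp := ndvd_pred pE.
have p0 : 0 < p.
  by rewrite lt0n; apply: contraNneq dp => ->.
pose e := letter alpha W (Ordinal p1n).
have We : po alpha W e = Ordinal p1n by rewrite /e letterK.
have Wa : po alpha W a = p.
  apply/val_inj/anti_leq; rewrite /= -ltnS pE ltnNge cW /= leqNgt.
  by rewrite /po switch_lt // /a permK ltnn.
have : same y a e.
  apply: le_same; case: xI => _ _ _ ->; rewrite We Wa.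
  have [rfl <-] := seg_equiv I (Ordinal p1n) p (Ordinal p1n) => //.
  by apply: seg_adj => //=; rewrite prednK.
move/(y_cut jJ); rewrite cV => ->; apply/negbTE; rewrite -ltnNge -pE ltnS ltnW //.
have : po alpha W e < p by rewrite We /= prednK.
by rewrite /po !switch_lt.
Qed.

End Refine.

Lemma SW_unique alpha x I J W V : SW alpha x I W -> SW alpha x J V ->
  I = J /\ W = V.
Proof.
move=> xI xJ; have JI := SW_sub xI xJ (lexx x); have IJ := SW_sub xJ xI (lexx x).
have E : I = J by apply/eqP; rewrite eqEsubset IJ.
split=> //; rewrite (SW_switch xI xJ (lexx x)); apply/esym/setIidPl.
by rewrite -E; case: xI.
Qed.

Definition cuts : {set 'I_k} := [set i : 'I_k | 0 < i].

Lemma nonzero_cuts : nonzero cuts.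
Proof. by move=> i; rewrite inE. Qed.

Lemma sub_cuts I : nonzero I -> I \subset cuts.
Proof. by move=> I0; apply/subsetP => i /I0; rewrite inE. Qed.

Lemma card_cuts : #|cuts| = k.-1.
Proof.
rewrite (_ : cuts = [set~ Ordinal k_gt0]) ?cardsC1 ?card_ord //.
by apply/setP => i; rewrite !inE lt0n.
Qed.

Lemma SW_lt alpha x y I J W V : SW alpha x I W -> SW alpha y J V ->
  J \proper I -> V = W :&: J -> (x < y)%O.
Proof.
move=> xI yJ JI VE; rewrite lt_neqAle (SW_le xI yJ (proper_sub JI) VE) andbT.
apply: contraTneq JI => E; rewrite E in xI.
by have [-> _] := SW_unique xI yJ; rewrite properxx.
Qed.

Lemma rk_SW_ge alpha x I W : SW alpha x I W -> #|I| <= rk x.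
Proof.
move: {2}#|I| (erefl #|I|) => m; elim: m I x W => [|m IHm] I x W Im xI.
  by rewrite Im.
have [i iI] : exists i, i \in I by apply/set0Pn; rewrite -card_gt0 Im.
have [I0 WI xN _] := xI; have I0' := nonzeroS (subsetDl I [set i]) I0.
have [y yI _] := SW_ex alpha I0' (subsetIr W (I :\ i)).
have xy : (x < y)%O by apply: SW_lt xI yI (properD1 iI) _.
apply: leq_trans (rk_ltQ xy); rewrite Im ltnS.
have E : #|I :\ i| = m by move: Im; rewrite (cardsD1 i) iI => -[].
by rewrite -E; apply: IHm yI.
Qed.

(* Making the missing cuts one at a time raises the rank at each step, and there
   are only [k - 1] cuts, so each step raises it by exactly one. *)
Lemma rk_SW alpha x I W : SW alpha x I W -> rk x = #|I|.
Proof.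
move=> xI; apply/eqP; rewrite eqn_leq (rk_SW_ge xI) andbT.
move: {2}#|cuts :\: I| (erefl #|cuts :\: I|) => m.
elim: m I x W xI => [|m IHm] I x W xI Im; have [I0 WI xN _] := xI.
  have IE : I = cuts.
    by apply/eqP; rewrite eqEsubset sub_cuts // -setD_eq0 -cards_eq0 Im.
  by rewrite IE card_cuts -ltnS prednK ?k_gt0 // rk_lt_k.
have [i] : exists i, i \in cuts :\: I by apply/set0Pn; rewrite -card_gt0 Im.
rewrite inE => /andP [iI ic].
have iI0 : nonzero (i |: I).
  by move=> j /setU1P [->|/I0 //]; move: ic; rewrite inE.
have [z zI _] := SW_ex alpha iI0 (subset_trans WI (subsetUr [set i] I)).
have zx : (z < x)%O.
  apply: (SW_lt zI xI); last by apply/esym/setIidPl.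
  by rewrite properEneq subsetUr andbT; apply: contraNneq iI => ->; rewrite setU11.
rewrite -ltnS; apply: leq_trans (rk_ltQ zx) _.
have <- : #|i |: I| = #|I|.+1 by rewrite cardsU1 iI.
apply: IHm zI _; move: Im; rewrite (cardsD1 i) inE iI ic add1n => -[<-].
by congr #|pred_of_set _|; apply/setP => j; rewrite !inE negb_or andbA.
Qed.

(** Make one of the cuts of [y] that [x] lacks, switched as in [y]; when [y] is the bottom, make all
    cuts. *)
Lemma gapless_Sigma alpha : gapless rkd (Sigma d alpha : {set Q^d}).
Proof.
move=> x y xS yS xy; have yx : (y < x :> Q)%O := xy; rewrite /rkd => rkxy.
have xN : x != None := lt_neq_None yx.
have [I [W xI]] := Sigma_SW xS xN; have [I0 WI _ _] := xI.
case: (eqVneq (y : Q) None) => [yE|yN].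
  have [z zI zS] := SW_ex alpha nonzero_cuts (subset_trans WI (sub_cuts I0)).
  exists z => //; apply/andP; split.
    change (z < x :> Q)%O; apply: (SW_lt zI xI).
      rewrite properEcard sub_cuts // card_cuts -(rk_SW xI).
      by move: rkxy; rewrite yE /= ltn_predRL.
    by apply/esym/setIidPl.
  change (y < z :> Q)%O; rewrite yE lt_neqAle eq_sym.
  by have [_ _ zN _] := zI; rewrite zN; case: (z).
have [J [V yJ]] := Sigma_SW yS yN; have [J0 VJ _ _] := yJ.
have IJ := SW_sub yJ xI (ltW yx); have WE := SW_switch yJ xI (ltW yx).
rewrite (rk_SW xI) (rk_SW yJ) in rkxy.
have [i iJ iI] : exists2 i, i \in J & i \notin I.
  apply/subsetPn; apply: contraTN rkxy => /subset_leq_card JI.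
  by rewrite -leqNgt (leq_trans JI).
have iJs : i |: I \subset J by rewrite subUset sub1set iJ.
have [z zI zS] := SW_ex alpha (nonzeroS iJs J0) (subsetIr V (i |: I)).
exists z => //; apply/andP; split.
  change (z < x :> Q)%O; apply: (SW_lt zI xI).
    by rewrite properEneq subsetUr andbT; apply: contraNneq iI => ->; rewrite setU11.
  by rewrite -setIA (setIidPr (subsetUr _ _)).
change (y < z :> Q)%O; apply: (SW_lt yJ zI) => //.
by rewrite properEcard iJs cardsU1 iI.
Qed.
End SplitAndSwitch.

(** * The canonical word of a chain *)

Section CanonicalWords.
Implicit Types (c x y z : Q) (a b e p q : 'I_n) (i j : 'I_k) (I J V W : {set 'I_k}).
Implicit Types (alpha beta : 'S_n).

(* Listing the letters in this order makes the blocks of every member of [C]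
   contiguous and sorts them by their maxima; switching at the ascents then gives
   the rr-lex first word whose [Sigma] contains [C]. *)
Definition prec (C : {set Q}) : rel 'I_n := fun a b =>
  [exists c : Q in None |: C, (bm c a < bm c b) &&
    [forall c' : Q in None |: C, (c < c')%O ==> same c' a b]].

Lemma precP (C : {set Q}) a b : reflect
  (exists c : Q, [/\ c \in None |: C, bm c a < bm c b &
     forall c' : Q, c' \in None |: C -> (c < c')%O -> same c' a b]) (prec C a b).
Proof.
apply: (iffP exists_inP) => [[c cC /andP [lt /forall_inP H]]|[c [cC lt H]]].
  by exists c; split=> // c' c'C; apply/implyP/H.
exists c => //; rewrite lt; apply/forall_inP => c' c'C.
by apply/implyP; apply: H.
Qed.

Lemma bm_None a : bm (None : Q) a = a.
Proof. by apply: bm_unique => [|b]; [apply: same_refl|move=> /eqP ->]. Qed.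

Lemma prec_irr (C : {set Q}) a : prec C a a = false.
Proof. by apply/negbTE/negP => /precP [c [_]]; rewrite ltnn. Qed.

Section Word.
Variable C : {set Q}.
Hypothesis cC : @chain _ Q^d C.
Notation C0 := ((None : Q) |: C).
Local Notation "a -< b" := (prec C a b) (at level 70).

Lemma chain_cmp x y : x \in C0 -> y \in C0 -> (x <= y)%O || (y <= x)%O.
Proof.
move=> /setU1P [->|xC] /setU1P [->|yC] //; first by rewrite orbC.
by have := chainP _ cC _ _ xC yC; rewrite orbC.
Qed.

Lemma None_C0 : (None : Q) \in C0. Proof. exact: setU11. Qed.

Lemma chain_lt x y : x \in C0 -> y \in C0 -> ~~ (x < y)%O -> (y <= x)%O.
Proof.
move=> xC yC; have := chain_cmp xC yC.
by rewrite le_eqVlt => /orP [/orP [/eqP ->|->]|].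
Qed.

Lemma prec_total a b : a != b -> (a -< b) || (b -< a).
Proof.
move=> nab; have nN : (None \in C0) && ~~ same (None : Q) a b by rewrite None_C0.
case: (@arg_minnP _ (None : Q) (fun c => (c \in C0) && ~~ same c a b) (fun c => rk c) nN).
move=> c /andP [cC0 nsame] cmin.
have above c' : c' \in C0 -> (c < c')%O -> same c' a b.
  move=> c'C lt; apply: contraT => ns; have := cmin c'; rewrite c'C ns => /(_ isT).
  by rewrite leqNgt rk_ltQ.
have : bm c a != bm c b by rewrite bm_eq.
rewrite -val_eqE neq_ltn => /orP [] lt; apply/orP; [left|right]; apply/precP.
  by exists c.
by exists c; split=> // c' c'C /above; rewrite same_sym; apply.
Qed.

Lemma prec_trans : transitive (prec C).
Proof.
move=> b a e /precP [c [cC0 ltc Hc]] /precP [c' [c'C ltc' Hc']]; apply/precP.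
case: (boolP (c < c')%O) => [cc'|/(chain_lt cC0 c'C)].
  exists c'; split=> // [|c'' c''C lt].
    by rewrite (eqP (_ : bm c' a == bm c' b)) // bm_eq Hc.
  by apply: same_trans (Hc _ c''C (lt_trans cc' lt)) (Hc' _ c''C lt).
rewrite le_eqVlt => /predU1P [E|c'c].
  exists c; split=> // [|c'' c''C lt]; first by apply: ltn_trans ltc _; rewrite -E.
  by apply: same_trans (Hc _ c''C lt) (Hc' _ c''C _); rewrite E.
exists c; split=> // [|c'' c''C lt].
  by rewrite -(eqP (_ : bm c b == bm c e)) // bm_eq Hc'.
by apply: same_trans (Hc _ c''C lt) (Hc' _ c''C (lt_trans c'c lt)).
Qed.

Lemma prec_asym a b : a -< b -> (b -< a) = false.
Proof. by move=> ab; apply/negbTE/negP => /(prec_trans ab); rewrite prec_irr. Qed.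

Lemma prec_sep c a b : c \in C0 -> ~~ same c a b -> a -< b ->
  exists c' : Q, [/\ c' \in C0, (c <= c')%O, bm c' a < bm c' b &
    forall c'' : Q, c'' \in C0 -> (c' < c'')%O -> same c'' a b].
Proof.
move=> cC0 ns /precP [c' [c'C lt H]]; exists c'; split=> //.
by apply: chain_lt => //; apply: contra ns; apply: H.
Qed.

(** Otherwise the coarsest members separating [a] from [b] and [b] from [e] both contain [c], hence
    keep [a] and [e] together. If they differ, the coarser one separates only one of the two pairs;
    if they are equal, the maxima increase from [a] to [e] although they coincide. *)
Lemma prec_contig c a b e : c \in C0 -> same c a e -> a -< b -> b -< e -> same c a b.
Proof.
move=> cC0 ae ab be; apply: contraT => nab.
have nbe : ~~ same c b e.
  by apply: contra nab => be'; rewrite (same_eqr _ be').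
have [c1 [c1C cc1 lt1 H1]] := prec_sep cC0 nab ab.
have [c2 [c2C cc2 lt2 H2]] := prec_sep cC0 nbe be.
have E1 : bm c1 a = bm c1 e.
  by apply/eqP; rewrite bm_eq; move/dpart_leP: cc1; apply.
have E2 : bm c2 a = bm c2 e.
  by apply/eqP; rewrite bm_eq; move/dpart_leP: cc2; apply.
have [lt|/(chain_lt c1C c2C)] := boolP (c1 < c2)%O.
  have := H1 _ c2C lt; rewrite -bm_eq E2 => /eqP E.
  by rewrite E ltnn in lt2.
rewrite le_eqVlt => /predU1P [E|lt].
  by rewrite E -E1 in lt2; have := ltn_trans lt1 lt2; rewrite ltnn.
by have := H2 _ c1C lt; rewrite -bm_eq -E1 => /eqP E; rewrite E ltnn in lt1.
Qed.

Lemma prec_bm c a : c \in C0 -> a != bm c a -> a -< bm c a.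
Proof.
move=> cC0 na; case/orP: (prec_total na) => // /precP [c2 [c2C lt H]].
have : ~~ same c2 (bm c a) a by rewrite -bm_eq neq_ltn lt.
have [lt2|/(chain_lt cC0 c2C) le2] := boolP (c < c2)%O.
  by move/dpart_leP: (ltW lt2) => -> //; rewrite same_sym bm_same.
move=> _; have := leq_trans lt (bm_le a le2).
by rewrite ltnNge le_bm.
Qed.

Definition rank_in a : nat := #|[set b | b -< a]|.

Lemma rank_in_lt a : rank_in a < n.
Proof.
rewrite /rank_in -[X in _ < X]card_ord -cardsT; apply: proper_card.
rewrite properE subsetT /=; apply/subsetPn; exists a; rewrite ?inE //.
by rewrite prec_irr.
Qed.

Definition pos_fun a := Ordinal (rank_in_lt a).

Lemma pos_fun_lt a b : (pos_fun a < pos_fun b) = (a -< b).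
Proof.
have H u v : u -< v -> pos_fun u < pos_fun v.
  move=> uv; apply: proper_card; apply/properP; split.
    by apply/subsetP => e; rewrite !inE => /prec_trans; apply.
  by exists u; rewrite !inE ?prec_irr.
apply/idP/idP; last exact: H.
case: (eqVneq a b) => [->|nab]; first by rewrite ltnn.
by case/orP: (prec_total nab) => // /H /ltnW; rewrite leqNgt => /negbTE ->.
Qed.

Lemma pos_fun_inj : injective pos_fun.
Proof.
move=> a b E; apply: contraTeq isT => nab; case/orP: (prec_total nab).
  by rewrite -pos_fun_lt E ltnn.
by rewrite -pos_fun_lt E ltnn.
Qed.

Definition pos := perm pos_fun_inj.
Definition omega : 'S_n := (pos^-1)%g.

Lemma pos_lt a b : (pos a < pos b) = (a -< b).
Proof. by rewrite !permE pos_fun_lt. Qed.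

Lemma omegaK : cancel omega pos. Proof. exact: permKV. Qed.
Lemma posK : cancel pos omega. Proof. exact: permK. Qed.

Lemma omega_lt p q : (p < q) = (omega p -< omega q).
Proof. by rewrite -pos_lt !omegaK. Qed.

Lemma pos_contig c a b e : c \in C0 -> same c a e ->
  pos a <= pos b -> pos b <= pos e -> same c a b.
Proof.
move=> cC0 ae; rewrite leq_eqVlt => /predU1P [/val_inj/perm_inj <-|].
  by rewrite same_refl.
rewrite pos_lt => ab; rewrite leq_eqVlt => /predU1P [/val_inj/perm_inj -> //|].
by rewrite pos_lt; apply: prec_contig ab.
Qed.

(** If [c] separates the letters at [p] and [q], the first [q] letters form a union of blocks of [c]
    by contiguity, so [d] divides [q]. *)
Lemma run_same c p q : p.+1 = q :> nat -> ~~ (d %| q) -> c \in C -> c != None ->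
  same c (omega p) (omega q).
Proof.
move=> pq dq cC0 cN; have {}cC0 : c \in C0 by rewrite setU1r.
apply: contraNT dq => ns.
rewrite (_ : nat_of_ord q = #|[set a | pos a < q]|).
  apply: (dvd_closed cN) => a b; rewrite !inE => aq ab.
  rewrite ltnNge; apply: contra ns => qb.
  have pb : p <= pos b by apply: leq_trans qb; rewrite -pq.
  have ap : pos a <= p by rewrite -ltnS pq.
  have a1 : same c a (omega p) by apply: pos_contig ab _ _; rewrite ?omegaK.
  have a2 : same c a (omega q) by apply: pos_contig ab _ _; rewrite ?omegaK // ltnW.
  by rewrite -(same_eql _ a1).
rewrite -(card_imset _ (@perm_inj _ pos)).
rewrite (_ : _ @: _ = [set r : 'I_n | r < q]); last first.
  apply/setP => r; rewrite inE; apply/imsetP/idP => [[a]|rq].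
    by rewrite inE => aq ->.
  by exists (omega r); rewrite ?inE omegaK.
rewrite -sum1_card; rewrite (eq_bigl (fun r : 'I_n => r < q)); last by move=> r; rewrite inE.
by rewrite (big_ord_narrow (ltnW (ltn_ord q))) sum1_card card_ord.
Qed.

Definition ascents : {set 'I_k} := [set i : 'I_k |
  [exists p : 'I_n, exists q : 'I_n, [&& p.+1 == d * i, q == d * i :> nat & omega p < omega q]]].

Lemma ascentsP i p q : p.+1 = d * i -> q = d * i :> nat ->
  (i \in ascents) = (omega p < omega q).
Proof.
move=> pE qE; rewrite inE; apply/existsP/idP => [[p' /existsP [q' /and3P [/eqP E1 /eqP E2]]]|lt].
  have -> : p' = p by apply/val_inj/succn_inj; rewrite /= E1 pE.
  by have -> : q' = q by apply/val_inj; rewrite /= E2 qE.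
by exists p; apply/existsP; exists q; rewrite pE qE !eqxx.
Qed.

Lemma nonzero_ascents : nonzero ascents.
Proof.
move=> i; rewrite inE => /existsP [p /existsP [q /and3P [/eqP E _ _]]].
by rewrite lt0n; apply: contra_eqN E => /eqP ->; rewrite muln0.
Qed.

Lemma gamma_inj : injective (fun p : 'I_n => omega (switch d ascents p)).
Proof.
by apply: inj_comp; [exact: perm_inj | exact: can_inj (switchK nonzero_ascents)].
Qed.

Definition gamma := perm gamma_inj.

Lemma gammaE p : gamma p = omega (switch d ascents p).
Proof. by rewrite permE. Qed.

Lemma pos_last (o : 'I_n) : o.+1 = n -> pos o = o.
Proof.
move=> oE; apply: val_inj; rewrite permE /= /rank_in.
have omax a : a <= o by rewrite -ltnS oE.
rewrite (_ : [set b | _] = [set~ o]); last first.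
  apply/setP => a; rewrite !inE; apply/idP/idP => [|na].
    by apply: contraTneq => ->; rewrite prec_irr.
  case/orP: (prec_total na) => // /precP [c [_ lt _]].
  by have := leq_trans lt (omax _); rewrite ltnNge le_bm.
by rewrite cardsC1 card_ord; apply: succn_inj; rewrite oE prednK.
Qed.

Lemma po_gamma a : po gamma ascents a = pos a.
Proof.
apply: (@perm_inj _ omega); rewrite posK /po -gammaE permKV //.
Qed.

Lemma run_lt p q : p.+1 = q :> nat -> ~~ (d %| q) -> omega p < omega q.
Proof.
move=> pq dq; have : p < q by rewrite -pq.
rewrite omega_lt => /precP [c [cC0 lt _]].
case: (eqVneq c None) => [cE|cN]; first by rewrite cE !bm_None in lt.
have cC' : c \in C by move: cC0; rewrite in_setU1 (negbTE cN).
have := run_same pq dq cC' cN; rewrite -bm_eq => /eqP E.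
by rewrite E ltnn in lt.
Qed.

(** At a multiple of [d], ascents are switched and descents are left alone. Inside a run the sorted
    word increases; a switch at its start brings in a smaller letter and one at its end a larger
    letter, so the increase persists. *)
Lemma gamma_descent p q : p.+1 = q :> nat -> (gamma q < gamma p) = (d %| q).
Proof.
move=> pq; rewrite !gammaE; case: (boolP (d %| q)) => dq.
  have qk : q %/ d < k by rewrite ltn_divLR ?d_gt0 // divnK.
  have qE : q = d * Ordinal qk :> nat by rewrite /= mulnC divnK.
  have pE : p.+1 = d * Ordinal qk by rewrite pq.
  have [-> ->] := switch_at ascents pE qE.
  rewrite (ascentsP pE qE); case: ifP => // /negbT; rewrite -leqNgt leq_eqVlt.
  case/predU1P => [/val_inj/perm_inj E|->] //.
  by move: pq; rewrite E => /eqP; rewrite eqn_leq ltnn.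
apply/negbTE; rewrite -leqNgt ltnW //.
have lep : omega (switch d ascents p) <= omega p.
  case: (switch_cases ascents p) => [[j [jW E _]]|[j [jW E E']]|[-> _ //]].
    by rewrite -pq E dvdn_mulr in dq.
  apply: ltnW; rewrite -(ascentsP (i := j)) // E' E prednK //.
  by rewrite muln_gt0 d_gt0 nonzero_ascents.
have leq : omega q <= omega (switch d ascents q).
  case: (switch_cases ascents q) => [[j [jW E E']]|[j [jW E _]]|[-> _ //]].
    by apply: ltnW; rewrite -(ascentsP (i := j)).
  by rewrite E dvdn_mulr in dq.
exact: leq_ltn_trans lep (leq_trans (run_lt pq dq) leq).
Qed.

Lemma gamma_A : gamma \in A_set n d.
Proof.
rewrite inE; apply/andP; split.
  apply/forallP => o; apply/implyP => /eqP oE; rewrite gammaE.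
  have -> : switch d ascents o = o.
    case: (switch_cases ascents o) => [[j [_ E _]]|[j [_ E _]]|[-> //]].
      by have := cut_lt_n j; rewrite -E oE ltnn.
    by exfalso; apply: (@dvd_adj o); rewrite ?oE // E dvdn_mulr.
  by rewrite -{2}(posK o) pos_last.
apply/eqP/setP => q; rewrite !inE; apply/existsP/andP => [[p /andP [/eqP pq]]|[q0 dq]].
  by rewrite (gamma_descent pq) => ->; rewrite -pq.
have pn : q.-1 < n := leq_ltn_trans (leq_pred _) (ltn_ord q).
have pq : (Ordinal pn).+1 = q by rewrite /= prednK.
by exists (Ordinal pn); rewrite pq eqxx (gamma_descent pq).
Qed.

Lemma gamma_SW c : c \in C -> c != None ->
  exists2 I, SW gamma c I (ascents :&: I) & nonzero I.
Proof.
move=> cC1 cN; have cC0 : c \in C0 by rewrite setU1r.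
(* The cuts of [c] are where it separates neighbours of the sorted word; its blocks being
   contiguous, these places determine [c]. *)
pose I := [set i : 'I_k | [exists p : 'I_n, exists q : 'I_n,
  [&& p.+1 == d * i, q == d * i :> nat & ~~ same c (omega p) (omega q)]]].
have I0 : nonzero I.
  move=> i; rewrite inE => /existsP [p /existsP [q /and3P [/eqP E _ _]]].
  by rewrite lt0n; apply: contra_eqN E => /eqP ->; rewrite muln0.
have W0 := nonzero_ascents.
exists I => //; split=> //; first exact: subsetIr.
have E a i : i \in I -> (d * i <= po gamma (ascents :&: I) a) = (d * i <= pos a).
  move=> iI; rewrite -po_gamma /po !cut_switch //; first by rewrite inE iI andbT.
  exact: nonzeroS (subsetIl _ _) W0.
have segE a b : seg I (po gamma (ascents :&: I) a) (po gamma (ascents :&: I) b) =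
    seg I (pos a) (pos b).
  by apply: eq_forallb => i; case: (boolP (i \in I)) => //= iI; rewrite !E.
suff H a b : pos a <= pos b -> same c a b = seg I (pos a) (pos b).
  move=> a b; rewrite segE; case/orP: (leq_total (pos a) (pos b)) => le.
    exact: H.
  rewrite same_sym H //; have [r1 r2] := seg_equiv I (pos b) (pos a) (pos b).
  apply/idP/idP => [/r2 <- //|ab].
  by have [r3 <-] := seg_equiv I (pos a) (pos b) (pos a).
move=> le; apply/idP/forall_inP => [ab i|H].
  rewrite inE => /existsP [p /existsP [q /and3P [/eqP pE /eqP qE npq]]].
  apply: contraNT npq; case: (leqP (d * i) (pos a)) => [/leq_trans -> //|lta].
  case: (leqP (d * i) (pos b)) => // leb _.
  have ap : pos a <= p by rewrite -ltnS pE.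
  have qb : q <= pos b by rewrite qE.
  have pq : p <= q by rewrite qE -pE.
  have a1 : same c a (omega p).
    by apply: (pos_contig cC0 ab); rewrite omegaK // (leq_trans pq).
  have a2 : same c a (omega q).
    by apply: (pos_contig cC0 ab); rewrite omegaK // (leq_trans ap).
  by rewrite -(same_eql _ a1).
suff step m : pos a <= m -> forall q, q = m :> nat -> q <= pos b -> same c a (omega q).
  by rewrite -[b]posK; apply: (step (pos b)).
elim: m => [|m IHm] am q qm qb.
  have -> : q = pos a by apply/val_inj/anti_leq; rewrite /= qm am.
  by rewrite posK same_refl.
move: am; rewrite leq_eqVlt => /predU1P [Em|am].
  have -> : q = pos a by apply: val_inj; rewrite /= qm Em.
  by rewrite posK same_refl.
have pn : m < n by rewrite ltnW // -qm.
have pq : (Ordinal pn).+1 = q by rewrite qm.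
have pb : Ordinal pn <= pos b by rewrite (leq_trans _ qb) // -pq.
apply: same_trans (IHm am (Ordinal pn) erefl pb) _.
case: (boolP (d %| q)) => dq; last exact: run_same pq dq cC1 cN.
have qk : q %/ d < k by rewrite ltn_divLR ?d_gt0 // divnK.
have qE : q = d * Ordinal qk :> nat by rewrite /= mulnC divnK.
apply: contraT => ns; have iI : Ordinal qk \in I.
  rewrite inE; apply/existsP; exists (Ordinal pn); apply/existsP; exists q.
  by rewrite pq -qE !eqxx.
have := H _ iI; rewrite -qE qb => /eqP qa.
by move: am; rewrite ltnS => /(leq_trans _); move: qa; rewrite qm => qa /(_ _ qa); rewrite ltnn.
Qed.

Lemma gamma_Sigma : C \subset Sigma d gamma.
Proof.
apply/subsetP => c cC1; case: (eqVneq c None) => [->|cN]; first by rewrite inE.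
by have [I cI _] := gamma_SW cC1 cN; apply: SW_mem cI.
Qed.

(** * Minimality of the canonical word in rr-lex *)

Section First.
Variables (beta : 'S_n) (W : {set 'I_k}).
Hypotheses (betaA : beta \in A_set n d) (W0 : nonzero W).
Hypothesis contig : forall c a b e, c \in C -> c != None -> same c a e ->
  po beta W a <= po beta W b -> po beta W b <= po beta W e -> same c a b.
Notation pos' := (po beta W).

(* A letter [s] exceeded by [z] although [prec C] places it after [z] belongs to
   the block of a larger letter [m], and this block does not contain [z]. *)
Lemma inversion_block (s z : 'I_n) : s < z -> z -< s -> pos' s < pos' z ->
  exists c m, [/\ c \in C /\ c != None, same c s m, s -< m, z < m &
    forall m', same c s m' -> pos' m' < pos' z].
Proof.
move=> sz /precP [c [cC0 lt _]] ps; exists c, (bm c s).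
have zm : z < bm c s by apply: leq_ltn_trans lt; apply: le_bm.
have cN : c != None.
  apply: contraTneq zm => ->; rewrite bm_None -leqNgt; exact: ltnW.
have cC1 : c \in C by move: cC0; rewrite in_setU1 (negbTE cN).
have ns : ~~ same c s z by rewrite -bm_eq eq_sym neq_ltn lt.
split=> //; first exact: bm_same.
  by apply: prec_bm => //; rewrite neq_ltn (ltn_trans sz zm).
move=> m' sm'; rewrite ltnNge; apply: contra ns => zm'.
exact: (contig cC1 cN sm' (ltnW ps)).
Qed.

Lemma beta_descent p q : p.+1 = q :> nat -> (beta q < beta p) = (d %| q).
Proof.
move=> pq; move: betaA; rewrite inE => /andP [_ /eqP/setP /(_ q)].
rewrite !inE -[0 < q](_ : true = _) => [/= <-|]; last by rewrite -pq.
apply/idP/existsP => [lt|[p' /andP [/eqP E lt]]]; first by exists p; rewrite pq eqxx.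
by have -> : p = p' by apply/val_inj/succn_inj; rewrite /= E pq.
Qed.

Lemma A_last alpha (o : 'I_n) : alpha \in A_set n d -> o.+1 = n -> alpha o = o.
Proof.
by rewrite inE => /andP [/forallP /(_ o) /implyP H _] oE; apply/eqP/H/eqP.
Qed.

(* A position [p] starts a run of length [d], ends one, or does neither; only in
   the first two cases can a switch move the letter at [p]. *)
Section Difference.
Variable p : 'I_n.
Hypotheses (agree : forall q : 'I_n, p < q -> gamma q = beta q).
Hypothesis lt_p : gamma p < beta p.
Notation gi a := ((gamma^-1)%g a).
Notation bi a := ((beta^-1)%g a).

Let agree_inv a : p < gi a -> bi a = gi a.
Proof.
by move=> pa; apply: (@perm_inj _ beta); rewrite permKV -agree // permKV.
Qed.

Let agree_inv' a : p < bi a -> gi a = bi a.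
Proof.
by move=> pa; apply: (@perm_inj _ gamma); rewrite permKV agree // permKV.
Qed.

Let inv_lt r a : p < r -> (gi a < r) = (bi a < r).
Proof.
move=> pr; apply/idP/idP; apply: contraLR; rewrite -!leqNgt => ra.
  by rewrite agree_inv' // (leq_trans pr).
by rewrite agree_inv // (leq_trans pr).
Qed.

Let pos_ltE r a : ~~ (d %| r) -> (pos a < r) = (gi a < r).
Proof. by move=> dr; rewrite -po_gamma /po switch_lt //; apply: nonzero_ascents. Qed.

Let pos'_lt r a : ~~ (d %| r) -> (pos' a < r) = (bi a < r).
Proof. by move=> dr; rewrite /po switch_lt. Qed.

(** Both words have the same letters from [r] on, and no switch crosses [r]. The contradictions
    below come from a letter that lies before [r] after the switches in one word but not in the
    other. *)
Let pos_agree r a : ~~ (d %| r) -> p < r -> (pos a < r) = (pos' a < r).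
Proof. by move=> dr pr; rewrite pos_ltE // pos'_lt // inv_lt. Qed.

Let gi_gamma q : gi (gamma q) = q. Proof. by rewrite permK. Qed.
Let bi_beta q : bi (beta q) = q. Proof. by rewrite permK. Qed.

Let gi_neq a q : a != gamma q -> gi a != q :> nat.
Proof. by apply: contra => /eqP/val_inj <-; rewrite permKV. Qed.

Let bi_neq a q : a != beta q -> bi a != q :> nat.
Proof. by apply: contra => /eqP/val_inj <-; rewrite permKV. Qed.

Let p_lt_last : p.+1 < n.
Proof.
rewrite ltn_neqAle ltn_ord andbT; apply/eqP => E.
by move: lt_p; rewrite (A_last gamma_A E) (A_last betaA E) ltnn.
Qed.

Let ndvd_succ r : d %| r -> ~~ (d %| r.+1).
Proof. by move=> dr; apply/negP => /(dvd_adj dr). Qed.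

Let ndvd_pred r : 0 < r -> d %| r -> ~~ (d %| r.-1).
Proof. by move=> r0 dr; apply/negP => dr1; apply: (dvd_adj dr1); rewrite prednK. Qed.

Lemma no_difference_start : 0 < p -> d %| p -> False.
Proof.
move=> p0 dp; have qn : p.-1 < n := leq_ltn_trans (leq_pred _) (ltn_ord p).
pose q := Ordinal qn; have qp : q.+1 = p by rewrite /= prednK.
set s := gamma p.
have sg : s < gamma q by rewrite gamma_descent.
have sb : beta p < beta q by rewrite beta_descent.
have dp1 := ndvd_succ dp; have dq : ~~ (d %| q) := ndvd_pred p0 dp.
(* [z] must differ from [gamma q], so that it precedes [q] in the sorted word. If [beta p] is that
   letter, [beta q] is larger still and will do. *)
have [z [zg zs bz1 bz2]] : exists z : 'I_n, [/\ z != gamma q, s < z, bi z < p.+1 & q <= bi z].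
  case: (eqVneq (beta p) (gamma q)) => E.
    exists (beta q); rewrite -E neq_ltn sb orbT bi_beta leqnn.
    by rewrite (ltn_trans lt_p sb) -qp ltnS leqW.
  by exists (beta p); rewrite E bi_beta lt_p -qp leqnSn.
have pz1 : pos' z < p.+1 by rewrite pos'_lt.
have pz2 : q <= pos' z by rewrite leqNgt pos'_lt // -leqNgt.
have ps2 : q <= pos s by rewrite leqNgt pos_ltE // gi_gamma -leqNgt -qp leqnSn.
have pz : pos z < q.
  rewrite pos_ltE // ltn_neqAle gi_neq //.
  rewrite -ltnS qp ltn_neqAle.
  have -> : gi z != p :> nat by apply: gi_neq; rewrite neq_ltn zs orbT.
  by rewrite -ltnS inv_lt.
have zs' : z -< s by rewrite -pos_lt (leq_trans pz).
have ps' : pos' s < q.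
  rewrite pos'_lt // ltn_neqAle.
  have -> : bi s != q :> nat by apply: bi_neq; rewrite neq_ltn (ltn_trans lt_p sb).
  rewrite -ltnS qp ltn_neqAle /=.
  have -> : bi s != p :> nat by apply: bi_neq; rewrite neq_ltn lt_p.
  by rewrite -ltnS -(inv_lt _ (ltnSn p)) gi_gamma /= ltnSn.
have [c [m [[cC1 cN] sm lt_sm zm blk_z]]] := inversion_block zs zs' (leq_trans ps' pz2).
have pm : pos s < pos m by rewrite pos_lt.
have [le|gt] := leqP p.+1 (pos m).
  have : pos' m < p.+1 := ltn_trans (blk_z _ sm) pz1.
  by rewrite -pos_agree // ltnNge le.
have Em : pos m = p.
  apply/val_inj/anti_leq; rewrite -ltnS gt /= -qp.
  exact: leq_ltn_trans ps2 pm.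
(* Here [m] starts a run, so the next letter of the run is in the same block, and its position is
   already in the range where the words agree. *)
pose t := omega (Ordinal p_lt_last).
have st : same c s t.
  apply: same_trans sm _; rewrite -[m]posK Em.
  exact: run_same.
have : pos' t < p.+1 := ltn_trans (blk_z _ st) pz1.
by rewrite -pos_agree // omegaK /= ltnn.
Qed.

(** The block of [s] could stay within the agreement only if [m] were [gamma u]. But [gamma u] is
    smaller than [s], whereas [m] exceeds [z], hence [s]. *)
Lemma no_difference_end : d %| p.+1 -> False.
Proof.
move=> du; pose u := Ordinal p_lt_last; have pu : p.+1 = u by [].
set s := gamma p; set z := beta p.
have us : gamma u < s by rewrite gamma_descent.
have Eu : gamma u = beta u by apply: agree.
have du1 := ndvd_succ du; have dp : ~~ (d %| p) := ndvd_pred (r := p.+1) isT du.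
have pu1 : p < u.+1 by rewrite -pu ltnW.
have pz1 : pos' z < u.+1 by rewrite pos'_lt // bi_beta.
have pz2 : p <= pos' z by rewrite leqNgt pos'_lt // bi_beta -leqNgt.
have ps2 : p <= pos s by rewrite leqNgt pos_ltE // gi_gamma -leqNgt.
have pz : pos z < p.
  rewrite pos_ltE // ltn_neqAle.
  have -> : gi z != p :> nat by apply: gi_neq; rewrite neq_ltn lt_p orbT.
  rewrite -ltnS pu ltn_neqAle /=.
  have -> : gi z != u :> nat by apply: gi_neq; rewrite neq_ltn (ltn_trans us lt_p) orbT.
  by rewrite -ltnS inv_lt // bi_beta.
have zs' : z -< s by rewrite -pos_lt (leq_trans pz).
have ps' : pos' s < p.
  rewrite pos'_lt // ltn_neqAle.
  have -> : bi s != p :> nat by apply: bi_neq; rewrite neq_ltn lt_p.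
  rewrite -ltnS pu ltn_neqAle /=.
  have -> : bi s != u :> nat by apply: bi_neq; rewrite -Eu neq_ltn us orbT.
  by rewrite -ltnS -(inv_lt _ pu1) gi_gamma /= pu1.
have [c [m [[cC1 cN] sm lt_sm zm blk_z]]] := inversion_block lt_p zs' (leq_trans ps' pz2).
have pm : pos s < pos m by rewrite pos_lt.
have [le|gt] := leqP u.+1 (pos m).
  have : pos' m < u.+1 := ltn_trans (blk_z _ sm) pz1.
  by rewrite -pos_agree // ltnNge le.
have gm1 : gi m < u.+1 by rewrite -pos_ltE.
have gm2 : p <= gi m.
  by rewrite leqNgt -pos_ltE // -leqNgt (leq_trans ps2) // ltnW.
have gm3 : gi m != p :> nat.
  by apply: gi_neq; rewrite neq_ltn (ltn_trans lt_p zm) orbT.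
have Em : gi m = u.
  apply/val_inj/anti_leq; rewrite -ltnS gm1 /=.
  by rewrite ltn_neqAle eq_sym gm3.
have mE : m = gamma u by rewrite -Em permKV.
have := ltn_trans (ltn_trans us lt_p) zm.
by rewrite mE ltnn.
Qed.

Lemma no_difference_middle : (p = 0 :> nat) \/ ~~ (d %| p) -> ~~ (d %| p.+1) -> False.
Proof.
move=> p0 dp1; set s := gamma p; set z := beta p.
have swp V : nonzero V -> switch d V p = p.
  move=> V0; case: (switch_cases V p) => [[j [jW E _]]|[j [jW E _]]|[] //].
    by rewrite E dvdn_mulr in dp1.
  case: p0 => [E0|]; last by rewrite E dvdn_mulr.
  by move: (V0 _ jW); rewrite -(ltn_pmul2l d_gt0) muln0 -E E0.
have ps : pos s = p by rewrite -po_gamma /po gi_gamma swp //; apply: nonzero_ascents.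
have pz : pos' z = p by rewrite /po bi_beta swp.
have pz' : pos z < p.
  rewrite ltn_neqAle -ltnS pos_agree // pz ltnSn andbT -ps val_eqE.
  by rewrite (inj_eq perm_inj) neq_ltn lt_p orbT.
have ps' : pos' s < pos' z.
  rewrite pz ltn_neqAle -ltnS -pos_agree // ps ltnSn andbT -pz val_eqE.
  by rewrite (inj_eq (po_inj W0)) neq_ltn lt_p.
have zs' : z -< s by rewrite -pos_lt ps.
have [c [m [_ sm lt_sm _ blk_z]]] := inversion_block lt_p zs' ps'.
have : pos' m < p.+1 by apply: ltn_trans (blk_z _ sm) _; rewrite pz.
by rewrite -pos_agree // ltnNge -ps pos_lt lt_sm.
Qed.

End Difference.

Lemma gamma_first : beta = gamma \/
  exists p, (forall q : 'I_n, p < q -> gamma q = beta q) /\ beta p < gamma p.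
Proof.
case: (boolP [exists p, gamma p != beta p]) => [/existsP [p0 np0]|]; last first.
  rewrite negb_exists => /forallP H; left; apply/permP => p.
  by have := H p; rewrite negbK => /eqP.
case: (@arg_maxnP _ p0 (fun p => gamma p != beta p) (fun p => p : nat) np0) => p np pmax.
have agree q : p < q -> gamma q = beta q.
  by move=> pq; apply/eqP; apply: contraTT pq => /pmax; rewrite -leqNgt.
right; exists p; split=> //; move: np; rewrite -val_eqE neq_ltn => /orP [lt|//].
exfalso; case: (boolP (d %| p.+1)) => dp1; first exact: no_difference_end agree lt dp1.
case: (posnP p) => [p00|p_gt0].
  by apply: (no_difference_middle agree lt) => //; left.
case: (boolP (d %| p)) => dp; first exact: no_difference_start agree lt p_gt0 dp.
by apply: (no_difference_middle agree lt) => //; right.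
Qed.

End First.
End Word.
End CanonicalWords.

(** * The boundary condition *)

Section Ears.
Implicit Types (c x y z : Q) (a b e p q : 'I_n) (i j : 'I_k) (I J V W : {set 'I_k}).
Implicit Types (alpha beta : 'S_n).

Lemma SW_seg alpha c J V W : nonzero W -> SW alpha c J V ->
  {in J, V =i W} ->
  forall a b, same c a b = seg J (po alpha W a) (po alpha W b).
Proof.
move=> W0 [J0 VJ _ cE] VW a b; rewrite cE; apply: eq_forallb => j.
case: (boolP (j \in J)) => //= jJ; have V0 := nonzeroS VJ J0.
by rewrite /po !cut_switch // VW.
Qed.

(** The finest member other than the bottom carries all the cuts and switches; those of the coarser
    members are restrictions of its own. *)
Lemma Sigma_chain alpha (C : {set Q}) : @chain _ Q^d C -> C \subset Sigma d alpha ->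
  exists I W : {set 'I_k}, [/\ W \subset I, nonzero I,
    forall c, c \in C -> c != None ->
      exists2 J : {set 'I_k}, J \subset I & SW alpha c J (W :&: J)
  & forall i, i \in I -> exists c (J : {set 'I_k}), [/\ c \in C, SW alpha c J (W :&: J) & i \in J]].
Proof.
move=> cC CS; case: (boolP [exists c in C, c != None]) => [/exists_inP [c0 c0C c0N]|].
  have P0 : (c0 \in C) && (c0 != None) by rewrite c0C.
  case: (@arg_maxnP _ c0 (fun c => (c \in C) && (c != None)) (fun c => rk c) P0).
  move=> c /andP [cC1 cN] cmax.
  have [I [W cI]] := Sigma_SW (subsetP CS _ cC1) cN.
  have [I0 WI _ _] := cI; exists I, W; split=> // [x xC xN|i iI]; last first.
    by exists c, I; split=> //; rewrite (setIidPl WI).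
  have le : (c <= x)%O.
    have /orP [//|] := chainP _ cC _ _ xC cC1.
    rewrite le_eqVlt => /predU1P [->//|lt].
    have : rk x <= rk c by apply: cmax; rewrite xC.
    by rewrite leqNgt rk_ltQ.
  have [J [V xJ]] := Sigma_SW (subsetP CS _ xC) xN.
  exists J; first exact: SW_sub cI xJ le.
  by rewrite -(SW_switch cI xJ le).
rewrite negb_exists_in => /forall_inP H.
exists set0, set0; split=> [|i|c cC1 cN|i]; rewrite ?sub0set ?inE //.
by have := H _ cC1; rewrite cN.
Qed.

Lemma seg_contig J p q (r : 'I_n) : p <= q -> q <= r -> seg J p r -> seg J p q.
Proof.
move=> pq qr /forall_inP H; apply/forall_inP => j /H.
case: (leqP (d * j) p) => [le _|_]; first by rewrite (leq_trans le pq).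
case: (leqP (d * j) r) => // rj _.
by rewrite leqNgt (leq_ltn_trans qr rj).
Qed.

Lemma seg_step J i p q : p.+1 = q :> nat -> q = d * i :> nat -> seg J p q = (i \notin J).
Proof.
move=> pq qE; apply/forall_inP/idP => [H|nJ j jJ].
  by apply/negP => /H; rewrite -qE leqnn -pq ltnn.
case: (leqP (d * j) p) => [le|lt]; first by rewrite -pq (leq_trans le).
have nij : (d * j == q) = false.
  by apply/negbTE; apply: contra nJ => /eqP; rewrite qE => /cut_inj <-.
by rewrite leq_eqVlt nij -pq ltnS leqNgt lt.
Qed.

Lemma gamma_le (C : {set Q}) (cC : @chain _ Q^d C) beta :
  beta \in A_set n d -> C \subset Sigma d beta -> rr_lex (gamma cC) beta.
Proof.
move=> bA CS; have [I [W [WI I0 cSW _]]] := Sigma_chain cC CS.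
have W0 := nonzeroS WI I0.
have [|c a b e cC1 cN|->|[p [agree lt]]] := @gamma_first C cC beta W bA.
- exact: W0.
- have [J JI cJ] := cSW c cC1 cN.
  have VW : {in J, W :&: J =i W} by move=> j jJ; rewrite inE jJ andbT.
  rewrite !(SW_seg W0 cJ VW) => ae ab be; exact: seg_contig ae.
- exact: rr_lex_refl.
exact: rr_lexP agree lt.
Qed.

Lemma card_ord_lt (r : nat) : r <= n -> #|[set p : 'I_n | p < r]| = r.
Proof.
move=> rn; rewrite -sum1_card (eq_bigl (fun p : 'I_n => p < r)).
  by rewrite (big_ord_narrow rn) sum1_card card_ord.
by move=> p; rewrite inE.
Qed.

Lemma pos_unique (C : {set Q}) (cC : @chain _ Q^d C) (f : 'I_n -> 'I_n) :
  injective f -> (forall a b, prec C a b -> f a < f b) -> forall a, pos cC a = f a.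
Proof.
move=> f_inj f_mono a; have [g fK gK] := injF_bij f_inj.
apply: val_inj; rewrite permE /= /rank_in -[RHS](card_ord_lt (ltnW (ltn_ord _))).
rewrite -(card_imset _ f_inj); congr #|pred_of_set _|; apply/setP => p.
rewrite inE; apply/imsetP/idP => [[b]|lt]; first by rewrite inE => /f_mono ? ->.
exists (g p); rewrite ?gK // inE.
have na : g p != a by apply: contraTneq lt => <-; rewrite gK ltnn.
case/orP: (prec_total C na) => // /f_mono.
by rewrite gK => /ltnW; rewrite leqNgt lt.
Qed.

Lemma gamma_switches (F : {set Q}) (cF : @chain _ Q^d F) alpha D W :
  gamma cF = alpha -> D \in F -> SW alpha D cuts W -> ascents cF = W.
Proof.
move=> E DF DW; have [_ _ DN _] := DW.
have [J] := gamma_SW cF DF DN; rewrite E => DJ _.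
have [EJ ->] := SW_unique DW DJ; rewrite -EJ; apply/esym/setIidPl.
exact/sub_cuts/nonzero_ascents.
Qed.

Section Boundary.
Variables (alpha : 'S_n) (C : {set Q}).
Hypotheses (cC : @chain _ Q^d C) (alphaA : alpha \in A_set n d).
Hypotheses (CS : C \subset Sigma d alpha) (not_first : gamma cC != alpha).

Lemma alpha_descent p q : p.+1 = q :> nat -> (alpha q < alpha p) = (d %| q).
Proof. exact: beta_descent. Qed.

Variables I W : {set 'I_k}.
Hypotheses (WI : W \subset I) (I0 : nonzero I).
Hypothesis cSW : forall c, c \in C -> c != None ->
      exists2 J : {set 'I_k}, J \subset I & SW alpha c J (W :&: J).
Hypothesis cI : forall i, i \in I ->
  exists c (J : {set 'I_k}), [/\ c \in C, SW alpha c J (W :&: J) & i \in J].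

(** At the cuts left free by [C], a switch turns the descent of [alpha] into an ascent, as required
    of letters which the bottom alone has to sort. *)
Let W1 := W :|: (cuts :\: I).

Let W10 : nonzero W1.
Proof.
by move=> i; rewrite !inE => /orP [/(subsetP WI)/I0|/andP []].
Qed.

Let W1J J : J \subset I -> W1 :&: J = W :&: J.
Proof.
move=> JI; apply/setP => j; rewrite !inE; case: (boolP (j \in J)) => jJ; rewrite ?andbF //.
by rewrite (subsetP JI _ jJ) /= orbF.
Qed.

Let f := po alpha W1.
Let g := letter alpha W1.

Let fK : cancel f g. Proof. exact: poK. Qed.
Let gK : cancel g f. Proof. exact: letterK. Qed.

Let W1_ascent i p q : p.+1 = d * i -> q = d * i :> nat -> (i \in W1) = (g p < g q).
Proof.
move=> pE qE; have pq : p.+1 = q :> nat by rewrite pE.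
have lt : alpha q < alpha p by rewrite alpha_descent // qE dvdn_mulr.
rewrite /g /letter; have [-> ->] := switch_at W1 pE qE.
by case: ifP => _; rewrite // ltnNge ltnW.
Qed.

(** If every adjacent pair were in order, [g] would be the sorted word of [C]. As [alpha] descends
    at all cuts, the ascents of [g] at the cuts are exactly [W1], and switching them back would give
    [gamma cC = alpha]. *)
Let inversion : exists p q, p.+1 = q :> nat /\ prec C (g q) (g p).
Proof.
case: (boolP [exists p : 'I_n, exists q : 'I_n, (p.+1 == q) && prec C (g q) (g p)]).
  by case/existsP => p /existsP [q /andP [/eqP pq lt]]; exists p, q.
rewrite negb_exists => /forallP no; case/eqP: not_first.
have adj p q : p.+1 = q :> nat -> prec C (g p) (g q).
  move=> pq; have := no p; rewrite negb_exists => /forallP/(_ q).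
  rewrite pq eqxx /= => nlt.
  have npq : g p != g q by rewrite (inj_eq (can_inj gK)) -val_eqE /= neq_ltn -pq ltnSn.
  by case/orP: (prec_total C npq) => //; rewrite (negbTE nlt).
have mono m : forall p q : 'I_n, q = p + m.+1 :> nat -> prec C (g p) (g q).
  elim: m => [|m IHm] p q E; first by apply: adj; rewrite E addn1.
  have rn : p + m.+1 < n by apply: ltn_trans (ltn_ord q); rewrite E ltn_add2l.
  apply: (prec_trans cC) (IHm p (Ordinal rn) erefl) _.
  by apply: adj; rewrite /= E !addnS.
have g_mono p q : p < q -> prec C (g p) (g q).
  by move=> pq; apply: (mono (q - p.+1)); rewrite addnS -addSn subnKC.
have f_mono a b : prec C a b -> f a < f b.
  move=> ab; rewrite ltnNge leq_eqVlt; apply/negP => /predU1P [/val_inj/(can_inj fK) E|].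
    by rewrite E prec_irr in ab.
  by move/g_mono; rewrite !fK (prec_asym cC ab).
have posE := pos_unique cC (can_inj fK) f_mono.
have omE p : omega cC p = g p.
  by apply: (@perm_inj _ (pos cC)); rewrite omegaK posE gK.
have ascE : ascents cC = W1.
  apply/setP => i; case: (posnP i) => [i0|i_gt0].
    transitivity false; last apply/esym.
      by apply/negP => /nonzero_ascents; rewrite i0.
    by apply/negP => /W10; rewrite i0.
  have qn := cut_lt_n i.
  have q0 : 0 < d * i by rewrite muln_gt0 d_gt0.
  have pn : (d * i).-1 < n := leq_ltn_trans (leq_pred _) qn.
  have pE : (Ordinal pn).+1 = d * i by rewrite /= prednK.
  have qE : Ordinal qn = d * i :> nat by [].
  by rewrite (ascentsP cC pE qE) (W1_ascent pE qE) !omE.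
by apply/permP => p; rewrite gammaE ascE omE /g /letter switchK.
Qed.

Let same_f c a b : c \in C -> c != None ->
  exists J : {set 'I_k}, [/\ J \subset I, SW alpha c J (W1 :&: J) & same c a b = seg J (f a) (f b)].
Proof.
move=> cC1 cN; have [J JI cJ] := cSW cC1 cN; exists J; rewrite W1J //; split=> //.
by apply: (SW_seg W10 cJ) => j jJ; rewrite -W1J // inE jJ andbT.
Qed.

Let full : exists D : Q, [/\ SW alpha D cuts W1, D \in Sigma d alpha &
  forall c, c \in C -> c != None -> (D <= c)%O].
Proof.
have [D DW DS] := SW_ex alpha nonzero_cuts (sub_cuts W10).
exists D; split=> // c cC1 cN; have [J [JI cJ _]] := same_f (Ordinal n_gt0) (Ordinal n_gt0) cC1 cN.
by apply: (SW_le DW cJ) => //; apply/sub_cuts/(nonzeroS JI).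
Qed.

Let pos_f (F : {set Q}) D (cF : @chain _ Q^d F) : gamma cF = alpha ->
  SW alpha D cuts W1 -> D \in F -> pos cF =1 f.
Proof.
move=> E DW DF a; have ascE := gamma_switches E DF DW.
by rewrite -po_gamma ascE E.
Qed.

(** The member [D], cut everywhere with switches [W1], fixes the switches of every [F] that contains
    it and has [gamma cF = alpha]; such an [F] satisfies [prec F a b]. So it suffices to extend [C]
    in a way that keeps [b] before [a]. *)
Lemma boundary_extension : exists F : {set Q},
  [/\ @max_chain _ Q^d (Sigma d alpha) F, C \subset F &
      forall cF : @chain _ Q^d F, gamma cF != alpha].
Proof.
have [p [q [pq lt_ba]]] := inversion; set a := g p in lt_ba; set b := g q in lt_ba.
have [D [DW DS Dle]] := full; have [_ _ DN _] := DW.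
have fab : f a < f b by rewrite !gK -pq.
have CDS : D |: C \subset Sigma d alpha by rewrite subUset sub1set DS.
have cCD : @chain _ Q^d (D |: C).
  apply: chainU1 => // c cC1; apply/orP; case: (eqVneq c None) => [->|cN].
    by left; rewrite leEdual; case: (D).
  by right; apply: Dle.
have extend (X : {set Q}) : @chain _ Q^d X -> X \subset Sigma d alpha ->
    D |: C \subset X ->
    (forall F : {set Q}, X \subset F -> @chain _ Q^d F -> prec F a b ->
       (forall c, c \in F -> c != None -> ~~ (d %| q) -> same c a b) ->
       F \subset Sigma d alpha -> False) ->
    exists F : {set Q}, [/\ @max_chain _ Q^d (Sigma d alpha) F, C \subset F &
      forall cF : @chain _ Q^d F, gamma cF != alpha].
  move=> cX XS CX H; have [F mF XF] := chain_extend cX XS.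
  have [_ FS _] := max_chainP _ _ mF; exists F; split=> // [|cF].
    exact: subset_trans (subset_trans (subsetUr _ _) CX) XF.
  apply/eqP => E; have DF : D \in F.
    by apply: (subsetP XF); apply: (subsetP CX); rewrite setU11.
  have posE := pos_f E DW DF.
  have omE r : omega cF r = g r.
    by apply: (@perm_inj _ (pos cF)); rewrite omegaK posE gK.
  apply: (H F XF cF) => // [|c cF' cN dq].
    by rewrite -(pos_lt cF) !posE.
  by rewrite /a /b -!omE; apply: run_same.
have /precP [c [cC0 lt_c above]] := lt_ba.
have nc : ~~ same c a b by rewrite -bm_eq neq_ltn lt_c orbT.
(* Inside a run only the bottom can separate [a] and [b], in [F] and hence in [C], and it compares
   the letters themselves. *)
case: (boolP (d %| q)) => dq; last first.
  apply: (extend (D |: C)) => // F CF cF /precP [h [hF lt_h _]] same_F _.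
  have hN : h = None.
    apply/eqP; apply: contraTT lt_h => hN; rewrite -leqNgt.
    have hF' : h \in F by move: hF; rewrite in_setU1 (negbTE hN).
    by have := same_F h hF' hN dq; rewrite -bm_eq => /eqP ->.
  have cN : c = None.
    apply/eqP; apply: contraNT nc => cN.
    have cC1 : c \in C by move: cC0; rewrite in_setU1 (negbTE cN).
    by apply: same_F => //; apply: (subsetP CF); rewrite setU1r.
  move: lt_c lt_h; rewrite cN hN !bm_None => /ltnW.
  by rewrite leqNgt => /negbTE ->.
have qk : q %/ d < k by rewrite ltn_divLR ?d_gt0 // divnK.
pose i : 'I_k := Ordinal qk; have qE : q = d * i :> nat by rewrite /= mulnC divnK.
have i0 : 0 < i.
  rewrite lt0n; apply/eqP => E.
  by move: qE; rewrite E muln0 -pq.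
have same_ab c' : c' \in C -> c' != None ->
    exists J : {set 'I_k}, [/\ J \subset I, SW alpha c' J (W1 :&: J) & same c' a b = (i \notin J)].
  move=> c'C c'N; have [J [JI cJ sE]] := same_f a b c'C c'N.
  by exists J; split=> //; rewrite sE !gK (seg_step _ pq qE).
(* If only the bottom separates them, no member of [C] uses the cut [i]. Then [i] belongs to [W1]
   and [a] is the smaller letter. *)
case: (eqVneq c None) => [cE|cN].
  exfalso; move: lt_c above; rewrite cE !bm_None => ltba above.
  have iI : i \notin I.
    apply/negP => /cI [c' [J [c'C c'J iJ]]]; have [_ _ c'N _] := c'J.
    have [J' [J'I c'J' sE]] := same_ab c' c'C c'N.
    have [EJ _] := SW_unique c'J c'J'.
    have : same c' a b.
      rewrite same_sym; apply: above; first by rewrite setU1r.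
      by rewrite lt_neqAle eq_sym c'N; case: (c').
    by rewrite sE -EJ iJ.
  have iW : i \in W1 by rewrite !inE iI i0 orbT.
  have pE : p.+1 = d * i by rewrite -qE.
  by move: iW; rewrite (W1_ascent pE qE) ltnNge ltnW.
have cC1 : c \in C by move: cC0; rewrite in_setU1 (negbTE cN).
have [J [JI cJ sE]] := same_ab c cC1 cN; rewrite sE negbK in nc.
have [J0 _ _ _] := cJ.
(* [h] is [c] with the cut [i] undone. It covers [c] and keeps [a] and [b] together, so in any chain
   through both [c] remains the coarsest member separating them, and [b] still precedes [a]. *)
have [h hJ hS] := SW_ex alpha (nonzeroS (subsetDl J [set i]) J0) (subsetIr W1 (J :\ i)).
have [_ _ hN _] := hJ.
have ch : (c < h)%O.
  by apply: (SW_lt cJ hJ (properD1 nc)); apply/setP => j; rewrite !inE; case: (j \in J); rewrite ?andbF ?andbT.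
have same_h : same h a b.
  have W1J' : {in J :\ i, W1 :&: (J :\ i) =i W1}.
    by move=> j jJ; rewrite inE jJ andbT.
  have -> : same h a b = seg (J :\ i) (f a) (f b) by apply: (SW_seg W10 hJ W1J').
  by rewrite !gK (seg_step _ pq qE) !inE eqxx.
have Dh : (D <= h)%O.
  apply: (SW_le DW hJ) => //; apply: subset_trans (subsetDl _ _) _.
  exact: sub_cuts.
have h_cmp c' : c' \in C -> c' != None -> (c' <= h)%O || (h <= c')%O.
  move=> c'C c'N; have /orP [cc'|c'c] := chainP _ cC _ _ c'C cC1; last first.
    by rewrite (le_trans (c'c : (c' <= c :> Q)%O) (ltW ch)).
  have {}cc' : (c <= c' :> Q)%O by [].
  move: cc'; rewrite le_eqVlt => /predU1P [<-|cc']; first by rewrite (ltW ch).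
  have [J' [J'I c'J' sE']] := same_ab c' c'C c'N.
  have iJ' : i \notin J'.
    rewrite -sE' same_sym; apply: above => //; by rewrite setU1r.
  have J'J := SW_sub cJ c'J' (ltW cc').
  apply/orP; right; apply: (SW_le hJ c'J').
    apply/subsetP => j jJ'; rewrite !inE (subsetP J'J _ jJ') andbT.
    by apply: contraNneq iJ' => <-.
  apply/setP => j; rewrite !inE; case: (boolP (j \in J')) => jJ'; rewrite ?andbF //.
  rewrite (subsetP J'J _ jJ') !andbT; case: eqVneq => [E|]; rewrite ?andbT //.
  by rewrite -E jJ' in iJ'.
apply: (extend (h |: (D |: C))).
- apply: chainU1 => // x /setU1P [->|xC].
    by apply/orP; left; apply: Dh.
  case: (eqVneq x None) => [->|xN].
    by apply/orP; left; rewrite leEdual; case: (h).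
  by have := h_cmp x xC xN.
- by rewrite subUset sub1set hS.
- exact: subsetUr.
move=> F XF cF /precP [y [yF lt_y above_y]] _ FS.
have hF : h \in None |: F by rewrite setU1r // (subsetP XF) // setU11.
have cF' : c \in None |: F by rewrite setU1r // (subsetP XF) // !inE cC1 !orbT.
have ny : ~~ same y a b by rewrite -bm_eq neq_ltn lt_y.
have yh : (y < h)%O.
  have [hy|/(chain_lt cF hF yF) yh] := boolP (h < y)%O.
    by move/dpart_leP: (ltW hy) ny => /(_ _ _ same_h) ->.
  rewrite lt_neqAle yh andbT; apply: contraNneq ny => ->; exact: same_h.
have cy : (c <= y)%O.
  apply: (chain_lt cF yF cF'); apply/negP => yc.
  by have := above_y c cF' yc; rewrite sE nc.
have rkc : rk c = (rk h).+1 by rewrite (rk_SW cJ) (rk_SW hJ) (cardsD1 i J) nc.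
move: cy; rewrite le_eqVlt => /predU1P [E|cy].
  by move: lt_y; rewrite -E ltnNge ltnW.
have := rk_ltQ cy; have := rk_ltQ yh; rewrite rkc ltnS => /leq_trans lt1 /lt1.
by rewrite ltnn.
Qed.
End Boundary.
End Ears.

(** * Descending chains *)

Section DescendingChains.
Implicit Types (c g h w x y : Q) (a b e m p q u v : 'I_n) (i j : 'I_k) (I J V W : {set 'I_k}).
Implicit Types (alpha beta : 'S_n).

Definition stepQ (C : {set Q}) g h :=
  [&& g \in C, h \in C, (h < g)%O & rk h == (rk g).+1].

Section Steps.
Variables (F C : {set Q}) (x : Q).
Hypotheses (cF : @chain _ Q^d F) (CF : C \subset F).
Hypotheses (xC : x \in C) (Cx : {in C, forall c, (c <= x)%O}).
Hypothesis full : forall w r, w \in C -> rk x <= r <= rk w ->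
  exists2 c, c \in C & rk c = r.

Lemma C_le g h : g \in C -> h \in C -> rk g <= rk h -> (h <= g)%O.
Proof.
move=> gC hC; have /orP [//|gh] := chainP _ cF _ _ (subsetP CF _ gC) (subsetP CF _ hC).
have {}gh : (g <= h :> Q)%O by [].
by move: gh; rewrite le_eqVlt => /predU1P [->//|/rk_ltQ]; rewrite ltnNge => /negbTE ->.
Qed.

Lemma step_new g h : stepQ C g h -> h != None ->
  exists m, [/\ bm g m != m, maxima h = m |: maxima g & g != None].
Proof.
case/and4P => gC hC hg /eqP rkh hN; have gN := lt_neq_None hg.
by have [m gm hE] := cover_new gN hN hg rkh; exists m.
Qed.

Lemma step_lam g h m : stepQ C g h -> h != None -> bm g m != m ->
  maxima h = m |: maxima g -> signed m (lam g h).
Proof.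
case/and4P => gC hC hg _ hN gm hE; apply: (cover_lam (lt_neq_None hg) hN hg gm hE).
Qed.

(** The half left behind keeps the maximum of the divided block, which is larger than [m]; so the
    half of [m] is listed first, and [m] is its last letter. *)
Lemma step_prec g h m e : stepQ C g h -> h != None -> bm g m != m ->
  maxima h = m |: maxima g -> same g m e ->
  if same h m e then (e == m) || prec F e m else prec F m e.
Proof.
case/and4P => gC hC hg /eqP rkh hN gm hE gme.
have hF : h \in (None : Q) |: F by rewrite setU1r // (subsetP CF).
have gF : g \in (None : Q) |: F by rewrite setU1r // (subsetP CF).
have hm := cover_bm hE; case: ifP => [hme|/negbT nhme].
  case: (eqVneq e m) => //= nem.
  have E : bm h e = m by rewrite -[RHS]hm; apply/eqP; rewrite bm_eq same_sym.
  by rewrite -[m]E; apply: prec_bm => //; rewrite E.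
apply/precP; exists h; split=> // [|c cF0 hc].
  have := bm_maxima h e; rewrite hE in_setU1 => /predU1P [E|].
    by case/negP: nhme; rewrite -bm_eq hm E.
  rewrite inE => /eqP E; have /eqP E' : bm g (bm h e) == bm g m.
    rewrite bm_eq same_sym; apply: same_trans gme _.
    by move/ltW/dpart_leP: hg; apply; apply: bm_same.
  by rewrite hm -E E' ltn_neqAle eq_sym gm le_bm.
have gc : (g <= c)%O.
  apply: (chain_lt cF cF0 gF); apply/negP => /rk_ltQ lt.
  by have := rk_ltQ hc; rewrite rkh ltnS => /(leq_trans lt); rewrite ltnn.
by move/dpart_leP: gc; apply.
Qed.

(** Take the step to the coarsest member that separates [u] and [v]. The half of the new maximum is
    listed first, so it is the half that contains [u]. *)
Lemma separating_step u v w : prec F u v -> same x u v -> w \in C ->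
  w != None -> ~~ same w u v ->
  exists g h m, [/\ [/\ stepQ C g h, rk h <= rk w & ~~ same h u v], h != None /\ same g u v,
    bm g m != m, maxima h = m |: maxima g & same h m u /\ u <= m].
Proof.
move=> uv xuv wC wN nw.
have P0 : (w \in C) && ~~ same w u v by rewrite wC.
case: (@arg_minnP _ w (fun c => (c \in C) && ~~ same c u v) (fun c => rk c) P0).
move=> h /andP [hC nh] hmin; have hw : rk h <= rk w by apply: hmin.
have hx : rk x < rk h.
  rewrite ltnNge; apply: contra nh => le; move: xuv.
  by apply/dpart_leP/C_le.
have [|g gC rkg] := full (r := (rk h).-1) hC.
  by rewrite leq_pred andbT -ltnS prednK // (leq_ltn_trans _ hx).
have rkh : rk h = (rk g).+1 by rewrite rkg prednK // (leq_ltn_trans _ hx).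
have guv : same g u v.
  by apply: contraT => ng; have := hmin g; rewrite gC ng rkh => /(_ isT); rewrite ltnn.
have hg : (h < g)%O.
  rewrite lt_neqAle C_le ?rkh // andbT; apply/eqP => E.
  by move: rkh; rewrite E => /eqP; rewrite eqn_leq ltnn andbF.
have st : stepQ C g h by rewrite /stepQ gC hC hg rkh eqxx.
have hN : h != None.
  by apply: contraTneq hw => ->; rewrite -ltnNge /=; apply: rk_lt_k.
have [m [gm hE gN]] := step_new st hN.
exists g, h, m; suff hmu : same h m u.
  split=> //; split=> //; have := bm_max hmu.
  by rewrite (cover_bm hE).
case/orP: (cover_two hg hE guv nh) => // hmv.
have gmv : same g m v by move/ltW/dpart_leP: hg; apply.
have gmu : same g m u by rewrite (same_eqr _ guv).
have nhmu : ~~ same h m u.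
  by apply: contra nh => hmu; rewrite -(same_eql _ hmu).
have := step_prec st hN gm hE gmv; rewrite hmv.
have := step_prec st hN gm hE gmu; rewrite (negbTE nhmu) => mu.
case/predU1P => [E|vm]; first by rewrite E (prec_asym cF mu) in uv.
by have := prec_trans cF vm mu; rewrite (prec_asym cF uv).
Qed.

End Steps.

(* The part of a maximal chain of an interval which lies above [y], with the
   chain [F] in which it is taken; [lam] strictly decreases along it. *)
Record descent (F C : {set Q}) x y : Prop := Descent {
  de_chain : @chain _ Q^d F;
  de_sub : C \subset F;
  de_top : x \in C;
  de_bot : y \in C;
  de_le : {in C, forall c, (c <= x)%O};
  de_full : forall w r, w \in C -> rk x <= r <= rk w -> exists2 c, c \in C & rk c = r;
  de_desc : forall g h g' h', stepQ C g h -> stepQ C g' h' -> rk h' <= rk y ->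
    (g' <= h)%O -> (lam g' h' < lam g h)%R
}.

Lemma lam_posE g h m : g != None -> h != None -> (h < g)%O -> bm g m != m ->
  maxima h = m |: maxima g -> (0 < lam g h)%R ->
  exists2 e, same g m e && ~~ same h m e & e < m.
Proof.
move=> gN hN hg gm hE; rewrite (lam_cover gN hN hg gm hE); case: ifP => // /negbT.
rewrite negb_forall => /existsP [e]; rewrite negb_imply -leqNgt => /andP [H le] _.
exists e => //; rewrite ltn_neqAle le andbT; apply: contraTneq H => /val_inj ->.
by rewrite !same_refl.
Qed.

Lemma lam_negE g h m e : g != None -> h != None -> (h < g)%O -> bm g m != m ->
  maxima h = m |: maxima g -> (lam g h < 0)%R -> same g m e -> ~~ same h m e -> m < e.
Proof.
move=> gN hN hg gm hE; rewrite (lam_cover gN hN hg gm hE); case: ifP => // /forallP H _ s ns.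
by have := H e; rewrite s ns.
Qed.

Section Clash.
Variables (F C F' C' : {set Q}) (x y z b b' : Q) (m m' : 'I_n).
Hypotheses (cF : @chain _ Q^d F) (CF : C \subset F) (de' : descent F' C' x y).
Hypotheses (yN : y != None) (yb : (y <= b)%O).
Hypotheses (st : stepQ C z b) (st' : stepQ C' z b') (rkb' : rk b' <= rk y).
Hypotheses (zm : bm z m != m) (bE : maxima b = m |: maxima z).
Hypothesis (bE' : maxima b' = m' |: maxima z).
Hypothesis same_order : forall e e', ~~ same y e e' -> prec F e e' -> prec F' e e'.

Lemma descents_clash : m != m' -> (lam z b' < lam z b)%R -> False.
Proof.
case: de' => cF' CF' xC' yC' C'x full' desc' nmm lt.
have bN : b != None := le_neq_None yN yb.
have leC' := C_le cF' CF'.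
have /and4P [zC bC bz /eqP rkb] := st; have /and4P [zC' bC' bz' /eqP rkb'z] := st'.
have yb' : (y <= b')%O := leC' _ _ bC' yC' rkb'.
have b'N : b' != None := le_neq_None yN yb'.
have zN := lt_neq_None bz.
have my : m \in maxima y by apply: (subsetP (maxima_le yb)); rewrite bE setU11.
have mb' : m \notin maxima b' by rewrite bE' !inE negb_or nmm.
(* [h] will be the coarsest member of [C'] with [m] among its maxima; there is one because [m] is a
   maximum of [y]. *)
have P0 : (y \in C') && (m \in maxima y) by rewrite yC'.
case: (@arg_minnP _ y (fun c => (c \in C') && (m \in maxima c)) (fun c => rk c) P0).
move=> h /andP [hC' mh] hmin; have hy : rk h <= rk y by apply: hmin; rewrite yC'.
have hN : h != None by apply: contraTneq hy => ->; rewrite -ltnNge /=; apply: rk_lt_k.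
have b'h : rk b' < rk h.
  rewrite ltnNge; apply: contra mb' => le; apply: (subsetP (maxima_le _)) mh.
  exact: leC'.
have xz : (z <= x)%O := C'x _ zC'.
have xb' : rk x < rk b' by rewrite rkb'z ltnS rk_leQ.
have [|g gC' rkg] := full' h (rk h).-1 hC'.
  by rewrite leq_pred andbT -ltnS prednK ?(ltn_trans xb') // (leq_ltn_trans _ b'h).
have rkh : rk h = (rk g).+1 by rewrite rkg prednK // (leq_ltn_trans _ b'h).
have hg : (h < g)%O.
  rewrite lt_neqAle leC' ?rkh // andbT; apply/eqP => E.
  by move: rkh; rewrite E => /eqP; rewrite eqn_leq ltnn andbF.
have sth : stepQ C' g h by rewrite /stepQ gC' hC' hg rkh eqxx.
have gb' : (g <= b')%O by apply: leC' => //; rewrite -ltnS -rkh.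
have [m2 [gm2 hE gN]] := step_new sth hN.
have E2 : m2 = m.
  move: mh; rewrite hE in_setU1 => /predU1P [//|mg].
  by have := hmin g; rewrite gC' mg rkh => /(_ isT); rewrite ltnn.
subst m2; have lt2 := desc' _ _ _ _ st' sth hy gb'.
have [lE lE'] := signed_pair (step_lam sth hN gm2 hE) (step_lam st bN zm bE) (lt_trans lt2 lt).
have [|e /andP [zme nbme] em] := lam_posE zN bN bz zm bE; first by rewrite lE' lab_pos.
have me : prec F m e by have := step_prec cF CF st bN zm bE zme; rewrite (negbTE nbme).
have nyme : ~~ same y m e by apply: contra nbme; apply/dpart_leP.
have me' := same_order nyme me.
(* The step from [g] to [h] cannot separate [m] from [e]: its label is negative, while [e] is
   smaller than [m] and listed after it. So they are separated earlier in [C']. *)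
have ngme : ~~ same g m e.
  apply/negP => gme; have := step_prec cF' CF' sth hN gm2 hE gme; case: ifP => [_|/negbT nh _].
    case/predU1P => [E|em']; first by rewrite E ltnn in em.
    by rewrite (prec_asym cF' me') in em'.
  have := lam_negE gN hN hg gm2 hE _ gme nh; rewrite lE lab_neg => /(_ isT).
  by rewrite ltnNge ltnW.
have xme : same x m e by move/dpart_leP: xz; apply.
have [g1 [h1 [m1 [[st1 h1g nh1] [h1N g1me] g1m1 h1E [_ mm1]]]]] :=
  separating_step cF' CF' xC' full' me' xme gC' gN ngme.
have /and4P [g1C h1C h1g1 /eqP rkh1] := st1.
have lt3 : (lam g h < lam g1 h1)%R.
  by apply: desc' st1 sth hy _; apply: leC'.
have rkzg1 : rk z <= rk g1.
  rewrite -ltnS -rkh1 ltnNge; apply/negP => le.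
  by case/negP: nh1; move: zme; apply/dpart_leP/leC'.
have le4 : (lam g1 h1 <= lam z b')%R.
  move: rkzg1; rewrite leq_eqVlt => /predU1P [E|zg1].
    have Eg : g1 = z by apply/eqP; rewrite eq_le !leC' ?E.
    have Eh : h1 = b' by apply/eqP; rewrite eq_le !leC' // rkh1 rkb'z Eg.
    by rewrite Eg Eh.
  apply/ltW/(desc' _ _ _ _ st' st1); last by apply: leC' => //; rewrite rkb'z.
  by apply: leq_trans h1g _; apply: leq_trans hy; rewrite rkh.
(* The label of that earlier step lies strictly between the two labels of [m], so its new maximum is
   below [m], against [m <= m1]. *)
have := signed_between (step_lam st1 h1N g1m1 h1E) (i := m).
rewrite -lE lt3 -lE' (le_lt_trans le4 lt) => /(_ isT isT).
by rewrite ltnNge mm1.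
Qed.
End Clash.

(** In either chain the half of [m] consists of [m] and the letters of the block listed before it; a
    letter on which the halves differ is separated from [m] by [y], where the orders agree. *)
Lemma step_blk_sub (F C F' C' : {set Q}) (y z b b' : Q) m :
  @chain _ Q^d F -> C \subset F -> @chain _ Q^d F' -> C' \subset F' ->
  stepQ C z b -> stepQ C' z b' -> y != None -> (y <= b)%O -> (y <= b')%O ->
  bm z m != m -> maxima b = m |: maxima z -> maxima b' = m |: maxima z ->
  (forall e e', ~~ same y e e' -> prec F' e e' -> prec F e e') ->
  forall e, same b m e -> same b' m e.
Proof.
move=> cF CF cF' CF' st st' yN yb yb' zm bE bE' order e be.
have bN := le_neq_None yN yb; have b'N := le_neq_None yN yb'.
have ze : same z m e.
  by case/and4P: st => _ _ /ltW/dpart_leP H _; apply: H.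
apply: contraT => nb'e; have nye : ~~ same y m e by apply: contra nb'e; apply/dpart_leP.
have := step_prec cF' CF' st' b'N zm bE' ze; rewrite (negbTE nb'e) => /(order _ _ nye) me.
have := step_prec cF CF st bN zm bE ze; rewrite be => /predU1P [E|em].
  by rewrite E prec_irr in me.
by rewrite (prec_asym cF em) in me.
Qed.

Section Unique.
Variables (F C F' C' : {set Q}) (x y : Q).
Hypotheses (de : descent F C x y) (de' : descent F' C' x y) (yN : y != None).
Hypothesis same_order : forall e e', ~~ same y e e' -> prec F e e' = prec F' e e'.

Lemma descent_step G D r c : descent G D x y -> c \in D -> rk c = r.+1 ->
  rk x <= r -> exists2 g, stepQ D g c & rk g = r.
Proof.
case=> cG DG xD yD Dx fullD _ cD rkc xr.
have [|g gD rkg] := fullD c r cD; first by rewrite xr rkc leqnSn.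
exists g => //; rewrite /stepQ gD cD rkc rkg eqxx andbT lt_neqAle.
rewrite (C_le cG DG) ?rkc ?rkg // andbT.
by apply/eqP => E; move: rkc; rewrite E rkg => /eqP; rewrite eqn_leq ltnn andbF.
Qed.

Lemma descent_start G D w : descent G D x y -> w \in D -> rk w <= rk x -> w = x.
Proof.
case=> cG DG xD _ Dx _ _ wD le; apply/eqP; rewrite eq_le Dx //=.
exact: (C_le cG DG).
Qed.

Lemma descent_unique r c c' : c \in C -> c' \in C' -> rk c = r -> rk c' = r ->
  rk x <= r <= rk y -> c = c'.
Proof.
case: (de) => cF CF xC yC Cx full desc; case: (de') => cF' CF' xC' yC' C'x full' desc'.
elim: r c c' => [|r IHr] c c' cC c'C rkc rkc' /andP [xr ry].
  have -> : c = x by apply: (descent_start de cC); rewrite rkc.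
  by apply/esym/(descent_start de' c'C); rewrite rkc'.
move: xr; rewrite leq_eqVlt => /predU1P [xr|xr].
  have -> : c = x by apply: (descent_start de cC); rewrite rkc xr.
  by apply/esym/(descent_start de' c'C); rewrite rkc' xr.
have [z st rkz] := descent_step de cC rkc xr.
have [z' st' rkz'] := descent_step de' c'C rkc' xr.
have Ez : z' = z.
  apply/esym/IHr => //; first by case/and4P: st.
    by case/and4P: st'.
  by rewrite -ltnS xr ltnW.
subst z'; have rc : rk c <= rk y by rewrite rkc.
have rc' : rk c' <= rk y by rewrite rkc'.
have yc : (y <= c)%O by apply: (C_le cF CF).
have yc' : (y <= c')%O by apply: (C_le cF' CF').
have cN := le_neq_None yN yc; have c'N := le_neq_None yN yc'.
have [m [zm cE zN]] := step_new st cN; have [m' [zm' cE' _]] := step_new st' c'N.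
have ord1 e e' : ~~ same y e e' -> prec F e e' -> prec F' e e' by move=> /same_order ->.
have ord2 e e' : ~~ same y e e' -> prec F' e e' -> prec F e e' by move=> /same_order ->.
case: (eqVneq m m') => [E|nmm].
  subst m'; have /and4P [_ _ cz _] := st; have /and4P [_ _ c'z _] := st'.
  apply: same_inj => a b; rewrite (cover_split cz cE) (cover_split c'z cE').
  suff -> : blk c m = blk c' m by [].
  apply/setP => e; rewrite !inE; apply/idP/idP.
    exact: (step_blk_sub cF CF cF' CF' st st' yN yc yc' zm cE cE' ord2).
  exact: (step_blk_sub cF' CF' cF CF st' st yN yc' yc zm cE' cE ord1).
exfalso; case: (ltgtP (lam z c') (lam z c)) => [lt|lt|E].
- exact: (descents_clash cF CF de' yN yc st st' rc' zm cE cE' ord1 nmm lt).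
- rewrite eq_sym in nmm.
  exact: (descents_clash cF' CF' de yN yc' st' st rc zm' cE' cE ord2 nmm lt).
have s := step_lam st cN zm cE; have s' := step_lam st' c'N zm' cE'.
rewrite E in s'; case/eqP: nmm; apply/val_inj/(signed_inj s s').
Qed.

End Unique.

Section FinalStep.
Variables (F C : {set Q}) (cF : @chain _ Q^d F) (x D : Q).
Hypotheses (de : descent F C x D) (rkD : (rk D).+1 = k).
Hypothesis pos_lam : forall g h, stepQ C g h -> rk h <= rk D -> (0 < lam g h)%R.

(** Suppose the ascent [u], [v] at the cut [i] lies inside a block of [x]. The step separating them
    has new maximum [u], and its positive label yields a letter [e] smaller than [u] on the side of
    [v]. Since [v] is listed before [e], a later step separates these two; its new maximum is at
    least [v], so the labels increase. *)
Lemma no_inner_ascent i I : SW (gamma cF) x I (ascents cF :&: I) ->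
  i \in ascents cF -> i \in I.
Proof.
case: (de) => _ CF xC DC Cx full desc xI ia; apply: contraT => iI.
have leC := C_le cF CF.
have i0 : 0 < i := nonzero_ascents ia.
have qn := cut_lt_n i; have q0 : 0 < d * i by rewrite muln_gt0 d_gt0.
have pn : (d * i).-1 < n := leq_ltn_trans (leq_pred _) qn.
pose p := Ordinal pn; pose q := Ordinal qn.
have pE : p.+1 = d * i by rewrite /= prednK.
have qE : q = d * i :> nat by []; have pq : p.+1 = q by rewrite pE.
set u := omega cF p; set v := omega cF q.
have posu : pos cF u = p by rewrite omegaK.
have posv : pos cF v = q by rewrite omegaK.
have uv : u < v by rewrite -(ascentsP cF pE qE).
have puv : prec F u v by rewrite -omega_lt -pq.
have seg_uv J c : c \in F -> SW (gamma cF) c J (ascents cF :&: J) ->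
    same c u v = (i \notin J).
  move=> _ cJ; have VW : {in J, ascents cF :&: J =i ascents cF}.
    by move=> j jJ; rewrite inE jJ andbT.
  rewrite (SW_seg (nonzero_ascents (cC := cF)) cJ VW) !po_gamma posu posv.
  exact: seg_step pq qE.
have xuv : same x u v by rewrite (seg_uv _ _ (subsetP CF _ xC) xI).
have DN : D != None.
  by apply/eqP => E; move: rkD; rewrite E /= => /eqP; rewrite eqn_leq ltnn.
have nDuv : ~~ same D u v.
  have [J DJ _] := gamma_SW cF (subsetP CF _ DC) DN.
  rewrite (seg_uv _ _ (subsetP CF _ DC) DJ) negbK.
  have [J0 _ _ _] := DJ; suff -> : J = cuts by rewrite inE.
  apply/eqP; rewrite eqEcard sub_cuts // card_cuts -(rk_SW DJ) -rkD.
  exact: leqnn.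
have [g [h [m [[st hD nh] [hN guv] gm hE [hmu _]]]]] :=
  separating_step cF CF xC full puv xuv DC DN nDuv.
have /and4P [gC hC hg /eqP rkh] := st.
have hF : h \in (None : Q) |: F by rewrite setU1r // (subsetP CF).
have um : u = m.
  apply/eqP/negPn/negP => num; have bu : bm h u = m.
    by rewrite -(cover_bm hE); apply/eqP; rewrite bm_eq same_sym.
  have pum : prec F u m by rewrite -bu; apply: prec_bm => //; rewrite bu.
  case: (eqVneq v m) => [E|nvm].
    by case/negP: nh; rewrite same_sym E.
  have pvm : prec F v m.
    rewrite -(pos_lt cF) posv ltn_neqAle -pq -posu pos_lt pum andbT posu pq.
    by rewrite -posv; apply: contra nvm => /eqP/val_inj/perm_inj ->.
  case/negP: nh; apply: (prec_contig cF hF _ puv pvm).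
  by rewrite same_sym.
subst m; have gN := lt_neq_None hg.
have [|e /andP [gue nhue] eu] := lam_posE gN hN hg gm hE; first exact: pos_lam.
have gve : same g v e by rewrite -(same_eql _ guv).
have hve : same h v e.
  apply: contraT => nve; case/orP: (cover_two hg hE gve nve) => [uv'|ue].
    by rewrite uv' in nh.
  by rewrite ue in nhue.
have ev : e < v := ltn_trans eu uv.
have pve : prec F v e.
  have nve : v != e by apply: contraTneq ev => ->; rewrite ltnn.
  case/orP: (prec_total F nve) => // pev.
  have pue : prec F e u.
    have neu : e != u by apply: contraTneq eu => ->; rewrite ltnn.
    case/orP: (prec_total F neu) => // pue.
    by move: pev pue; rewrite -!(pos_lt cF) posu posv -pq ltnS leqNgt => /negbTE ->.
  case/negP: nhue; rewrite same_sym; apply: (prec_contig cF hF _ pue puv).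
  by rewrite same_sym.
(* Only the bottom lies strictly below [D]. If [D] kept [v] and [e] together, the bottom would
   decide their order and list [e] first. *)
have nDve : ~~ same D v e.
  apply/negP => Dve; have /precP [c [cF0 lt above]] := pve.
  have [cN|cN] := eqVneq c None.
    by move: lt; rewrite cN !bm_None ltnNge ltnW.
  have DF : D \in (None : Q) |: F by rewrite setU1r // (subsetP CF).
  have cD : (c < D)%O.
    have [|/(chain_lt cF cF0 DF) Dc] := boolP (c < D)%O; first by [].
    have : same c v e by move/dpart_leP: Dc; apply.
    by rewrite -bm_eq => /eqP E; rewrite E ltnn in lt.
  have := leq_ltn_trans (rk_ltQ cD) (rk_lt_k cN).
  by rewrite rkD ltnn.
have xve : same x v e.
  by move/dpart_leP: (Cx _ gC); apply.
have [g2 [h2 [m2 [[st2 h2D nh2] [h2N g2ve] g2m h2E [_ vm2]]]]] :=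
  separating_step cF CF xC full pve xve DC DN nDve.
have /and4P [g2C h2C h2g2 /eqP rkh2] := st2.
have rkhg2 : rk h <= rk g2.
  rewrite -ltnS -rkh2 ltnNge; apply: contra nh2 => le.
  by move: hve; apply/dpart_leP/leC.
have lt := desc _ _ _ _ st st2 h2D (leC _ _ hC g2C rkhg2).
move: lt; rewrite (signed_pos (step_lam st2 h2N g2m h2E) (ltW (pos_lam st2 h2D))).
rewrite (signed_pos (step_lam st hN gm hE) (ltW (pos_lam st hD))) lab_lt.
by rewrite ltnNge ltnW // (leq_trans uv).
Qed.
End FinalStep.
End DescendingChains.

(** * The facets of the complexes and the conditions of an EL-ced *)

Section Decomposition.
Implicit Types (c g h w x y : Q) (a b e p q u v : 'I_n) (i j : 'I_k) (I J V W : {set 'I_k}).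
Implicit Types (alpha beta : 'S_n).

Lemma None_le x : ((None : Q) <= x)%O.
Proof. by case: x. Qed.

Section SigmaPolytope.
Import classical_sets.
Local Open Scope classical_set_scope.

(** Quantifying over all pairs [I], [W] in [f] avoids choosing the sign vector of [x], which
    [SW_unique] shows to be unique. *)
Lemma Sigma_polytope (R : realType) alpha :
  is_face_lattice R (Sigma d alpha : {set Q^d}).
Proof.
pose f (x : Q^d) : set 'rV[R]_k := if x is None then cross cuts else
  cross cuts `&` [set v | forall I W, SW alpha x I W -> dot (sgn I W) v = 1%R].
have fE (x : Q) I W : SW alpha x I W -> f x = face_of cuts I W.
  move=> xI; have [_ _ + _] := xI; rewrite /f; case: (x) xI => [p|] // xI _.
  congr (_ `&` _); apply/seteqP; split=> v /=; first exact.
  by move=> E J V /(SW_unique xI) [<- <-].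
have SWf (x : Q) : x \in Sigma d alpha -> x != None ->
    exists I W, SW alpha x I W /\ f x = face_of cuts I W.
  by move=> xS xN; have [I [W xI]] := Sigma_SW xS xN; exists I, W; rewrite -(fE _ _ _ xI).
exists k, (cross cuts), f; split.
- exact: polytope_cross.
- move=> x xS; case: (eqVneq (x : Q) None) => [->|xN]; first exact: face_cross.
  by have [I [W [_ ->]]] := SWf x xS xN; apply: face_face_of.
- move=> G /face_cases [->|[I [W [IC WI ->]]]].
    by exists (None : Q) => //; rewrite inE.
  have [x xI xS] := SW_ex alpha (nonzeroS IC nonzero_cuts) WI.
  by exists (x : Q) => //; apply: fE.
move=> x y xS yS; rewrite leEdual.
case: (eqVneq (y : Q) None) => [->|yN].
  split=> [_|_]; last exact: None_le.
  case: (eqVneq (x : Q) None) => [-> //|xN].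
  by have [I [W [_ ->]]] := SWf x xS xN; move=> v [].
have [J [V [yJ ->]]] := SWf y yS yN; case: (eqVneq (x : Q) None) => [->|xN].
  split=> [|/cross_not_sub //].
  by move=> /(le_neq_None yN); rewrite eqxx.
have [I [W [xI ->]]] := SWf x xS xN.
have [I0 WI _ _] := xI; have [J0 VJ _ _] := yJ.
rewrite (face_of_sub (sub_cuts I0) WI VJ); split=> [yx|[IJ WE]].
  by split; [exact: SW_sub yJ xI yx | exact: SW_switch yJ xI yx].
exact: SW_le yJ xI IJ WE.
Qed.

End SigmaPolytope.

Lemma Sigma_top alpha : exists x : Q, [/\ x \in Sigma d alpha, rk x = 0 &
  forall y, (y <= x)%O].
Proof.
have z0 : nonzero (set0 : {set 'I_k}) by move=> i; rewrite inE.
have [x xI xS] := SW_ex alpha z0 (sub0set set0).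
exists x; split=> //; first by rewrite (rk_SW xI) cards0.
move=> y; apply/dpart_leP => a b _; have [_ _ _ ->] := xI.
by apply/forall_inP => i; rewrite inE.
Qed.

Lemma rank_Sigma alpha : graded_rank k (Sigma d alpha : {set Q^d}).
Proof.
have [t [tS rt le_t]] := Sigma_top alpha.
move=> C; apply: (max_chain_card rk_lt_dual (b := (t : Q^d)) (t := (None : Q) : Q^d)) => //.
- by rewrite inE.
- move=> x _; exact: (le_t x).
exact: gapless_Sigma.
Qed.

Lemma rank_Q : graded_rank k [set: Q^d].
Proof.
have [t [_ rt le_t]] := Sigma_top 1%g.
move=> C; apply: (max_chain_card rk_lt_dual (b := (t : Q^d)) (t := (None : Q) : Q^d));
  rewrite ?inE //; last exact: gapless_dual.
move=> x _; exact: (le_t x).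
Qed.

Notation L := (sort (@rr_lex n) (enum (A_set n d))).

Lemma size_Sigmas : size (Sigmas n d) = size L.
Proof. by rewrite size_map. Qed.

Lemma nth_Sigmas s : s < size (Sigmas n d) ->
  nth finset.set0 (Sigmas n d) s = Sigma d (nth 1%g L s).
Proof. by rewrite size_map => sL; rewrite (nth_map 1%g). Qed.

Lemma mem_L alpha : (alpha \in L) = (alpha \in A_set n d).
Proof. by rewrite mem_sort mem_enum. Qed.

Lemma nth_L_A s : s < size (Sigmas n d) -> nth 1%g L s \in A_set n d.
Proof. by rewrite size_Sigmas => sL; rewrite -mem_L mem_nth. Qed.

Lemma sorted_L : sorted (@rr_lex n) L.
Proof. exact/sort_sorted/rr_lex_total. Qed.

Lemma uniq_L : uniq L.
Proof. by rewrite sort_uniq enum_uniq. Qed.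

Lemma nth_L_le s t : t < size L -> s <= t -> rr_lex (nth 1%g L s) (nth 1%g L t).
Proof.
move=> tL st; apply: (sorted_leq_nth (@rr_lex_trans n) (@rr_lex_refl n)) => //.
- exact: sorted_L.
- by rewrite inE (leq_ltn_trans st).
Qed.

(** As [F] lies in the [s]-th member, [gamma cF] is not later than its word; as [F] also lies in
    [Sigma d (gamma cF)] and in no earlier member, it is not earlier either. *)
Lemma facet_gamma s (F : {set Q^d}) : s < size (Sigmas n d) ->
  Delta_facet (Sigmas n d : seq {set Q^d}) s F ->
  exists cF : @chain _ Q^d F, [/\ max_chain [set: Q^d] F,
    F \subset Sigma d (nth 1%g L s) & gamma cF = nth 1%g L s].
Proof.
move=> sS /and3P [mF FS /allP first]; have [cF _ _] := max_chainP _ _ mF.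
rewrite (nth_Sigmas sS) in FS; exists cF; split=> //.
set alpha := nth 1%g L s in FS *.
have le : rr_lex (gamma cF) alpha by apply: gamma_le => //; apply: nth_L_A.
have gL : gamma cF \in L by rewrite mem_L gamma_A.
have sL : s < size L by rewrite -size_Sigmas.
set t := index (gamma cF) L; have tL : t < size L by rewrite index_mem.
have tE : nth 1%g L t = gamma cF by rewrite nth_index.
case: (ltnP t s) => [ts|st].
  have : Sigma d (gamma cF) \in take s (Sigmas n d).
    rewrite -tE -(nth_map 1%g finset.set0 (Sigma d)) // -(nth_take finset.set0 ts).
    by rewrite mem_nth // size_take size_Sigmas sL.
  by move/first; rewrite gamma_Sigma.
apply: rr_lex_anti; rewrite le /= -tE; exact: nth_L_le.
Qed.

Lemma interval_Q (x y : Q^d) (C : {set Q^d}) : max_chain (interval x y) C ->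
  {in C, forall c : Q, (y <= c :> Q)%O && (c <= x :> Q)%O}.
Proof.
move=> /max_chainP [_ /subsetP CS _] c /CS; rewrite mem_interval => /andP [xc cy].
by apply/andP; split; [exact: cy | exact: xc].
Qed.

Lemma max_chain_descent (x y : Q^d) (C F : {set Q^d}) (w : Q) : (x <= y)%O ->
  max_chain (interval x y) C -> chain F -> C \subset F ->
  descending (@lam n d : Q^d -> Q^d -> int) C -> w \in C -> descent F C x w.
Proof.
move=> xy mC cF CF dC wC; split=> //.
- exact: (max_chain_int_bot xy mC).
- by move=> c /(interval_Q mC) /andP [].
- move=> v r vC /andP [xr rv].
  apply: (max_chain_int_rank rk_lt_dual gapless_dual xy mC).
  by rewrite xr (leq_trans rv) // rk_leQ //; case/andP: (interval_Q mC vC).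
move=> g h g' h' st st' _ le.
exact: (descending_steps rk_lt_dual gapless_dual xy mC dC st st' le).
Qed.

Section Order.
Variables (F F' : {set Q^d}) (cF : chain F) (cF' : chain F').
Hypothesis E : gamma cF = gamma cF'.

Lemma common_SW y : y \in F -> y \in F' -> y != None -> exists I,
  [/\ SW (gamma cF) y I (ascents cF :&: I), SW (gamma cF') y I (ascents cF' :&: I)
    & ascents cF :&: I = ascents cF' :&: I].
Proof.
move=> yF yF' yN; have [I yI _] := gamma_SW cF yF yN.
have [I' yI' _] := gamma_SW cF' yF' yN; have yI2 := yI'; rewrite -E in yI2.
by have [EI EW] := SW_unique yI yI2; subst I'; exists I.
Qed.

(** Letters separated by [y] lie on different sides of one of its cuts. There both chains make the
    same switch, so both list the same letter first. *)
Lemma common_order y : y \in F -> y \in F' -> y != None ->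
  forall e e', ~~ same y e e' -> prec F e e' = prec F' e e'.
Proof.
move=> yF yF' yN; have [I [yI _ EW]] := common_SW yF yF' yN.
have [I0 _ _ _] := yI.
have cutE i e : i \in I -> (d * i <= pos cF e) = (d * i <= pos cF' e).
  move=> iI; rewrite -!po_gamma /po !cut_switch; try exact: nonzero_ascents.
  by rewrite E; move/setP/(_ i): EW; rewrite !inE iI !andbT => ->.
have VW : {in I, ascents cF :&: I =i ascents cF}.
  by move=> i iI; rewrite inE iI andbT.
move=> e e'; rewrite (SW_seg (nonzero_ascents (cC := cF)) yI VW) !po_gamma.
rewrite negb_forall_in => /exists_inP [i iI]; rewrite -!(pos_lt cF) -(pos_lt cF').
have := cutE i e iI; have := cutE i e' iI.
case: (leqP (d * i) (pos cF e)) => l1; case: (leqP (d * i) (pos cF e')) => l2 //.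
- move=> /esym/negbT l2' /esym l1' _; rewrite -ltnNge in l2'.
  rewrite ltnNge (leq_trans (ltnW l2) l1) ltnNge /=.
  by rewrite (leq_trans (ltnW l2') l1').
move=> /esym l2' /esym/negbT l1' _; rewrite -ltnNge in l1'.
by rewrite (leq_trans l1 l2) (leq_trans l1' l2').
Qed.
End Order.


Lemma SW_fun alpha x y I W : SW alpha x I W -> SW alpha y I W -> x = y.
Proof. by move=> [_ _ _ xE] [_ _ _ yE]; apply: same_inj => a b; rewrite xE yE. Qed.

Section Descent.
Variables (F : {set Q^d}) (cF : chain F) (x y : Q^d) (C : {set Q^d}).
Hypotheses (xy : (x <= y)%O) (mC : max_chain (interval x y) C) (CF : C \subset F).
Hypotheses (dC : descending (@lam n d : Q^d -> Q^d -> int) C).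
Hypothesis yE : (y : Q) = None.

(** The chain ends with the step from [D] to the bottom, whose label is 0. *)
Lemma descent_pos D g h : D \in C -> (rk D).+1 = k ->
  stepQ C g h -> rk h <= rk D -> (0 < lam g h)%R.
Proof.
move=> DC rkD st le; have yC := max_chain_int_top xy mC.
have stD : stepQ C D None.
  rewrite /stepQ DC -{1}yE yC /= rkD eqxx andbT lt_neqAle None_le andbT.
  by apply: contraTneq isT => DE; move: rkD; rewrite -DE /= => /eqP; rewrite eqn_leq ltnn.
rewrite -(lam_None D).
apply: (descending_steps rk_lt_dual gapless_dual xy mC dC st stD).
by case/and4P: st => _ hC _ _; apply: (C_le cF CF).
Qed.

Lemma descent_penultimate : (x : Q) != None ->
  exists2 D : Q, D \in C & (rk D).+1 = k /\ SW (gamma cF) D cuts (ascents cF).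
Proof.
move=> xN; have [|D DC rkD] := max_chain_int_rank rk_lt_dual gapless_dual xy mC (r := k.-1).
  by rewrite -ltnS prednK ?k_gt0 // rk_lt_k //= yE leq_pred.
have {}rkD : (rk D).+1 = k by rewrite [rk D]rkD prednK ?k_gt0.
have DN : (D : Q) != None.
  by apply: contraTneq isT => DE; move: rkD; rewrite DE /= => /eqP; rewrite eqn_leq ltnn.
exists (D : Q) => //; split=> //.
have [J DJ J0] := gamma_SW cF (subsetP CF _ DC) DN.
have JE : J = cuts.
  apply/eqP; rewrite eqEcard sub_cuts // card_cuts -(rk_SW DJ) -rkD.
  exact: leqnn.
by move: DJ; rewrite JE (setIidPl (sub_cuts (nonzero_ascents (cC := cF)))).
Qed.

Lemma descent_ascents I : (x : Q) != None ->
  SW (gamma cF) x I (ascents cF :&: I) -> ascents cF \subset I.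
Proof.
move=> xN xI; have [D DC [rkD _]] := descent_penultimate xN.
apply/subsetP => i.
apply: (no_inner_ascent (max_chain_descent xy mC cF CF dC DC) rkD _ xI).
by move=> g h; apply: descent_pos.
Qed.

End Descent.

Section Descents.
Variables (F F' : {set Q^d}) (cF : chain F) (cF' : chain F').
Hypothesis E : gamma cF = gamma cF'.
Variables (x y : Q^d) (C C' : {set Q^d}).
Hypotheses (xy : (x <= y)%O).
Hypotheses (mC : max_chain (interval x y) C) (mC' : max_chain (interval x y) C').
Hypotheses (dC : descending (@lam n d : Q^d -> Q^d -> int) C).
Hypotheses (dC' : descending (@lam n d : Q^d -> Q^d -> int) C').
Hypotheses (CF : C \subset F) (CF' : C' \subset F').

Lemma descents_agree w c : w \in C -> w \in C' -> w != None -> c \in C ->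
  rk c <= rk w -> c \in C'.
Proof.
move=> wC wC' wN cC le; have /andP [yc cx] := interval_Q mC cC.
have [|c' c'C rkc'] := max_chain_int_rank rk_lt_dual gapless_dual xy mC' (r := rk c).
  by rewrite !rk_leQ.
have de := max_chain_descent xy mC cF CF dC wC.
have de' := max_chain_descent xy mC' cF' CF' dC' wC'.
have ord := common_order E (subsetP CF _ wC) (subsetP CF' _ wC') wN.
have -> // : c = c'.
apply: (descent_unique de de' wN ord cC c'C (erefl (rk c))); first exact: rkc'.
by rewrite le rk_leQ.
Qed.

(** If [y] is not the bottom, it is the common lower member. Otherwise the ascents of both facets
    are cuts of [x], where they coincide, so both chains have the same last partition [D], which
    takes the place of [y]. *)
Lemma descending_sub : C \subset C'.
Proof.
have xC := max_chain_int_bot xy mC; have xC' := max_chain_int_bot xy mC'.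
have yC := max_chain_int_top xy mC; have yC' := max_chain_int_top xy mC'.
apply/subsetP => c cC; have /andP [yc cx] := interval_Q mC cC.
case: (eqVneq (y : Q) None) => [yE|yN]; last first.
  by apply: descents_agree yC yC' yN cC _; apply: rk_leQ.
case: (eqVneq (c : Q) None) => [->|cN]; first by rewrite -yE.
have xN : (x : Q) != None := le_neq_None cN cx.
have [D DC [rkD DF]] := descent_penultimate cF xy mC CF yE xN.
have [D' DC' [_ DF']] := descent_penultimate cF' xy mC' CF' yE xN.
have [I [xI xI' EW]] := common_SW E (subsetP CF _ xC) (subsetP CF' _ xC') xN.
have A := descent_ascents xy mC CF dC yE xN xI.
have A' := descent_ascents xy mC' CF' dC' yE xN xI'.
have EA : ascents cF = ascents cF' by rewrite -(setIidPl A) EW (setIidPl A').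
rewrite -E -EA in DF'; have ED := SW_fun DF DF'; subst D'.
have [_ _ DN _] := DF; apply: (descents_agree DC DC' DN cC).
by rewrite -ltnS rkD rk_lt_k.
Qed.
End Descents.

Lemma descending_unique (F F' : {set Q^d}) (cF : chain F) (cF' : chain F')
    (x y : Q^d) (C C' : {set Q^d}) :
  gamma cF = gamma cF' -> (x <= y)%O ->
  max_chain (interval x y) C -> max_chain (interval x y) C' ->
  descending (@lam n d : Q^d -> Q^d -> int) C ->
  descending (@lam n d : Q^d -> Q^d -> int) C' ->
  C \subset F -> C' \subset F' -> C = C'.
Proof.
move=> E xy mC mC' dC dC' CF CF'; apply/eqP; rewrite eqEsubset.
rewrite (descending_sub E xy mC mC' dC dC' CF CF').
exact: (descending_sub (esym E) xy mC' mC dC' dC CF' CF).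
Qed.

(** The facet [G] shows that [C] lies in the [Sigma] of an earlier word, so [gamma cC] is earlier
    than [alpha] and [boundary_extension] applies. *)
Lemma boundary (s t : nat) (C F G : {set Q^d}) :
  s < size (Sigmas n d) -> t < s -> chain C ->
  Delta_facet (Sigmas n d : seq {set Q^d}) s F -> C \subset F ->
  Delta_facet (Sigmas n d : seq {set Q^d}) t G -> C \subset G ->
  exists H : {set Q^d}, [/\ @max_chain _ Q^d (nth finset.set0 (Sigmas n d) s) H, C \subset H
    & ~~ Delta_facet (Sigmas n d : seq {set Q^d}) s H].
Proof.
move=> sS ts cC dF CF dG CG; have tS := ltn_trans ts sS.
have [cF [_ FS gF]] := facet_gamma sS dF; have [cG [_ GS gG]] := facet_gamma tS dG.
set alpha := nth 1%g L s in FS gF *; set beta := nth 1%g L t in GS gG *.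
have CA : C \subset Sigma d alpha := subset_trans CF FS.
have alphaA : alpha \in A_set n d := nth_L_A sS.
have sL : s < size L by rewrite -size_Sigmas.
have first : gamma cC != alpha.
  apply/eqP => gC; have : rr_lex (gamma cC) beta.
    by apply: gamma_le; [exact: nth_L_A | exact: subset_trans CG GS].
  rewrite gC => ab; have : alpha = beta.
    by apply: rr_lex_anti; rewrite ab; apply: nth_L_le => //; apply: ltnW.
  move/eqP; rewrite nth_uniq ?uniq_L // ?(ltn_trans ts) //.
  by rewrite gtn_eqF.
have [I [W [WI I0 cSW cI]]] := Sigma_chain cC CA.
have [H [mH CH nfirst]] := boundary_extension alphaA CA first WI I0 cSW cI.
exists H; rewrite nth_Sigmas //; split; [exact: mH | exact: CH |].
apply/negP => dH; have [cH [_ _ gH]] := facet_gamma sS dH.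
by move: (nfirst cH); rewrite gH eqxx.
Qed.

Theorem dual_EL_ced_Sigmas (R : realType) :
  dual_EL_ced R k (@lam n d) (Sigmas n d).
Proof.
have SgP S : S \in Sigmas n d -> exists alpha, S = Sigma d alpha.
  by case/mapP => alpha _ ->; exists alpha.
split.
- have [t [_ _ le_t]] := Sigma_top 1%g.
  split; first by exists (t : Q^d) => x; apply: le_t.
  by exists (None : Q) => x; apply: None_le.
- exact: rank_Q.
- exact: dual_EL.
- by move=> S /SgP [alpha ->]; apply: rank_Sigma.
- by move=> S /SgP [alpha ->]; apply: Sigma_polytope.
- move=> s x y C D sS xy mC mD dC dD [F dF CF] [G dG CG].
  have [cF [_ _ gF]] := facet_gamma sS dF; have [cG [_ _ gG]] := facet_gamma sS dG.
  by apply: (descending_unique (cF := cF) (cF' := cG) _ xy mC mD dC dD CF CG); rewrite gF gG.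
- move=> s t C sS ts cC _ [F dF CF] [G dG CG].
  exact: boundary ts cC dF CF dG CG.
move=> C cC; exists (Sigma d (gamma cC)); last exact: gamma_Sigma.
by apply: map_f; rewrite mem_L gamma_A.
Qed.
End Decomposition.

End Divisible.

Theorem theorem3p8 (R : realType) (n d : nat) :
  1 < d -> 0 < n -> d %| n ->
  dual_EL_ced R (n %/ d) (@lam n d) (Sigmas n d).
Proof. by move=> d_gt1 n_gt0 d_dvd; apply: dual_EL_ced_Sigmas. Qed.
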